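(* Let $\varphi(\alpha)$ be a $\forall\Sigma^0_2$ formula of second-order arithmetic. If $\mathsf{WKL_0}+\mathrm{RT}^2_2$ proves $\forall\alpha<\omega^\omega\,(\mathrm{WO}(\alpha)\to\varphi(\alpha))$, then $\mathsf{RCA_0}$ proves $\forall\alpha<\omega^\omega\,(\mathrm{WO}(\alpha)\to\varphi(\alpha))$.
   Context: $\mathsf{RCA_0}$ is the second-order arithmetic theory consisting of basic axioms for $\mathbb{N}$ as a discrete ordered semiring, $\Delta^0_1$-comprehension and $\Sigma^0_1$-induction. $\mathsf{WKL_0}$ is $\mathsf{RCA_0}$ plus weak König's lemma (every infinite binary tree has an infinite path). $\mathrm{RT}^2_2$ is the statement: for every $P:[\mathbb{N}]^2\to2$ there is an infinite $P$-homogeneous set. A $\Sigma^0_n$ formula has no second-order quantifiers and consists of at most $n$ alternating first-order quantifiers beginning with $\exists$ followed by a formula with only bounded quantifiers; a $\forall\Sigma^0_n$ formula is a block of universal (possibly second-order) quantifiers followed by a $\Sigma^0_n$ formula. Ordinals $<\omega^\omega$ are coded by codes of non-increasing finite sequences $\langle n_0,\dots,n_{k-1}\rangle$ representing $\omega^{n_0}+\dots+\omega^{n_{k-1}}$, with the usual ordinal ordering; $\alpha<\omega^\omega$ ranges over such codes. $\mathrm{WO}(\alpha)$ is the statement that there is no infinite descending sequence of ordinals starting from $\alpha$. *)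

(* Defs.v *)
(* Syntax, deductive calculus and axiom systems of
   second-order arithmetic (two-sorted first-order logic, language
   0,1,+,*,<,=,∈), with de Bruijn indices (separate index spaces for
   number variables and set variables). *)
From Stdlib Require Import List Arith.
Import ListNotations.

Inductive term : Type :=
| tvar (n : nat) | tzero | tone
| tplus (a b : term) | ttimes (a b : term).

Inductive form : Type :=
| feq (a b : term)
| flt (a b : term)
| fmem (a : term) (X : nat)     (* a ∈ X   (X = set variable index) *)
| fbot
| fimp (p q : form) | fand (p q : form) | forr (p q : form)
| fall (p : form) | fex (p : form)
| fall2 (p : form) | fex2 (p : form).

Definition fnot (p : form) : form := fimp p fbot.
Definition fiff (p q : form) : form := fand (fimp p q) (fimp q p).

Fixpoint tsubst (s : nat -> term) (t : term) : term :=
  match t with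
  | tvar n => s n
  | tzero => tzero
  | tone => tone
  | tplus a b => tplus (tsubst s a) (tsubst s b)
  | ttimes a b => ttimes (tsubst s a) (tsubst s b)
  end.

Definition tlift (t : term) : term := tsubst (fun n => tvar (S n)) t.

Definition upN (s : nat -> term) : nat -> term :=
  fun n => match n with 0 => tvar 0 | S k => tlift (s k) end.
Definition upS (r : nat -> nat) : nat -> nat :=
  fun n => match n with 0 => 0 | S k => S (r k) end.

Fixpoint fsubst (s : nat -> term) (r : nat -> nat) (p : form) : form :=
  match p with
  | feq a b => feq (tsubst s a) (tsubst s b)
  | flt a b => flt (tsubst s a) (tsubst s b)
  | fmem a X => fmem (tsubst s a) (r X)
  | fbot => fbot
  | fimp p q => fimp (fsubst s r p) (fsubst s r q)
  | fand p q => fand (fsubst s r p) (fsubst s r q)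
  | forr p q => forr (fsubst s r p) (fsubst s r q)
  | fall p => fall (fsubst (upN s) r p)
  | fex p => fex (fsubst (upN s) r p)
  | fall2 p => fall2 (fsubst s (upS r) p)
  | fex2 p => fex2 (fsubst s (upS r) p)
  end.

Definition liftN (p : form) : form := fsubst (fun n => tvar (S n)) (fun X => X) p.
Definition liftS (p : form) : form := fsubst tvar S p.
Definition instN (p : form) (t : term) : form :=
  fsubst (fun n => match n with 0 => t | S k => tvar k end) (fun X => X) p.
Definition instS (p : form) (j : nat) : form :=
  fsubst tvar (fun n => match n with 0 => j | S k => k end) p.

Inductive nd : list form -> form -> Prop :=
| nd_ax G p : In p G -> nd G p
| nd_raa G p : nd (fnot p :: G) fbot -> nd G p
| nd_impI G p q : nd (p :: G) q -> nd G (fimp p q)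
| nd_impE G p q : nd G (fimp p q) -> nd G p -> nd G q
| nd_andI G p q : nd G p -> nd G q -> nd G (fand p q)
| nd_andE1 G p q : nd G (fand p q) -> nd G p
| nd_andE2 G p q : nd G (fand p q) -> nd G q
| nd_orI1 G p q : nd G p -> nd G (forr p q)
| nd_orI2 G p q : nd G q -> nd G (forr p q)
| nd_orE G p q r : nd G (forr p q) -> nd (p :: G) r -> nd (q :: G) r -> nd G r
| nd_allI G p : nd (map liftN G) p -> nd G (fall p)
| nd_allE G p t : nd G (fall p) -> nd G (instN p t)
| nd_exI G p t : nd G (instN p t) -> nd G (fex p)
| nd_exE G p q : nd G (fex p) -> nd (p :: map liftN G) (liftN q) -> nd G q
| nd_all2I G p : nd (map liftS G) p -> nd G (fall2 p)
| nd_all2E G p j : nd G (fall2 p) -> nd G (instS p j)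
| nd_ex2I G p j : nd G (instS p j) -> nd G (fex2 p)
| nd_ex2E G p q : nd G (fex2 p) -> nd (p :: map liftS G) (liftS q) -> nd G q
| nd_refl G t : nd G (feq t t)
| nd_leib G p s t : nd G (feq s t) -> nd G (instN p s) -> nd G (instN p t).

Definition theory := form -> Prop.
Definition Provable (T : theory) (p : form) : Prop :=
  exists G : list form, (forall q, In q G -> T q) /\ nd G p.

Fixpoint tfv (t : term) : nat :=
  match t with
  | tvar n => S n
  | tzero | tone => 0
  | tplus a b | ttimes a b => Nat.max (tfv a) (tfv b)
  end.
Fixpoint ffvN (p : form) : nat :=
  match p with
  | feq a b | flt a b => Nat.max (tfv a) (tfv b)
  | fmem a _ => tfv a
  | fbot => 0
  | fimp p q | fand p q | forr p q => Nat.max (ffvN p) (ffvN q)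
  | fall p | fex p => pred (ffvN p)
  | fall2 p | fex2 p => ffvN p
  end.
Fixpoint ffvS (p : form) : nat :=
  match p with
  | feq _ _ | flt _ _ | fbot => 0
  | fmem _ X => S X
  | fimp p q | fand p q | forr p q => Nat.max (ffvS p) (ffvS q)
  | fall p | fex p => ffvS p
  | fall2 p | fex2 p => pred (ffvS p)
  end.
Fixpoint allsN (n : nat) (p : form) : form :=
  match n with 0 => p | S k => fall (allsN k p) end.
Fixpoint allsS (n : nat) (p : form) : form :=
  match n with 0 => p | S k => fall2 (allsS k p) end.
Definition closure (p : form) : form := allsS (ffvS p) (allsN (ffvN p) p).

Definition fball (t : term) (p : form) : form := fall (fimp (flt (tvar 0) (tlift t)) p).
Definition fbex (t : term) (p : form) : form := fex (fand (flt (tvar 0) (tlift t)) p).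

Inductive Bounded : form -> Prop :=
| B_eq a b : Bounded (feq a b)
| B_lt a b : Bounded (flt a b)
| B_mem a X : Bounded (fmem a X)
| B_bot : Bounded fbot
| B_imp p q : Bounded p -> Bounded q -> Bounded (fimp p q)
| B_and p q : Bounded p -> Bounded q -> Bounded (fand p q)
| B_or p q : Bounded p -> Bounded q -> Bounded (forr p q)
| B_ball t p : Bounded p -> Bounded (fball t p)
| B_bex t p : Bounded p -> Bounded (fbex t p).

Inductive Sigma : nat -> form -> Prop :=
| Sig_bd n p : Bounded p -> Sigma n p
| Sig_ex n p : Pi n p -> Sigma (S n) (fex p)
with Pi : nat -> form -> Prop :=
| Pi_bd n p : Bounded p -> Pi n p
| Pi_all n p : Sigma n p -> Pi (S n) (fall p).

Inductive AllSigma2 : form -> Prop :=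
| AS_base p : Sigma 2 p -> AllSigma2 p
| AS_all p : AllSigma2 p -> AllSigma2 (fall p)
| AS_all2 p : AllSigma2 p -> AllSigma2 (fall2 p).

(* A named (PHOAS) front end to write concrete sentences readably.     *)
Section PHOAS.
Variables V W : Type.
Inductive pt : Type :=
| pv (x : V) | p0 | p1 | pplus (a b : pt) | ptimes (a b : pt).
Inductive pf : Type :=
| peq (a b : pt) | plt (a b : pt) | pmem (a : pt) (X : W)
| pbot | pimp (p q : pf) | pand (p q : pf) | por (p q : pf)
| pall (f : V -> pf) | pex (f : V -> pf)
| pall2 (f : W -> pf) | pex2 (f : W -> pf).
End PHOAS.
Arguments pv {V}. Arguments p0 {V}. Arguments p1 {V}.
Arguments pplus {V}. Arguments ptimes {V}.
Arguments peq {V W}. Arguments plt {V W}. Arguments pmem {V W}.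
Arguments pbot {V W}. Arguments pimp {V W}. Arguments pand {V W}.
Arguments por {V W}. Arguments pall {V W}. Arguments pex {V W}.
Arguments pall2 {V W}. Arguments pex2 {V W}.

(* compilation to de Bruijn: variables are de Bruijn levels *)
Fixpoint ct (d : nat) (t : pt nat) : term :=
  match t with
  | pv l => tvar (d - S l)
  | p0 => tzero | p1 => tone
  | pplus a b => tplus (ct d a) (ct d b)
  | ptimes a b => ttimes (ct d a) (ct d b)
  end.
Fixpoint cf (d e : nat) (p : pf nat nat) : form :=
  match p with
  | peq a b => feq (ct d a) (ct d b)
  | plt a b => flt (ct d a) (ct d b)
  | pmem a X => fmem (ct d a) (e - S X)
  | pbot => fbot
  | pimp p q => fimp (cf d e p) (cf d e q)
  | pand p q => fand (cf d e p) (cf d e q)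
  | por p q => forr (cf d e p) (cf d e q)
  | pall f => fall (cf (S d) e (f d))
  | pex f => fex (cf (S d) e (f d))
  | pall2 f => fall2 (cf d (S e) (f e))
  | pex2 f => fex2 (cf d (S e) (f e))
  end.

Section Sentences.
Context {V W : Type}.
Local Notation T := (pt V).
Local Notation F := (pf V W).
Definition pnot (p : F) : F := pimp p pbot.
Definition piff (p q : F) : F := pand (pimp p q) (pimp q p).
Definition ple (a b : T) : F := por (plt a b) (peq a b).
Definition pvar (x : V) : T := pv x.
(* pairing map (i,j) = (i+j)^2 + i  (injective) *)
Definition ppair (a b : T) : T := pplus (ptimes (pplus a b) (pplus a b)) a.

Definition pRem (a d r : T) : F :=
  pex (fun q => pand (peq a (pplus (ptimes (pv q) d) r)) (plt r d)).
(* Finite sequences: the number c = ((k, (a, b))) codes the sequence of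
   length k whose i-th entry is (Gödel's β-function) the remainder of a
   divided by 1 + (i+1)*b. *)
Definition pSeq (c : T) : F :=
  pex (fun k => pex (fun a => pex (fun b =>
    peq c (ppair (pv k) (ppair (pv a) (pv b)))))).
Definition pLen (c k : T) : F :=
  pex (fun a => pex (fun b => peq c (ppair k (ppair (pv a) (pv b))))).
Definition pEntry (c i e : T) : F :=
  pex (fun k => pex (fun a => pex (fun b =>
    pand (peq c (ppair (pv k) (ppair (pv a) (pv b))))
         (pRem (pv a) (pplus p1 (ptimes (pplus i p1) (pv b))) e)))).
Definition pSameEntry (c c' i : T) : F :=
  pall (fun e => pall (fun e' =>
    pimp (pEntry c i (pv e)) (pimp (pEntry c' i (pv e')) (peq (pv e) (pv e'))))).

(* ordinals below ω^ω: codes of non-increasing sequences n_0 >= ... >= n_{k-1},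
   representing ω^{n_0} + ... + ω^{n_{k-1}} *)
Definition pOrd (c : T) : F :=
  pand (pSeq c)
   (pall (fun k => pall (fun i => pall (fun j => pall (fun ei => pall (fun ej =>
     pimp (pLen c (pv k)) (pimp (plt (pv i) (pv j)) (pimp (plt (pv j) (pv k))
       (pimp (pEntry c (pv i) (pv ei)) (pimp (pEntry c (pv j) (pv ej))
          (ple (pv ej) (pv ei)))))))))))).
(* the ordinal ordering: lexicographic ordering of the exponent sequences *)
Definition pOlt (c d : T) : F :=
  pex (fun k => pex (fun k' => pand (pLen c (pv k)) (pand (pLen d (pv k'))
    (por
      (pand (plt (pv k) (pv k'))
            (pall (fun i => pimp (plt (pv i) (pv k)) (pSameEntry c d (pv i)))))
      (pex (fun i => pand (plt (pv i) (pv k)) (pand (plt (pv i) (pv k'))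
         (pand (pall (fun j => pimp (plt (pv j) (pv i)) (pSameEntry c d (pv j))))
               (pex (fun e => pex (fun e' =>
                  pand (pEntry c (pv i) (pv e))
                   (pand (pEntry d (pv i) (pv e')) (plt (pv e) (pv e')))))))))))))).
(* WO(α): there is no infinite descending sequence of ordinals starting
   from α; a sequence is a set F of pairs (n, f(n)) coding a total function *)
Definition pWO (a : T) : F :=
  pnot (pex2 (fun Fs =>
    pand (pall (fun n => pex (fun m => pmem (ppair (pv n) (pv m)) Fs)))
    (pand (pall (fun n => pall (fun m => pall (fun m' =>
             pimp (pmem (ppair (pv n) (pv m)) Fs)
              (pimp (pmem (ppair (pv n) (pv m')) Fs) (peq (pv m) (pv m')))))))
    (pand (pmem (ppair p0 a) Fs)
          (pall (fun n => pall (fun m => pall (fun m' =>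
             pimp (pmem (ppair (pv n) (pv m)) Fs)
              (pimp (pmem (ppair (pplus (pv n) p1) (pv m')) Fs)
                 (pand (pOrd (pv m')) (pOlt (pv m') (pv m)))))))))))).

Definition pBinStr (c : T) : F :=
  pand (pSeq c) (pall (fun k => pall (fun i => pall (fun e =>
    pimp (pLen c (pv k)) (pimp (plt (pv i) (pv k))
      (pimp (pEntry c (pv i) (pv e)) (plt (pv e) (pplus p1 p1)))))))).
Definition pPrefix (c' c : T) : F :=
  pex (fun k' => pex (fun k => pand (pLen c' (pv k')) (pand (pLen c (pv k))
    (pand (ple (pv k') (pv k))
      (pall (fun i => pimp (plt (pv i) (pv k')) (pSameEntry c' c (pv i)))))))).
Definition pWKL : F :=
  pall2 (fun Tr =>
    pimp
      (pand (pall (fun c => pimp (pmem (pv c) Tr) (pBinStr (pv c))))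
      (pand (pall (fun c => pall (fun c' =>
               pimp (pmem (pv c) Tr) (pimp (pBinStr (pv c'))
                 (pimp (pPrefix (pv c') (pv c)) (pmem (pv c') Tr))))))
            (pall (fun k => pex (fun c => pand (pmem (pv c) Tr) (pLen (pv c) (pv k)))))))
      (pex2 (fun X => pall (fun k => pex (fun c =>
         pand (pmem (pv c) Tr) (pand (pLen (pv c) (pv k))
           (pall (fun i => pall (fun e => pimp (plt (pv i) (pv k))
              (pimp (pEntry (pv c) (pv i) (pv e))
                 (piff (peq (pv e) p1) (pmem (pv i) X)))))))))))).

(* Ramsey's theorem for pairs and two colours; a colouring P : [N]^2 -> 2 is
   coded by the set P with P(i,j) = 1 iff (i,j) ∈ P *)
Definition pRT22 : F :=
  pall2 (fun P => pex2 (fun H =>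
    pand (pall (fun n => pex (fun m => pand (plt (pv n) (pv m)) (pmem (pv m) H))))
     (por
       (pall (fun i => pall (fun j => pimp (pmem (pv i) H) (pimp (pmem (pv j) H)
          (pimp (plt (pv i) (pv j)) (pmem (ppair (pv i) (pv j)) P))))))
       (pall (fun i => pall (fun j => pimp (pmem (pv i) H) (pimp (pmem (pv j) H)
          (pimp (plt (pv i) (pv j)) (pnot (pmem (ppair (pv i) (pv j)) P)))))))))).
End Sentences.

Definition v0 := tvar 0.
Definition v1 := tvar 1.
Definition succ (t : term) := tplus t tone.

(* basic axioms (Simpson, SOSOA I.2) *)
Inductive BasicAx : form -> Prop :=
| ba1 : BasicAx (fall (fnot (feq (succ v0) tzero)))
| ba2 : BasicAx (fall (fall (fimp (feq (succ v1) (succ v0)) (feq v1 v0))))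
| ba3 : BasicAx (fall (fnot (flt v0 tzero)))
| ba4 : BasicAx (fall (fall (fiff (flt v1 (succ v0)) (forr (flt v1 v0) (feq v1 v0)))))
| ba5 : BasicAx (fall (feq (tplus v0 tzero) v0))
| ba6 : BasicAx (fall (fall (feq (tplus v1 (succ v0)) (succ (tplus v1 v0)))))
| ba7 : BasicAx (fall (feq (ttimes v0 tzero) tzero))
| ba8 : BasicAx (fall (fall (feq (ttimes v1 (succ v0)) (tplus (ttimes v1 v0) v1)))).

Definition nextN (p : form) : form :=
  fsubst (fun n => match n with 0 => succ (tvar 0) | S k => tvar (S k) end)
         (fun X => X) p.

Inductive RCA0 : theory :=
| rca_basic p : BasicAx p -> RCA0 p
| rca_ind p : Sigma 1 p ->
    RCA0 (closure (fimp (fand (instN p tzero) (fall (fimp p (nextN p)))) (fall p)))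
(* Δ^0_1 comprehension: ∀n(φ(n) ↔ ψ(n)) → ∃X ∀n(n ∈ X ↔ φ(n)), φ ∈ Σ^0_1, ψ ∈ Π^0_1,
   X not free in φ (automatic with de Bruijn indices) *)
| rca_comp p q : Sigma 1 p -> Pi 1 q ->
    RCA0 (closure (fimp (fall (fiff p q))
                        (fex2 (fall (fiff (fmem (tvar 0) 0) (liftS p)))))).

Definition WKL_sentence : form := cf 0 0 (@pWKL nat nat).
Definition RT22_sentence : form := cf 0 0 (@pRT22 nat nat).

Definition WKL0_RT22 : theory :=
  fun p => RCA0 p \/ p = WKL_sentence \/ p = RT22_sentence.

(* formulas with the single free number variable 0 (= α) *)
Definition Ord_form : form := cf 1 0 (@pOrd nat nat (pv 0)).
Definition WO_form : form := cf 1 0 (@pWO nat nat (pv 0)).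

Definition WO_statement (phi : form) : form :=
  fall (fimp Ord_form (fimp WO_form phi)).

(* Main.v *)
Require Import Defs.
From Stdlib Require Import List Arith Lia Classical ClassicalEpsilon ZArith.
From Stdlib Require Import FunctionalExtensionality PropExtensionality ProofIrrelevance Cantor Ring Setoid.
Import ListNotations.

(** Suppose RCA0 does not prove the statement.  By completeness and compactness it fails in
    a countable nonstandard model of RCA0: there are an ordinal [a], well-ordered in the
    model, and parameters refuting the Sigma^0_2 matrix, where the refutation of
    [exists u, forall v, r] is a recursive function [g] of the model taking [u] to some [v]
    with [r] false.  If omega^k is the leading power of [a], then omega^k is well-ordered,
    hence so is omega^(k m) for every standard [m], and by overspill some sparse finite set,
    sparse also with respect to [g], is omega^((k+1) 19^j)-large for a nonstandard [j].

    A sparse omega^(16 n)-large set has, for every 2-colouring of its pairs, a homogeneous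
    omega^n-large subset.  Iterating this along an enumeration of the model shrinks the
    interval spanned by the large set; each step also arranges that a given function has no
    value between the end points, up to the ones already fixed, and that a given candidate
    for a descending sequence from [a] stops being one.  The limit is a cut [I] closed under
    [g].  The structure [I] with the traces on [I] of the finite sets of the model satisfies
    WKL0 and RT^2_2, believes [a] to be well-ordered, and still refutes the matrix, so
    WKL0 + RT^2_2 does not prove the statement either. *)

(** * Semantics and completeness *)

(** The exponent [k] may be nonstandard, and well-orderedness is known only for omega^(k m) with m
    standard. Hence the Ramsey bound for large sets has to be linear in the exponent; a bound such
    as omega^(2^n) could leave this range in a single step. Linearity comes from an asymmetric
    statement proved by induction on n: for every k <= n there is a homogeneous set that is
    omega^k-large for one colour or omega^(n-k)-large for the other. Its induction step needs a
    chain of large blocks with one fixed colour between different blocks, at a constant cost in the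
    exponent, here 8.

    The model has only Sigma^0_1 induction, so all notions are arranged to be recursive; largeness
    is the outcome of a recursive process, not a statement about all sequences. The cut does not
    inherit induction. It gets it from the gaps: since the values of a coded function that lie in
    the cut are bounded inside the cut, an existential quantifier over the cut can be bounded by one
    of its elements. Weak Koenig's lemma needs no step of the construction: a path is read off a
    string whose length overspills the cut. *)

Record struct := Struct {
  dom : Type; sset : Type;
  s_zero : dom; s_one : dom;
  s_add : dom -> dom -> dom; s_mul : dom -> dom -> dom;
  s_lt : dom -> dom -> Prop; s_mem : dom -> sset -> Prop }.

Definition sc {A : Type} (x : A) (e : nat -> A) : nat -> A :=
  fun n => match n with 0 => x | S k => e k end.
Notation "x .: e" := (sc x e) (at level 55, right associativity).

Fixpoint teval (A : struct) (t : term) (e : nat -> dom A) : dom A :=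
  match t with
  | tvar n => e n
  | tzero => s_zero A
  | tone => s_one A
  | tplus a b => s_add A (teval A a e) (teval A b e)
  | ttimes a b => s_mul A (teval A a e) (teval A b e)
  end.

Fixpoint sat (A : struct) (p : form) (e : nat -> dom A) (s : nat -> sset A) : Prop :=
  match p with
  | feq a b => teval A a e = teval A b e
  | flt a b => s_lt A (teval A a e) (teval A b e)
  | fmem a X => s_mem A (teval A a e) (s X)
  | fbot => False
  | fimp p q => sat A p e s -> sat A q e s
  | fand p q => sat A p e s /\ sat A q e s
  | forr p q => sat A p e s \/ sat A q e s
  | fall p => forall x, sat A p (x .: e) s
  | fex p => exists x, sat A p (x .: e) s
  | fall2 p => forall X, sat A p e (X .: s)
  | fex2 p => exists X, sat A p e (X .: s)
  end.

Lemma sc_eta {A : Type} (e : nat -> A) : (e 0 .: fun n => e (S n)) = e.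
Proof. apply functional_extensionality; intros [|n]; reflexivity. Qed.

Lemma teval_subst A t sg e :
  teval A (tsubst sg t) e = teval A t (fun n => teval A (sg n) e).
Proof. induction t; simpl; congruence. Qed.

Lemma upN_env A sg x e :
  (fun n => teval A (upN sg n) (x .: e)) = (x .: fun n => teval A (sg n) e).
Proof.
  apply functional_extensionality; intros [|n]; [reflexivity|].
  simpl. unfold tlift. now rewrite teval_subst.
Qed.

Lemma upS_env {A : Type} r (X : A) s :
  (fun n => (X .: s) (upS r n)) = (X .: fun n => s (r n)).
Proof. apply functional_extensionality; intros [|n]; reflexivity. Qed.

Lemma sat_subst A p : forall sg r e s,
  sat A (fsubst sg r p) e s <-> sat A p (fun n => teval A (sg n) e) (fun X => s (r X)).
Proof.
  induction p; intros sg r e s; simpl; rewrite ?teval_subst; try tauto;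
  try (rewrite IHp1, IHp2; tauto).
  all: split; first [intros H x; specialize (H x) | intros [x H]; exists x];
    [rewrite IHp, ?upN_env, ?upS_env in H | rewrite IHp, ?upN_env, ?upS_env]; exact H.
Qed.

Lemma sat_liftN A p x e s : sat A (liftN p) (x .: e) s <-> sat A p e s.
Proof. unfold liftN. rewrite sat_subst. reflexivity. Qed.
Lemma sat_liftS A p X e s : sat A (liftS p) e (X .: s) <-> sat A p e s.
Proof. unfold liftS. rewrite sat_subst. reflexivity. Qed.
Lemma sat_instN A p t e s : sat A (instN p t) e s <-> sat A p (teval A t e .: e) s.
Proof.
  unfold instN. rewrite sat_subst.
  replace (fun n => teval A (match n with 0 => t | S k => tvar k end) e)
    with (teval A t e .: e); [tauto|].
  apply functional_extensionality; intros [|n]; reflexivity.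
Qed.
Lemma sat_instS A p j e s : sat A (instS p j) e s <-> sat A p e (s j .: s).
Proof.
  unfold instS. rewrite sat_subst.
  replace (fun X => s (match X with 0 => j | S k => k end))
    with (s j .: s); [tauto|].
  apply functional_extensionality; intros [|n]; reflexivity.
Qed.

Theorem soundness A G p : nd G p ->
  forall e s, (forall q, In q G -> sat A q e s) -> sat A p e s.
Proof.
  induction 1; intros e ss HG.
  - auto.
  - apply NNPP; intro Hn. apply (IHnd e ss). intros q [<-|Hq]; [exact Hn|auto].
  - intro Hp. apply IHnd. intros r [<-|Hr]; auto.
  - exact (IHnd1 e ss HG (IHnd2 e ss HG)).
  - split; auto.
  - apply (IHnd e ss HG).
  - apply (IHnd e ss HG).
  - left; auto.
  - right; auto.
  - destruct (IHnd1 e ss HG) as [H'|H'];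
      [apply IHnd2|apply IHnd3]; intros r' [<-|Hr]; auto.
  - intro x. apply IHnd. intros q Hq. apply in_map_iff in Hq as [q' [<- Hq]].
    apply sat_liftN; auto.
  - apply sat_instN, (IHnd e ss HG).
  - exists (teval A t e). apply sat_instN; auto.
  - destruct (IHnd1 e ss HG) as [x Hx]. apply (sat_liftN A q x). apply IHnd2.
    intros r [<-|Hr]; auto. apply in_map_iff in Hr as [q' [<- Hq]].
    apply sat_liftN; auto.
  - intro x. apply IHnd. intros q Hq. apply in_map_iff in Hq as [q' [<- Hq]].
    apply sat_liftS; auto.
  - apply sat_instS, (IHnd e ss HG).
  - exists (ss j). apply sat_instS; auto.
  - destruct (IHnd1 e ss HG) as [x Hx]. apply (sat_liftS A q x). apply IHnd2.
    intros r [<-|Hr]; auto. apply in_map_iff in Hr as [q' [<- Hq]].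
    apply sat_liftS; auto.
  - reflexivity.
  - apply sat_instN. generalize (IHnd1 e ss HG). simpl. intros <-.
    apply sat_instN; auto.
Qed.

Lemma teval_agree A t e e' :
  (forall n, n < tfv t -> e n = e' n) -> teval A t e = teval A t e'.
Proof.
  induction t; simpl; intro H; auto; try (apply H; lia);
  rewrite IHt1, IHt2; auto; intros n Hn; apply H; lia.
Qed.

Lemma sat_agree A p : forall e e' s s',
  (forall n, n < ffvN p -> e n = e' n) -> (forall n, n < ffvS p -> s n = s' n) ->
  (sat A p e s <-> sat A p e' s').
Proof.
  induction p; simpl; intros e e' s s' HN HS;
  try (rewrite (teval_agree A a e e'), (teval_agree A b e e')
         by (intros; apply HN; lia); tauto);
  try tauto;
  try (rewrite (IHp1 e e' s s'), (IHp2 e e' s s')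
         by (intros; first [apply HN|apply HS]; lia); tauto).
  1: rewrite (teval_agree A a e e') by (intros; apply HN; lia);
     rewrite (HS X) by lia; tauto.
  all: split; try (intros H x; specialize (H x)); try (intros [x H]; exists x);
    revert H; apply IHp; intros [|n] Hn; simpl; auto; first [apply HN|apply HS|symmetry; apply HN|symmetry; apply HS]; lia.
Qed.

(** * Substitution in terms, formulas and derivations *)

Lemma tsubst_comp t sg sg' :
  tsubst sg' (tsubst sg t) = tsubst (fun n => tsubst sg' (sg n)) t.
Proof. induction t; simpl; congruence. Qed.

Lemma fsubst_comp p : forall sg r sg' r',
  fsubst sg' r' (fsubst sg r p) = fsubst (fun n => tsubst sg' (sg n)) (fun n => r' (r n)) p.
Proof.
  assert (EN : forall sg sg', (fun n => tsubst (upN sg') (upN sg n)) = upN (fun n => tsubst sg' (sg n))).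
  { intros sg sg'. apply functional_extensionality; intros [|n]; [reflexivity|].
    simpl. unfold tlift. rewrite !tsubst_comp. reflexivity. }
  assert (ES : forall r r', (fun n => upS r' (upS r n)) = upS (fun n => r' (r n))).
  { intros r r'. apply functional_extensionality; intros [|n]; reflexivity. }
  induction p; intros; simpl; rewrite ?tsubst_comp, ?IHp1, ?IHp2, ?IHp, ?EN, ?ES; reflexivity.
Qed.

Lemma tsubst_agree t sg sg' :
  (forall n, n < tfv t -> sg n = sg' n) -> tsubst sg t = tsubst sg' t.
Proof.
  induction t; simpl; intro H; auto; try (apply H; lia);
  rewrite IHt1, IHt2; auto; intros n Hn; apply H; lia.
Qed.

Lemma fsubst_agree p : forall sg sg' r r',
  (forall n, n < ffvN p -> sg n = sg' n) -> (forall n, n < ffvS p -> r n = r' n) ->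
  fsubst sg r p = fsubst sg' r' p.
Proof.
  induction p; simpl; intros sg sg' r r' HN HS; try reflexivity.
  1,2: f_equal; apply tsubst_agree; intros; apply HN; lia.
  1: f_equal; [apply tsubst_agree; intros; apply HN; lia|apply HS; lia].
  1-3: f_equal; [apply IHp1|apply IHp2]; intros; first [apply HN|apply HS]; lia.
  all: f_equal; apply IHp; intros [|n] Hn; simpl; auto;
    first [rewrite HN by lia; reflexivity | rewrite HS by lia; reflexivity | apply HN; lia|apply HS; lia].
Qed.

Lemma tsubst_id t : tsubst tvar t = t.
Proof. induction t; simpl; congruence. Qed.

Lemma fsubst_id p : fsubst tvar (fun X => X) p = p.
Proof.
  assert (EN : upN tvar = tvar).
  { apply functional_extensionality; intros [|n]; reflexivity. }
  assert (ES : upS (fun X => X) = (fun X => X)).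
  { apply functional_extensionality; intros [|n]; reflexivity. }
  induction p; simpl; rewrite ?EN, ?ES, ?tsubst_id; congruence.
Qed.

Lemma nd_weak G p : nd G p -> forall G', incl G G' -> nd G' p.
Proof.
  induction 1; intros G' HI.
  - apply nd_ax; auto.
  - apply nd_raa, IHnd. intros x [<-|Hx]; [left|right]; auto.
  - apply nd_impI, IHnd. intros x [<-|Hx]; [left|right]; auto.
  - eapply nd_impE; eauto.
  - apply nd_andI; auto.
  - eapply nd_andE1; eauto.
  - eapply nd_andE2; eauto.
  - apply nd_orI1; auto.
  - apply nd_orI2; auto.
  - eapply nd_orE; [apply IHnd1; auto|apply IHnd2|apply IHnd3];
      intros x [<-|Hx]; [left|right|left|right]; auto.
  - apply nd_allI, IHnd, incl_map; auto.
  - apply nd_allE; auto.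
  - eapply nd_exI; eauto.
  - eapply nd_exE; [apply IHnd1; auto|apply IHnd2].
    intros x [<-|Hx]; [left|right]; auto. revert Hx; apply incl_map; auto.
  - apply nd_all2I, IHnd, incl_map; auto.
  - apply nd_all2E; auto.
  - eapply nd_ex2I; eauto.
  - eapply nd_ex2E; [apply IHnd1; auto|apply IHnd2].
    intros x [<-|Hx]; [left|right]; auto. revert Hx; apply incl_map; auto.
  - apply nd_refl.
  - eapply nd_leib; eauto.
Qed.

Lemma fsubst_liftN sg r p : fsubst (upN sg) r (liftN p) = liftN (fsubst sg r p).
Proof. unfold liftN. rewrite !fsubst_comp. reflexivity. Qed.
Lemma fsubst_liftS sg r p : fsubst sg (upS r) (liftS p) = liftS (fsubst sg r p).
Proof.
  unfold liftS. rewrite !fsubst_comp. f_equal.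
  apply functional_extensionality; intro n. symmetry. apply tsubst_id.
Qed.
Lemma fsubst_instN sg r p t :
  fsubst sg r (instN p t) = instN (fsubst (upN sg) r p) (tsubst sg t).
Proof.
  unfold instN. rewrite !fsubst_comp. f_equal.
  apply functional_extensionality; intros [|n]; [reflexivity|].
  simpl. unfold tlift. rewrite tsubst_comp. symmetry. apply tsubst_id.
Qed.
Lemma fsubst_instS sg r p j :
  fsubst sg r (instS p j) = instS (fsubst sg (upS r) p) (r j).
Proof.
  unfold instS. rewrite !fsubst_comp. f_equal.
  - apply functional_extensionality; intros n. symmetry. apply tsubst_id.
  - apply functional_extensionality; intros [|n]; reflexivity.
Qed.

(** A Henkin witness will be an ordinary free variable. Renaming it throughout a derivation turns a
    refutation that uses the witness into the premise of [nd_exE] or [nd_ex2E]. *)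
Lemma nd_subst G p : nd G p -> forall sg r, nd (map (fsubst sg r) G) (fsubst sg r p).
Proof.
  assert (LN : forall G sg r, map (fsubst (upN sg) r) (map liftN G) = map liftN (map (fsubst sg r) G)).
  { intros. rewrite !map_map. apply map_ext. intro; apply fsubst_liftN. }
  assert (LS : forall G sg r, map (fsubst sg (upS r)) (map liftS G) = map liftS (map (fsubst sg r) G)).
  { intros. rewrite !map_map. apply map_ext. intro; apply fsubst_liftS. }
  induction 1; intros sg r'; simpl in *; rewrite ?fsubst_instN, ?fsubst_instS in *.
  - apply nd_ax, in_map; auto.
  - apply nd_raa, IHnd.
  - apply nd_impI, IHnd.
  - eapply nd_impE; eauto.
  - apply nd_andI; auto.
  - eapply nd_andE1; eauto.
  - eapply nd_andE2; eauto.
  - apply nd_orI1; auto.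
  - apply nd_orI2; auto.
  - eapply nd_orE; eauto.
  - apply nd_allI. rewrite <- LN. auto.
  - apply nd_allE. apply IHnd.
  - eapply nd_exI. rewrite <- fsubst_instN. apply IHnd.
  - eapply nd_exE; [apply IHnd1|]. rewrite <- LN, <- fsubst_liftN. apply IHnd2.
  - apply nd_all2I. rewrite <- LS. auto.
  - apply nd_all2E. apply IHnd.
  - eapply nd_ex2I. rewrite <- fsubst_instS. apply IHnd.
  - eapply nd_ex2E; [apply IHnd1|]. rewrite <- LS, <- fsubst_liftS. apply IHnd2.
  - apply nd_refl.
  - eapply nd_leib; [apply IHnd1|]. rewrite <- fsubst_instN. apply IHnd2.
Qed.

Definition npair (a b : nat) : nat := to_nat (a, b).
Lemma npair_inj a b c d : npair a b = npair c d -> a = c /\ b = d.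
Proof. unfold npair. intro H. apply to_nat_inj in H. split; congruence. Qed.

Fixpoint tcode (t : term) : nat :=
  match t with
  | tvar n => npair 0 n
  | tzero => npair 1 0
  | tone => npair 2 0
  | tplus a b => npair 3 (npair (tcode a) (tcode b))
  | ttimes a b => npair 4 (npair (tcode a) (tcode b))
  end.

Fixpoint fcode (p : form) : nat :=
  match p with
  | feq a b => npair 0 (npair (tcode a) (tcode b))
  | flt a b => npair 1 (npair (tcode a) (tcode b))
  | fmem a X => npair 2 (npair (tcode a) X)
  | fbot => npair 3 0
  | fimp p q => npair 4 (npair (fcode p) (fcode q))
  | fand p q => npair 5 (npair (fcode p) (fcode q))
  | forr p q => npair 6 (npair (fcode p) (fcode q))
  | fall p => npair 7 (fcode p)
  | fex p => npair 8 (fcode p)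
  | fall2 p => npair 9 (fcode p)
  | fex2 p => npair 10 (fcode p)
  end.

Ltac inj_code :=
  repeat match goal with
  | H : npair _ _ = npair _ _ |- _ => apply npair_inj in H as [? ?]
  end; try discriminate.

Lemma tcode_inj t : forall t', tcode t = tcode t' -> t = t'.
Proof.
  induction t; intros [] H; cbn [tcode] in H; inj_code; subst; f_equal; auto.
Qed.

Lemma fcode_inj p : forall p', fcode p = fcode p' -> p = p'.
Proof.
  induction p; intros [] H; cbn [fcode] in H; inj_code; subst; f_equal; auto using tcode_inj.
Qed.

Definition fenum (n : nat) : form := epsilon (inhabits fbot) (fun p => fcode p = n).
Lemma fenum_code p : fenum (fcode p) = p.
Proof.
  apply fcode_inj. apply (epsilon_spec (inhabits fbot) (fun q => fcode q = fcode p)). eauto.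
Qed.

(** * Henkin construction with free variables as witnesses *)

Section Henkin.
Variables (T : theory) (N0 N1 : nat).
(** With a common bound on the free variables of the axioms, infinitely many variables stay fresh at
    every stage, and the language need not be extended by constants. *)
Hypothesis Tfv : forall p, T p -> ffvN p <= N0 /\ ffvS p <= N1.

Definition Con (G : list form) : Prop :=
  forall L, (forall q, In q L -> T q) -> ~ nd (G ++ L) fbot.

Definition bdN (G : list form) : nat := fold_right (fun p m => Nat.max (ffvN p) m) N0 G.
Definition bdS (G : list form) : nat := fold_right (fun p m => Nat.max (ffvS p) m) N1 G.

Lemma bdN_spec G L : (forall q, In q L -> T q) -> forall q, In q (G ++ L) -> ffvN q <= bdN G.
Proof.
  intros HL q. induction G as [|p G IH]; simpl.
  - intro Hq. apply Tfv, HL, Hq.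
  - intros [<-|Hq]; [lia|]. specialize (IH Hq). lia.
Qed.
Lemma bdS_spec G L : (forall q, In q L -> T q) -> forall q, In q (G ++ L) -> ffvS q <= bdS G.
Proof.
  intros HL q. induction G as [|p G IH]; simpl.
  - intro Hq. apply Tfv, HL, Hq.
  - intros [<-|Hq]; [lia|]. specialize (IH Hq). lia.
Qed.

Lemma Con_exN p G : Con (fex p :: G) ->
  Con (instN p (tvar (bdN (fex p :: G))) :: fex p :: G).
Proof.
  set (k := bdN (fex p :: G)). intros HC L HL HN. apply (HC L HL).
  set (Gam := (fex p :: G) ++ L) in *.
  assert (HB : forall q, In q Gam -> ffvN q <= k) by apply (bdN_spec _ _ HL).
  (* [sg] sends the fresh variable [k] to the bound variable and lifts the others. As [k] is not
     free in [Gam], it acts there as [liftN], while it turns the instance at [k] back into [p]. *)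
  set (sg := fun n => if Nat.eq_dec n k then tvar 0 else tvar (S n)).
  apply nd_subst with (sg := sg) (r := fun X => X) in HN. cbn [map app] in HN.
  apply nd_exE with (p := p); [apply nd_ax; left; reflexivity|].
  replace (p :: map liftN Gam) with
    (fsubst sg (fun X => X) (instN p (tvar k)) :: map (fsubst sg (fun X => X)) Gam);
    [exact HN|].
  f_equal.
  - unfold instN. rewrite fsubst_comp. rewrite <- (fsubst_id p) at 2.
    apply fsubst_agree; [|reflexivity].
    intros [|n] Hn; simpl; unfold sg.
    + destruct (Nat.eq_dec k k); congruence.
    + assert (ffvN (fex p) <= k) by (apply HB; left; reflexivity). simpl in H.
      destruct (Nat.eq_dec n k); [lia|reflexivity].
  - apply map_ext_in. intros q Hq. apply HB in Hq.
    apply fsubst_agree; [|reflexivity]. intros n Hn. unfold sg.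
    destruct (Nat.eq_dec n k); [lia|reflexivity].
Qed.

Lemma Con_exS p G : Con (fex2 p :: G) ->
  Con (instS p (bdS (fex2 p :: G)) :: fex2 p :: G).
Proof.
  set (k := bdS (fex2 p :: G)). intros HC L HL HN. apply (HC L HL).
  set (Gam := (fex2 p :: G) ++ L) in *.
  assert (HB : forall q, In q Gam -> ffvS q <= k) by apply (bdS_spec _ _ HL).
  set (sg := fun n => if Nat.eq_dec n k then 0 else S n).
  apply nd_subst with (sg := tvar) (r := sg) in HN. cbn [map app] in HN.
  apply nd_ex2E with (p := p); [apply nd_ax; left; reflexivity|].
  replace (p :: map liftS Gam) with
    (fsubst tvar sg (instS p k) :: map (fsubst tvar sg) Gam);
    [exact HN|].
  f_equal.
  - unfold instS. rewrite fsubst_comp. rewrite <- (fsubst_id p) at 2.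
    apply fsubst_agree; [reflexivity|].
    intros [|n] Hn; simpl; unfold sg.
    + destruct (Nat.eq_dec k k); congruence.
    + assert (ffvS (fex2 p) <= k) by (apply HB; left; reflexivity). simpl in H.
      destruct (Nat.eq_dec n k); [lia|reflexivity].
  - apply map_ext_in. intros q Hq. apply HB in Hq.
    apply fsubst_agree; [reflexivity|]. intros n Hn. unfold sg.
    destruct (Nat.eq_dec n k); [lia|reflexivity].
Qed.

Definition witness (f : form) (G : list form) : list form :=
  match f with
  | fex p => instN p (tvar (bdN (f :: G))) :: f :: G
  | fex2 p => instS p (bdS (f :: G)) :: f :: G
  | _ => f :: G
  end.

Definition next (f : form) (G : list form) : list form :=
  if excluded_middle_informative (Con (f :: G)) then witness f G else fnot f :: G.

Fixpoint stage (n : nat) : list form :=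
  match n with 0 => [] | S k => next (fenum k) (stage k) end.

Hypothesis T_con : forall L, (forall q, In q L -> T q) -> ~ nd L fbot.

Lemma stage_con n : Con (stage n).
Proof.
  induction n as [|n IH]; simpl.
  - exact T_con.
  - unfold next. destruct (excluded_middle_informative _) as [H|H].
    + unfold witness. destruct (fenum n); auto using Con_exN, Con_exS.
    + intros L HL HN. apply H. intros L' HL' HN'.
      apply (IH (L ++ L')). { intros q Hq; apply in_app_or in Hq as [|]; auto. }
      assert (E : nd (stage n ++ L ++ L') (fnot (fnot (fenum n)))).
      { apply nd_impI. eapply nd_weak; [exact HN|].
        intros x. simpl. rewrite !in_app_iff. tauto. }
      eapply nd_impE; [exact E|]. apply nd_impI. eapply nd_weak; [exact HN'|].
      intros x. simpl. rewrite !in_app_iff. tauto.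
Qed.

Lemma stage_mono n m : n <= m -> incl (stage n) (stage m).
Proof.
  induction 1 as [|m _ IH]; [apply incl_refl|].
  intros q Hq. apply IH in Hq. simpl. unfold next, witness.
  destruct (excluded_middle_informative _); [|right; auto].
  destruct (fenum m); simpl; auto.
Qed.

Definition Dset (p : form) : Prop := exists n, In p (stage n).

Lemma Dset_cons L : (forall q, In q L -> Dset q \/ T q) -> ~ nd L fbot.
Proof.
  intros H HN.
  assert (exists n L', (forall q, In q L' -> T q) /\ incl L (stage n ++ L')) as (n & L' & HT & HI).
  { clear HN. induction L as [|p L IH].
    - exists 0, []. split; [intros ? []|intros ? []].
    - destruct IH as (n & L' & HT & HI); [intros; apply H; right; auto|].
      destruct (H p) as [[m Hm]|Hp]; [left; auto| |].
      + exists (n + m), L'. split; auto. intros x [<-|Hx].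
        * apply in_or_app; left. apply (stage_mono m); auto; lia.
        * apply HI, in_app_or in Hx as [Hx|Hx]; apply in_or_app; auto.
          left; apply (stage_mono n); auto; lia.
      + exists n, (p :: L'). split; [intros q [<-|Hq]; auto|].
        intros x [<-|Hx]; apply in_or_app; [right; left; auto|].
        apply HI, in_app_or in Hx as [Hx|Hx]; auto. right; right; auto. }
  apply (stage_con n L' HT). eapply nd_weak; eauto.
Qed.

Lemma Dset_dec p : Dset p \/ Dset (fnot p).
Proof.
  assert (H : In p (stage (S (fcode p))) \/ In (fnot p) (stage (S (fcode p)))).
  { simpl. rewrite fenum_code. unfold next.
    destruct (excluded_middle_informative _); [left|right; left; auto].
    unfold witness; destruct p; simpl; auto. }
  destruct H; [left|right]; eexists; eauto.
Qed.

Lemma Dset_nd L p : (forall q, In q L -> Dset q \/ T q) -> nd L p -> Dset p.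
Proof.
  intros HL HN. destruct (Dset_dec p) as [|Hn]; auto. exfalso.
  apply (Dset_cons (fnot p :: L)).
  - intros q [<-|Hq]; auto.
  - eapply nd_impE; [apply nd_ax; left; reflexivity|].
    eapply nd_weak; [exact HN|]. intros x Hx; right; auto.
Qed.

Lemma Dset_T p : T p -> Dset p.
Proof.
  intro H. apply (Dset_nd [p]); [|apply nd_ax; left; auto]. intros q [<-|[]]; auto.
Qed.

Lemma Dset_nd1 p q : Dset p -> nd [p] q -> Dset q.
Proof. intros H. apply Dset_nd. intros r [<-|[]]; auto. Qed.
Lemma Dset_nd2 p p' q : Dset p -> Dset p' -> nd [p; p'] q -> Dset q.
Proof. intros H H'. apply Dset_nd. intros r [<-|[<-|[]]]; auto. Qed.

Lemma Dset_imp p q : Dset (fimp p q) <-> (Dset p -> Dset q).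
Proof.
  split.
  - intros H Hp. apply (Dset_nd2 _ _ _ H Hp).
    apply nd_impE with (p := p); apply nd_ax; simpl; auto.
  - intro H. destruct (Dset_dec p) as [Hp|Hp].
    + apply (Dset_nd1 q); [auto|]. apply nd_impI, nd_ax; simpl; auto.
    + apply (Dset_nd1 _ _ Hp). apply nd_impI, nd_raa.
      apply nd_impE with (p := p); apply nd_ax; simpl; auto.
Qed.

Lemma Dset_bot : ~ Dset fbot.
Proof. intro H. apply (Dset_cons [fbot]); [intros q [<-|[]]; auto|]. apply nd_ax; left; auto. Qed.

Lemma Dset_not p : Dset (fnot p) <-> ~ Dset p.
Proof.
  unfold fnot. rewrite Dset_imp. split; intros H H'; [exact (Dset_bot (H H'))|contradiction].
Qed.

Lemma Dset_and p q : Dset (fand p q) <-> Dset p /\ Dset q.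
Proof.
  split.
  - intro H; split; apply (Dset_nd1 _ _ H); [eapply nd_andE1|eapply nd_andE2]; apply nd_ax; left; eauto.
  - intros [H H']. apply (Dset_nd2 _ _ _ H H'). apply nd_andI; apply nd_ax; simpl; auto.
Qed.

Lemma Dset_or p q : Dset (forr p q) <-> Dset p \/ Dset q.
Proof.
  split.
  - intro H. apply NNPP; intro Hn. apply not_or_and in Hn as [H1 H2].
    apply Dset_not in H1. apply Dset_not in H2.
    apply (Dset_cons [forr p q; fnot p; fnot q]).
    + intros r [<-|[<-|[<-|[]]]]; auto.
    + eapply nd_orE; [apply nd_ax; left; reflexivity| |];
        (eapply nd_impE; [apply nd_ax|apply nd_ax; left; reflexivity]); simpl; auto.
  - intros [H|H]; apply (Dset_nd1 _ _ H); [apply nd_orI1|apply nd_orI2]; apply nd_ax; left; auto.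
Qed.

Lemma Dset_ex p : Dset (fex p) <-> exists t, Dset (instN p t).
Proof.
  split.
  - intros H. pose proof H as H0.
    assert (Hc : Con (fex p :: stage (fcode (fex p)))).
    { intros L HL HN. apply (Dset_cons ((fex p :: stage (fcode (fex p))) ++ L)); auto.
      intros q Hq. apply in_app_or in Hq as [[<-|Hq]|Hq]; auto. left; eexists; eauto. }
    exists (tvar (bdN (fex p :: stage (fcode (fex p))))).
    exists (S (fcode (fex p))). cbn [stage]. rewrite fenum_code. unfold next.
    destruct (excluded_middle_informative _); [left; auto|contradiction].
  - intros [t H]. apply (Dset_nd1 _ _ H). eapply nd_exI. apply nd_ax; left; eauto.
Qed.

Lemma Dset_ex2 p : Dset (fex2 p) <-> exists j, Dset (instS p j).
Proof.
  split.
  - intros H. pose proof H as H0.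
    assert (Hc : Con (fex2 p :: stage (fcode (fex2 p)))).
    { intros L HL HN. apply (Dset_cons ((fex2 p :: stage (fcode (fex2 p))) ++ L)); auto.
      intros q Hq. apply in_app_or in Hq as [[<-|Hq]|Hq]; auto. left; eexists; eauto. }
    exists (bdS (fex2 p :: stage (fcode (fex2 p)))).
    exists (S (fcode (fex2 p))). cbn [stage]. rewrite fenum_code. unfold next.
    destruct (excluded_middle_informative _); [left; auto|contradiction].
  - intros [t H]. apply (Dset_nd1 _ _ H). eapply nd_ex2I. apply nd_ax; left; eauto.
Qed.

Lemma Dset_all p : Dset (fall p) <-> forall t, Dset (instN p t).
Proof.
  split.
  - intros H t. apply (Dset_nd1 _ _ H). apply nd_allE, nd_ax; left; auto.
  - intro H. apply NNPP; intro Hn. apply Dset_not in Hn.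
    (* Universal formulas are reduced to existential ones: the negation of [fall p] derives
       [fex (fnot p)], which has a witness. *)
    assert (He : Dset (fex (fnot p))).
    { apply (Dset_nd1 _ _ Hn). apply nd_raa.
      eapply nd_impE; [apply nd_ax; right; left; reflexivity|].
      apply nd_allI, nd_raa. cbn [map].
      eapply nd_impE; [apply nd_ax; right; left; reflexivity|].
      apply nd_exI with (t := tvar 0). simpl. apply nd_ax; left.
      unfold instN. simpl. unfold fnot. f_equal.
      rewrite fsubst_comp. rewrite <- (fsubst_id p) at 1.
      apply fsubst_agree; [intros [|n] _; reflexivity|reflexivity]. }
    apply Dset_ex in He as [t Ht]. apply (Dset_not (instN p t)) in Ht; auto.
Qed.

Lemma Dset_all2 p : Dset (fall2 p) <-> forall j, Dset (instS p j).
Proof.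
  split.
  - intros H t. apply (Dset_nd1 _ _ H). apply nd_all2E, nd_ax; left; auto.
  - intro H. apply NNPP; intro Hn. apply Dset_not in Hn.
    assert (He : Dset (fex2 (fnot p))).
    { apply (Dset_nd1 _ _ Hn). apply nd_raa.
      eapply nd_impE; [apply nd_ax; right; left; reflexivity|].
      apply nd_all2I, nd_raa. cbn [map].
      eapply nd_impE; [apply nd_ax; right; left; reflexivity|].
      apply nd_ex2I with (j := 0). simpl. apply nd_ax; left.
      unfold instS. simpl. unfold fnot. f_equal.
      rewrite fsubst_comp. rewrite <- (fsubst_id p) at 1.
      apply fsubst_agree; [reflexivity|intros [|n] _; reflexivity]. }
    apply Dset_ex2 in He as [t Ht]. apply (Dset_not (instS p t)) in Ht; auto.
Qed.

Definition teq (s t : term) : Prop := Dset (feq s t).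

Lemma teq_refl t : teq t t.
Proof. apply (Dset_nd []); [intros ? []|apply nd_refl]. Qed.

Lemma Dset_leib p s t : teq s t -> Dset (instN p s) -> Dset (instN p t).
Proof.
  intros H H'. apply (Dset_nd2 _ _ _ H H').
  apply nd_leib with (s := s); apply nd_ax; simpl; auto.
Qed.

Lemma instN_lift_t t u : tsubst (fun n => match n with 0 => u | S k => tvar k end) (tlift t) = t.
Proof. unfold tlift. rewrite tsubst_comp. apply tsubst_id. Qed.

Lemma teq_sym s t : teq s t -> teq t s.
Proof.
  intro H. pose proof (Dset_leib (feq (tvar 0) (tlift s)) s t H) as L.
  unfold instN in L; simpl in L. rewrite !instN_lift_t in L. apply L, teq_refl.
Qed.
Lemma teq_trans s t u : teq s t -> teq t u -> teq s u.
Proof.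
  intros H H'. pose proof (Dset_leib (feq (tlift s) (tvar 0)) t u H') as L.
  unfold instN in L; simpl in L. rewrite !instN_lift_t in L. apply L, H.
Qed.

(** The quotient by provable equality is realised by chosen representatives, because [sat]
    interprets [feq] as equality of the elements themselves. *)
Definition trep (t : term) : term := epsilon (inhabits tzero) (teq t).
Lemma trep_teq t : teq t (trep t).
Proof. apply (epsilon_spec (inhabits tzero) (teq t)). exists t; apply teq_refl. Qed.
Lemma trep_eq s t : trep s = trep t <-> teq s t.
Proof.
  split; intro H.
  - eapply teq_trans; [apply trep_teq|]. rewrite H. apply teq_sym, trep_teq.
  - unfold trep. f_equal. apply functional_extensionality; intro u.
    apply propositional_extensionality; split; intro; eapply teq_trans; eauto using teq_sym.
Qed.
Lemma trep_idem t : trep (trep t) = trep t.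
Proof. apply trep_eq, teq_sym, trep_teq. Qed.

Definition hdom : Type := {t : term | trep t = t}.
Definition hcls (t : term) : hdom := exist _ (trep t) (trep_idem t).
Lemma hcls_eq s t : hcls s = hcls t <-> teq s t.
Proof.
  rewrite <- trep_eq. split; intro H.
  - exact (f_equal (@proj1_sig _ _) H).
  - apply subset_eq_compat, H.
Qed.
Lemma hcls_surj (x : hdom) : x = hcls (proj1_sig x).
Proof. destruct x as [t H]. apply subset_eq_compat. auto. Qed.

(** The set variables serve as the sets: the language has no equation between sets, so nothing has
    to be identified in this sort. *)
Definition hstruct : struct := {|
  dom := hdom; sset := nat;
  s_zero := hcls tzero; s_one := hcls tone;
  s_add := fun x y => hcls (tplus (proj1_sig x) (proj1_sig y));
  s_mul := fun x y => hcls (ttimes (proj1_sig x) (proj1_sig y));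
  s_lt := fun x y => Dset (flt (proj1_sig x) (proj1_sig y));
  s_mem := fun x X => Dset (fmem (proj1_sig x) X) |}.

Lemma teq_cong1 (f : term -> term -> term) s s' t t' :
  (forall a b u, tsubst u (f a b) = f (tsubst u a) (tsubst u b)) ->
  teq s s' -> teq t t' -> teq (f s t) (f s' t').
Proof.
  intros Hf H H'.
  pose proof (Dset_leib (feq (tlift (f s t)) (f (tvar 0) (tlift t))) s s' H) as L.
  unfold instN in L; simpl in L. rewrite !Hf, !instN_lift_t in L.
  pose proof (Dset_leib (feq (tlift (f s t)) (f (tlift s') (tvar 0))) t t' H') as L2.
  unfold instN in L2; simpl in L2. rewrite !Hf, !instN_lift_t in L2.
  apply L2, L, teq_refl.
Qed.

Lemma Dset_lt_cong s s' t t' : teq s s' -> teq t t' -> Dset (flt s t) -> Dset (flt s' t').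
Proof.
  intros H H' H0.
  pose proof (Dset_leib (flt (tvar 0) (tlift t)) s s' H) as L.
  unfold instN in L; simpl in L. rewrite !instN_lift_t in L.
  pose proof (Dset_leib (flt (tlift s') (tvar 0)) t t' H') as L2.
  unfold instN in L2; simpl in L2. rewrite !instN_lift_t in L2. auto.
Qed.

Lemma Dset_mem_cong s s' X : teq s s' -> Dset (fmem s X) -> Dset (fmem s' X).
Proof. intros H H0. apply (Dset_leib (fmem (tvar 0) X) s s' H H0). Qed.

Lemma hteval t sg : teval hstruct t (fun n => hcls (sg n)) = hcls (tsubst sg t).
Proof.
  induction t; simpl; try reflexivity; rewrite IHt1, IHt2; apply hcls_eq;
  apply teq_cong1; try reflexivity; apply teq_sym, trep_teq.
Qed.

Lemma instN_up p sg r t :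
  instN (fsubst (upN sg) r p) t = fsubst (t .: sg) r p.
Proof.
  unfold instN. rewrite fsubst_comp. apply fsubst_agree; [|reflexivity].
  intros [|n] _; simpl; [reflexivity|]. apply instN_lift_t.
Qed.
Lemma instS_up p sg r j :
  instS (fsubst sg (upS r) p) j = fsubst sg (j .: r) p.
Proof.
  unfold instS. rewrite fsubst_comp. apply fsubst_agree.
  - intros; apply tsubst_id.
  - intros [|n] _; reflexivity.
Qed.

Lemma truth p : forall sg r,
  sat hstruct p (fun n => hcls (sg n)) r <-> Dset (fsubst sg r p).
Proof.
  assert (EN : forall (t : term) sg, (hcls t .: fun n => hcls (sg n)) = fun n => hcls ((t .: sg) n)).
  { intros. apply functional_extensionality; intros [|n]; reflexivity. }
  induction p; intros sg r; cbn [sat fsubst].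
  - rewrite !hteval. apply hcls_eq.
  - rewrite !hteval. simpl. split; apply Dset_lt_cong; auto using trep_teq, teq_sym.
  - rewrite !hteval. simpl. split; apply Dset_mem_cong; auto using trep_teq, teq_sym.
  - split; [tauto|]. intro H; exact (Dset_bot H).
  - rewrite Dset_imp, IHp1, IHp2. tauto.
  - rewrite Dset_and, IHp1, IHp2. tauto.
  - rewrite Dset_or, IHp1, IHp2. tauto.
  - rewrite Dset_all. split; intros H t.
    + rewrite instN_up. apply IHp. rewrite <- EN. apply H.
    + rewrite (hcls_surj t), EN. apply IHp. rewrite <- instN_up. apply H.
  - rewrite Dset_ex. split; intros [t H].
    + exists (proj1_sig t). rewrite instN_up. apply IHp. rewrite <- EN, <- hcls_surj. apply H.
    + exists (hcls t). rewrite EN. apply IHp. rewrite <- instN_up. apply H.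
  - rewrite Dset_all2. split; intros H t.
    + rewrite instS_up. apply IHp, H.
    + apply IHp. rewrite <- instS_up. apply H.
  - rewrite Dset_ex2. split; intros [t H]; exists t.
    + rewrite instS_up. apply IHp, H.
    + apply IHp. rewrite <- instS_up. apply H.
Qed.

(** The enumeration of the numbers, obtained from codes of terms, is recorded because the cut will
    be built along it. *)
Theorem model_existence : exists (A : struct) (e : nat -> dom A) (s : nat -> sset A),
  (forall p, T p -> sat A p e s) /\ (exists en : nat -> dom A, forall x, exists n, en n = x).
Proof.
  exists hstruct, (fun n => hcls (tvar n)), (fun X => X). split.
  - intros p Hp. apply truth. rewrite fsubst_id. apply Dset_T, Hp.
  - exists (fun n => hcls (epsilon (inhabits tzero) (fun t => tcode t = n))).
    intro x. exists (tcode (proj1_sig x)). transitivity (hcls (proj1_sig x)); [|symmetry; apply hcls_surj].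
    f_equal. apply tcode_inj.
    apply (epsilon_spec (inhabits tzero) (fun t => tcode t = tcode (proj1_sig x))). eauto.
Qed.
End Henkin.

Lemma ffvN_allsN n p : ffvN (allsN n p) = ffvN p - n.
Proof. induction n; simpl; [lia|rewrite IHn; lia]. Qed.
Lemma ffvS_allsN n p : ffvS (allsN n p) = ffvS p.
Proof. induction n; simpl; auto. Qed.
Lemma ffvN_allsS n p : ffvN (allsS n p) = ffvN p.
Proof. induction n; simpl; auto. Qed.
Lemma ffvS_allsS n p : ffvS (allsS n p) = ffvS p - n.
Proof. induction n; simpl; [lia|rewrite IHn; lia]. Qed.
Lemma closure_closed p : ffvN (closure p) = 0 /\ ffvS (closure p) = 0.
Proof.
  unfold closure. rewrite ffvN_allsS, ffvN_allsN, ffvS_allsS, ffvS_allsN. lia.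
Qed.

Lemma sat_allsN A n : forall p e s,
  sat A (allsN n p) (fun i => e (i + n)) s -> (forall e', sat A (allsN n p) e' s) -> sat A p e s.
Proof.
  induction n as [|n IH]; simpl; intros p e s H HA.
  - replace e with (fun i => e (i + 0)); [exact H|].
    apply functional_extensionality; intro; f_equal; lia.
  - apply IH.
    + replace (fun i => e (i + n)) with (e n .: fun i => e (i + S n)); [apply H|].
      apply functional_extensionality; intros [|i]; simpl; f_equal; lia.
    + intro e'. rewrite <- (sc_eta e'). apply HA.
Qed.

Lemma sat_allsS A n : forall p e s,
  (forall s', sat A (allsS n p) e s') -> sat A p e s.
Proof.
  induction n as [|n IH]; simpl; intros p e s HA; [apply HA|].
  apply IH. intro s'. rewrite <- (sc_eta s'). apply HA.
Qed.

Lemma sat_closure A p e0 s0 : sat A (closure p) e0 s0 -> forall e s, sat A p e s.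
Proof.
  intros H e s.
  assert (H' : forall e s, sat A (closure p) e s).
  { intros e' s'. revert H. apply sat_agree; intros n; destruct (closure_closed p); lia. }
  unfold closure in H'.
  assert (forall e, sat A (allsN (ffvN p) p) e s).
  { intro e'. apply (sat_allsS A (ffvS p)). intro; apply H'. }
  apply (sat_allsN A (ffvN p)); auto.
Qed.

Lemma sat_closed A p : ffvN p = 0 -> ffvS p = 0 -> forall e s e' s', sat A p e s -> sat A p e' s'.
Proof. intros H H' e s e' s'. apply sat_agree; lia. Qed.

(** * Reading the sentences of second-order arithmetic in a structure *)

Section Reading.
Variable A : struct.
Notation "0" := (s_zero A). Notation "1" := (s_one A).
Notation "x + y" := (s_add A x y). Notation "x * y" := (s_mul A x y).
Notation "x < y" := (s_lt A x y). Notation "x ∈ X" := (s_mem A x X) (at level 70).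

Definition sp (a b : dom A) : dom A := (a + b) * (a + b) + a.
Definition sRem (a d r : dom A) : Prop := exists q, a = q * d + r /\ r < d.
Definition sSeq (c : dom A) : Prop := exists k a b, c = sp k (sp a b).
Definition sLen (c k : dom A) : Prop := exists a b, c = sp k (sp a b).
Definition sEntry (c i e : dom A) : Prop :=
  exists k a b, c = sp k (sp a b) /\ sRem a (1 + (i + 1) * b) e.
Definition sSame (c c' i : dom A) : Prop :=
  forall e e', sEntry c i e -> sEntry c' i e' -> e = e'.
Definition sOrd (c : dom A) : Prop :=
  sSeq c /\ forall k i j ei ej, sLen c k -> i < j -> j < k -> sEntry c i ei -> sEntry c j ej -> ej < ei \/ ej = ei.
Definition sOlt (c d : dom A) : Prop :=
  exists k k', sLen c k /\ sLen d k' /\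
    ((k < k' /\ forall i, i < k -> sSame c d i) \/
     (exists i, i < k /\ i < k' /\ (forall j, j < i -> sSame c d j) /\
        exists e e', sEntry c i e /\ sEntry d i e' /\ e < e')).
Definition sWO (a : dom A) : Prop :=
  ~ exists Fs, (forall n, exists m, sp n m ∈ Fs) /\
    (forall n m m', sp n m ∈ Fs -> sp n m' ∈ Fs -> m = m') /\
    sp 0 a ∈ Fs /\
    (forall n m m', sp n m ∈ Fs -> sp (n + 1) m' ∈ Fs -> sOrd m' /\ sOlt m' m).
Definition sBin (c : dom A) : Prop :=
  sSeq c /\ forall k i e, sLen c k -> i < k -> sEntry c i e -> e < 1 + 1.
Definition sPrefix (c' c : dom A) : Prop :=
  exists k' k, sLen c' k' /\ sLen c k /\ (k' < k \/ k' = k) /\ forall i, i < k' -> sSame c' c i.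
Definition sWKL : Prop :=
  forall Tr, ((forall c, c ∈ Tr -> sBin c) /\
     (forall c c', c ∈ Tr -> sBin c' -> sPrefix c' c -> c' ∈ Tr) /\
     (forall k, exists c, c ∈ Tr /\ sLen c k)) ->
  exists X, forall k, exists c, c ∈ Tr /\ sLen c k /\
    forall i e, i < k -> sEntry c i e -> ((e = 1 -> i ∈ X) /\ (i ∈ X -> e = 1)).
Definition sRT : Prop :=
  forall P, exists H, (forall n, exists m, n < m /\ m ∈ H) /\
    ((forall i j, i ∈ H -> j ∈ H -> i < j -> sp i j ∈ P) \/
     (forall i j, i ∈ H -> j ∈ H -> i < j -> ~ sp i j ∈ P)).

(** [cf] computes on concrete sentences, so the compiled formula and its reading are convertible;
    the same holds for the next three lemmas. *)
Lemma sat_Ord e s : sat A Ord_form e s <-> sOrd (e 0%nat).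
Proof. reflexivity. Qed.
Lemma sat_WO e s : sat A WO_form e s <-> sWO (e 0%nat).
Proof. reflexivity. Qed.
Lemma sat_WKL e s : sat A WKL_sentence e s <-> sWKL.
Proof. reflexivity. Qed.
Lemma sat_RT e s : sat A RT22_sentence e s <-> sRT.
Proof. reflexivity. Qed.
End Reading.

(** * Arithmetic in a model of RCA0 *)

(** The axioms are stated semantically, for arbitrary environments in place of closures. The set
    [rS0] yields an environment for the set variables, which must exist before comprehension can be
    applied. *)
Class RM := {
  rA : struct;
  rS0 : sset rA;
  ax_basic : forall p, BasicAx p -> forall e s, sat rA p e s;
  ax_ind : forall p, Sigma 1 p -> forall e s,
    sat rA p (s_zero rA .: e) s ->
    (forall x, sat rA p (x .: e) s -> sat rA p (s_add rA x (s_one rA) .: e) s) ->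
    forall x, sat rA p (x .: e) s;
  ax_comp : forall p q, Sigma 1 p -> Pi 1 q -> forall e s,
    (forall x, sat rA p (x .: e) s <-> sat rA q (x .: e) s) ->
    exists X, forall x, s_mem rA x X <-> sat rA p (x .: e) s }.

Declare Scope M_scope.
Delimit Scope M_scope with M.
Notation M := (dom rA).
Notation "0" := (s_zero rA) : M_scope.
Notation "1" := (s_one rA) : M_scope.
Notation "x + y" := (s_add rA x y) : M_scope.
Notation "x * y" := (s_mul rA x y) : M_scope.
Notation "x < y" := (s_lt rA x y) : M_scope.
Definition le `{RM} (x y : M) : Prop := (x < y + 1)%M.
Notation "x <= y" := (le x y) : M_scope.
Local Open Scope M_scope.

Section Arith.
Context `{R : RM}.
Implicit Types a b c d x y z m n : M.

Definition s00 : nat -> sset rA := fun _ => rS0.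
Definition e00 : nat -> M := fun _ => 0.

Lemma ind_ex p e s : Bounded p ->
  (exists y, sat rA p (y .: 0 .: e) s) ->
  (forall x, (exists y, sat rA p (y .: x .: e) s) -> exists y, sat rA p (y .: x + 1 .: e) s) ->
  forall x, exists y, sat rA p (y .: x .: e) s.
Proof.
  intros HB. apply (ax_ind (fex p)). apply Sig_ex, Pi_bd, HB.
Qed.

Lemma ind_bd p e s : Bounded p ->
  sat rA p (0 .: e) s -> (forall x, sat rA p (x .: e) s -> sat rA p (x + 1 .: e) s) ->
  forall x, sat rA p (x .: e) s.
Proof. intros HB. apply (ax_ind p). apply Sig_bd, HB. Qed.

Lemma add_0_r n : n + 0 = n.
Proof. exact (ax_basic _ ba5 e00 s00 n). Qed.
Lemma add_S_r m n : m + (n + 1) = m + n + 1.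
Proof. exact (ax_basic _ ba6 e00 s00 m n). Qed.
Lemma mul_0_r n : n * 0 = 0.
Proof. exact (ax_basic _ ba7 e00 s00 n). Qed.
Lemma mul_S_r m n : m * (n + 1) = m * n + m.
Proof. exact (ax_basic _ ba8 e00 s00 m n). Qed.
Lemma S_inj m n : m + 1 = n + 1 -> m = n.
Proof. exact (ax_basic _ ba2 e00 s00 m n). Qed.
Lemma S_neq0 n : n + 1 <> 0.
Proof. exact (ax_basic _ ba1 e00 s00 n). Qed.
Lemma nlt0 n : ~ n < 0.
Proof. exact (ax_basic _ ba3 e00 s00 n). Qed.
Lemma lt_S m n : m < n + 1 <-> m < n \/ m = n.
Proof. exact (ax_basic _ ba4 e00 s00 m n). Qed.

Local Ltac eqind t1 t2 e :=
  let H := fresh in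
  pose proof (ind_bd (feq t1 t2) e s00 (B_eq t1 t2)) as H; simpl in H; apply H; clear H.

Notation "'v0" := (tvar 0). Notation "'v1" := (tvar 1). Notation "'v2" := (tvar 2).

Lemma add_0_l n : 0 + n = n.
Proof.
  revert n. eqind (tplus tzero 'v0) ('v0) e00.
  - apply add_0_r.
  - intros x IH. now rewrite add_S_r, IH.
Qed.
Lemma add_S_l m n : m + 1 + n = m + n + 1.
Proof.
  revert n. eqind (tplus (tplus 'v1 tone) 'v0) (tplus (tplus 'v1 'v0) tone) (m .: e00).
  - now rewrite !add_0_r.
  - intros x IH. now rewrite !add_S_r, IH.
Qed.
Lemma add_comm m n : m + n = n + m.
Proof.
  revert n. eqind (tplus 'v1 'v0) (tplus 'v0 'v1) (m .: e00).
  - now rewrite add_0_r, add_0_l.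
  - intros x IH. now rewrite add_S_r, add_S_l, IH.
Qed.
Lemma add_assoc m n k : m + (n + k) = m + n + k.
Proof.
  revert k. eqind (tplus 'v1 (tplus 'v2 'v0)) (tplus (tplus 'v1 'v2) 'v0) (m .: n .: e00).
  - now rewrite !add_0_r.
  - intros x IH. now rewrite !add_S_r, IH.
Qed.
Lemma mul_0_l n : 0 * n = 0.
Proof.
  revert n. eqind (ttimes tzero 'v0) tzero e00.
  - apply mul_0_r.
  - intros x IH. now rewrite mul_S_r, IH, add_0_r.
Qed.
Lemma mul_S_l m n : (m + 1) * n = m * n + n.
Proof.
  revert n. eqind (ttimes (tplus 'v1 tone) 'v0) (tplus (ttimes 'v1 'v0) 'v0) (m .: e00).
  - now rewrite !mul_0_r, add_0_r.
  - intros x IH. rewrite !mul_S_r, IH, !add_S_r. f_equal.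
    rewrite <- !add_assoc. f_equal. apply add_comm.
Qed.
Lemma mul_comm m n : m * n = n * m.
Proof.
  revert n. eqind (ttimes 'v1 'v0) (ttimes 'v0 'v1) (m .: e00).
  - now rewrite mul_0_r, mul_0_l.
  - intros x IH. now rewrite mul_S_r, mul_S_l, IH.
Qed.
Lemma mul_1_l n : 1 * n = n.
Proof. rewrite <- (add_0_l 1), mul_S_l, mul_0_l. apply add_0_l. Qed.
Lemma mul_add_r m n k : k * (m + n) = k * m + k * n.
Proof.
  revert n. eqind (ttimes 'v2 (tplus 'v1 'v0)) (tplus (ttimes 'v2 'v1) (ttimes 'v2 'v0)) (m .: k .: e00).
  - now rewrite mul_0_r, !add_0_r.
  - intros x IH. now rewrite add_S_r, !mul_S_r, IH, add_assoc.
Qed.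
Lemma mul_add_l m n k : (m + n) * k = m * k + n * k.
Proof. now rewrite mul_comm, mul_add_r, (mul_comm k m), (mul_comm k n). Qed.
Lemma mul_assoc m n k : m * (n * k) = m * n * k.
Proof.
  revert k. eqind (ttimes 'v1 (ttimes 'v2 'v0)) (ttimes (ttimes 'v1 'v2) 'v0) (m .: n .: e00).
  - now rewrite !mul_0_r.
  - intros x IH. now rewrite !mul_S_r, mul_add_r, IH.
Qed.

Lemma M_srt : semi_ring_theory (s_zero rA) (s_one rA) (s_add rA) (s_mul rA) eq.
Proof.
  constructor; auto using add_0_l, add_comm, add_assoc, mul_1_l, mul_0_l, mul_comm, mul_assoc, mul_add_l.
Qed.
Add Ring Mring : M_srt.

Lemma add_cancel_r a b c : a + c = b + c -> a = b.
Proof.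
  revert c.
  pose proof (ind_bd (fimp (feq (tplus 'v1 'v0) (tplus 'v2 'v0)) (feq 'v1 'v2)) (a .: b .: e00) s00) as H.
  simpl in H. apply H; clear H.
  - repeat constructor.
  - now rewrite !add_0_r.
  - intros x IH E. apply IH, S_inj. now rewrite <- !add_S_r.
Qed.

Lemma lt_iff m n : m < n <-> exists d, n = m + d + 1.
Proof.
  split.
  (* The hypothesis [m < n] is moved into the matrix as a disjunct, since the induction formula has
     to be one existential quantifier over a bounded formula. *)
  - pose proof (ind_ex (forr (feq 'v1 (tplus (tplus 'v2 'v0) tone)) (fnot (flt 'v2 'v1))) (m .: e00) s00) as H.
    simpl in H. intro Hl. destruct (H ltac:(repeat constructor)) with n as [d [E|E]]; [| |eauto|contradiction].
    + exists 0. right. apply nlt0.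
    + intros x [d [E|E]].
      * exists (d + 1). left. rewrite E. ring.
      * destruct (classic (m = x)) as [->|Hn].
        -- exists 0. left. ring.
        -- exists 0. right. rewrite lt_S. tauto.
  - intros [d ->]. revert d.
    pose proof (ind_bd (flt 'v1 (tplus (tplus 'v1 'v0) tone)) (m .: e00) s00) as H.
    simpl in H. apply H; clear H.
    + constructor.
    + rewrite add_0_r. apply lt_S. auto.
    + intros x IH. apply lt_S. left. now rewrite add_S_r.
Qed.

Lemma lt_irrefl n : ~ n < n.
Proof.
  rewrite lt_iff. intros [d E]. apply (S_neq0 d).
  apply add_cancel_r with n. rewrite add_0_l. rewrite E at 2. ring.
Qed.

Lemma zero_or_S n : n = 0 \/ exists m, n = m + 1.
Proof.
  pose proof (ind_ex (forr (feq 'v1 tzero) (feq 'v1 (tplus 'v0 tone))) e00 s00) as H.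
  simpl in H. destruct (H ltac:(repeat constructor)) with n as [d [E|E]]; [| |auto|eauto].
  - exists 0; auto.
  - intros x _. exists x; auto.
Qed.

Lemma lt_trans a b c : a < b -> b < c -> a < c.
Proof.
  rewrite !lt_iff. intros [d ->] [d' ->]. exists (d + d' + 1). ring.
Qed.

Lemma lt_total a b : a < b \/ a = b \/ b < a.
Proof.
  pose proof (ind_ex (forr (feq 'v1 (tplus (tplus 'v2 'v0) tone)) (feq 'v2 (tplus 'v1 'v0))) (a .: e00) s00) as H.
  simpl in H. destruct (H ltac:(repeat constructor)) with b as [d [E|E]].
  - exists a. right. ring.
  - intros x [d [E|E]].
    + exists (d + 1). left. rewrite E; ring.
    + destruct (zero_or_S d) as [->|[d' ->]].
      * exists 0. left. rewrite E; ring.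
      * exists d'. right. rewrite E; ring.
  - left. apply lt_iff; eauto.
  - destruct (zero_or_S d) as [->|[d' ->]]; [right; left; rewrite E; ring|].
    right; right. apply lt_iff. exists d'. rewrite E; ring.
Qed.

Lemma le_iff m n : m <= n <-> exists d, n = m + d.
Proof.
  unfold le. rewrite lt_iff. split; intros [d E]; exists d.
  - apply S_inj, E.
  - now rewrite E.
Qed.

Lemma nlt_le a b : ~ a < b <-> b <= a.
Proof.
  split.
  - intro H. apply lt_S. destruct (lt_total a b) as [|[|]]; subst; auto; contradiction.
  - intros H H'. apply lt_S in H as [H| ->]; [|exact (lt_irrefl _ H')].
    exact (lt_irrefl _ (lt_trans _ _ _ H H')).
Qed.
Lemma nle_lt a b : ~ a <= b <-> b < a.
Proof. rewrite <- nlt_le. split; [apply NNPP|tauto]. Qed.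
Lemma lt_le1 a b : a < b <-> a + 1 <= b.
Proof. rewrite lt_iff, le_iff. split; intros [d E]; exists d; rewrite E; ring. Qed.
Lemma eq_le a b : a = b -> a <= b.
Proof. intros ->. apply lt_S. auto. Qed.
Lemma le_antisym a b : a <= b -> b <= a -> a = b.
Proof.
  intros H H'. apply nlt_le in H, H'. destruct (lt_total a b) as [|[|]]; tauto.
Qed.

End Arith.

(** * Linear arithmetic by Fourier-Motzkin elimination *)

Section Linear.
Context `{R : RM}.
Add Ring Mring' : M_srt.

Fixpoint nmul (k : nat) (x : M) : M :=
  match k with O => 0 | S k => x + nmul k x end.
Lemma nmul_add k l x : nmul (k + l) x = nmul k x + nmul l x.
Proof. induction k; simpl; [ring|rewrite IHk; ring]. Qed.
Lemma nmul_addr k x y : nmul k (x + y) = nmul k x + nmul k y.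
Proof. induction k; simpl; [ring|rewrite IHk; ring]. Qed.
Lemma nmul_mul k l x : nmul (k * l) x = nmul k (nmul l x).
Proof. induction k; simpl; [ring|rewrite nmul_add, IHk; ring]. Qed.
Lemma nmul_le k x y : x <= y -> nmul k x <= nmul k y.
Proof.
  rewrite !le_iff. intros [d ->]. exists (nmul k d). apply nmul_addr.
Qed.

(* A linear constraint is a vector of integer coefficients (entry 0 is the
   constant); as [M] has no subtraction, it asserts that the negative part
   is at most the positive part. *)
Fixpoint lev (f : Z -> nat) (l : list Z) (xs : list M) : M :=
  match l, xs with
  | z :: l, x :: xs => nmul (f z) x + lev f l xs
  | _, _ => 0
  end.
Definition zneg (z : Z) : nat := Z.to_nat (- z).
Definition cst (xs : list M) (l : list Z) : Prop :=
  length l = length xs /\ lev zneg l xs <= lev Z.to_nat l xs.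

Fixpoint vcomb (a : nat) (l : list Z) (b : nat) (m : list Z) : list Z :=
  match l, m with
  | x :: l, y :: m => (Z.of_nat a * x + Z.of_nat b * y)%Z :: vcomb a l b m
  | _, _ => nil
  end.

(** This is linearity of the difference of positive and negative part, with all subtracted terms
    moved to the other side. The integer identity [K] proves it for each coefficient. *)
Lemma lev_comb a b : forall xs l m, length l = length xs -> length m = length xs ->
  lev Z.to_nat (vcomb a l b m) xs + nmul a (lev zneg l xs) + nmul b (lev zneg m xs)
  = lev zneg (vcomb a l b m) xs + nmul a (lev Z.to_nat l xs) + nmul b (lev Z.to_nat m xs).
Proof.
  assert (K : forall x y, (Z.to_nat (Z.of_nat a * x + Z.of_nat b * y) + a * zneg x + b * zneg y
     = zneg (Z.of_nat a * x + Z.of_nat b * y) + a * Z.to_nat x + b * Z.to_nat y)%nat).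
  { intros x y. unfold zneg. nia. }
  induction xs as [|t xs IH]; intros [|x l] [|y m]; simpl; try discriminate; [reflexivity|].
  intros Hl Hm. injection Hl; injection Hm; intros Hm' Hl'. specialize (IH l m Hl' Hm').
  rewrite !nmul_addr, <- !nmul_mul.
  pose proof (f_equal (fun k => nmul k t) (K x y)) as E'. cbv beta in E'.
  rewrite !nmul_add in E'.
  transitivity ((nmul (Z.to_nat (Z.of_nat a * x + Z.of_nat b * y)) t + nmul (a * zneg x) t + nmul (b * zneg y) t)
    + (lev Z.to_nat (vcomb a l b m) xs + nmul a (lev zneg l xs) + nmul b (lev zneg m xs))); [ring|].
  rewrite IH, E'. ring.
Qed.

Lemma cst_comb xs a b l m : cst xs l -> cst xs m -> cst xs (vcomb a l b m).
Proof.
  intros [Hl L1] [Hm L2]. split.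
  - clear L1 L2. revert l m Hl Hm.
    induction xs; intros [|x l] [|y m]; simpl; try discriminate; auto.
  - pose proof (lev_comb a b xs l m Hl Hm) as E.
    apply (nmul_le a) in L1. apply (nmul_le b) in L2. apply le_iff in L1 as [d1 E1], L2 as [d2 E2].
    rewrite E1, E2 in E. apply le_iff. exists (d1 + d2).
    apply add_cancel_r with (nmul a (lev zneg l xs) + nmul b (lev zneg m xs)).
    rewrite add_assoc, E. ring.
Qed.

Definition getz (i : nat) (l : list Z) : Z := nth i l 0%Z.

(** One elimination step: each constraint with positive coefficient at [i] is paired with each one
    with negative coefficient, and the multipliers cancel the entry [i]. *)
Definition elim (i : nat) (cs : list (list Z)) : list (list Z) :=
  let pos := filter (fun c => Z.ltb 0 (getz i c)) cs in
  let neg := filter (fun c => Z.ltb (getz i c) 0) cs in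
  filter (fun c => Z.eqb (getz i c) 0) cs ++
  flat_map (fun c => map (fun d => vcomb (Z.to_nat (- getz i d)) c (Z.to_nat (getz i c)) d) neg) pos.

(** A negative constant without any positive coefficient is a contradiction, because the variables
    are nonnegative. Testing for this before each elimination can stop the growth of the list
    early. *)
Fixpoint fm (i : nat) (cs : list (list Z)) : bool :=
  match i with
  | O => existsb (fun c => Z.ltb (getz 0 c) 0 && forallb (fun z => Z.eqb z 0) (tl c))%bool cs
  | S j => (existsb (fun c => Z.ltb (getz 0 c) 0 && forallb (fun z => Z.leb z 0) c)%bool cs || fm j (elim i cs))%bool
  end.

Lemma elim_cst xs i cs : (forall c, In c cs -> cst xs c) -> forall c, In c (elim i cs) -> cst xs c.
Proof.
  intros HH c Hc. unfold elim in Hc. apply in_app_or in Hc as [Hc|Hc].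
  - apply filter_In in Hc. apply HH, Hc.
  - apply in_flat_map in Hc as (c1 & H1 & Hc). apply in_map_iff in Hc as (c2 & <- & H2).
    apply filter_In in H1, H2. apply cst_comb; apply HH; tauto.
Qed.

Lemma lev_nonpos : forall l xs, forallb (fun z => Z.leb z 0) l = true -> lev Z.to_nat l xs = 0.
Proof.
  induction l as [|z l IH]; intros [|x xs]; simpl; auto.
  intro E. apply andb_prop in E as [E1 E2]. rewrite (IH xs E2).
  apply Z.leb_le in E1. replace (Z.to_nat z) with O by lia. simpl. ring.
Qed.

Lemma cst_false xs c : Z.ltb (getz 0 c) 0 = true -> forallb (fun z => Z.leb z 0) c = true ->
  cst (1 :: xs) c -> False.
Proof.
  destruct c as [|z l]; [discriminate|]. unfold getz. cbn [nth].
  intros E1 E2 [_ Hc]. rewrite (lev_nonpos _ (1 :: xs) E2) in Hc. simpl in Hc.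
  apply Z.ltb_lt in E1. unfold zneg in Hc at 1.
  destruct (Z.to_nat (- z)) as [|k] eqn:E; [lia|]. simpl in Hc.
  apply le_iff in Hc as [d Hd]. apply (S_neq0 (nmul k 1 + lev zneg l xs + d)).
  rewrite Hd. ring.
Qed.

Lemma fm_sound xs i : forall cs, fm i cs = true -> (forall c, In c cs -> cst (1 :: xs) c) -> False.
Proof.
  induction i as [|i IH]; cbn [fm]; intros cs E HC.
  - apply existsb_exists in E as (c & Hc & E). apply andb_prop in E as [E1 E2].
    apply (cst_false xs c E1); [|auto]. destruct c as [|z l]; auto. cbn [tl] in E2. cbn [forallb].
    unfold getz in E1; cbn [nth] in E1. apply andb_true_intro; split; [apply Z.ltb_lt in E1; apply Z.leb_le; lia|].
    apply forallb_forall. intros y Hy. rewrite forallb_forall in E2. apply E2 in Hy. apply Z.eqb_eq in Hy. apply Z.leb_le; lia.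
  - apply Bool.orb_prop in E as [E|E].
    + apply existsb_exists in E as (c & Hc & E). apply andb_prop in E as [E1 E2].
      apply (cst_false xs c E1 E2); auto.
    + apply (IH _ E). intros c. apply elim_cst, HC.
Qed.

Inductive lexp := Lv (n : nat) | Lz | Lo | La (a b : lexp).
Fixpoint leval (xs : list M) (t : lexp) : M :=
  match t with
  | Lv n => nth n xs 0 | Lz => 0 | Lo => 1 | La a b => leval xs a + leval xs b
  end.
Fixpoint lcoef (t : lexp) (n : nat) : Z :=
  match t with
  | Lv m => if Nat.eqb n (S m) then 1 else 0
  | Lz => 0
  | Lo => match n with O => 1 | _ => 0 end
  | La a b => lcoef a n + lcoef b n
  end%Z.
Definition lvec (k : nat) (p : lexp * lexp) : list Z :=
  map (fun n => lcoef (snd p) n - lcoef (fst p) n)%Z (seq 0 (S k)).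
Definition unitv (k n : nat) : list Z :=
  map (fun m => if Nat.eqb m n then 1 else 0)%Z (seq 0 (S k)).

Fixpoint lwf (k : nat) (t : lexp) : bool :=
  match t with Lv n => Nat.ltb n k | La a b => (lwf k a && lwf k b)%bool | _ => true end.

(** The curried form is the goal that remains when the hypotheses have been reverted, so that the
    tactic can pass to it by [change]. *)
Fixpoint limp (xs : list M) (L : list (lexp * lexp)) : Prop :=
  match L with nil => False | p :: L => leval xs (fst p) <= leval xs (snd p) -> limp xs L end.

Definition lsum (f : nat -> nat) (a : nat) (xs : list M) : M :=
  fold_right (fun p acc => nmul (f (fst p)) (snd p) + acc) 0 (combine (seq a (length xs)) xs).

Lemma lsum_cons f a x xs : lsum f a (x :: xs) = nmul (f a) x + lsum f (S a) xs.
Proof. reflexivity. Qed.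
Lemma lev_lsum g f : forall xs a,
  lev g (map f (seq a (length xs))) xs = lsum (fun n => g (f n)) a xs.
Proof. induction xs; intro b; [reflexivity|]. rewrite lsum_cons, <- IHxs. reflexivity. Qed.
Lemma lsum_add f g : forall xs a, lsum (fun n => f n + g n)%nat a xs = lsum f a xs + lsum g a xs.
Proof.
  induction xs; intro b; [unfold lsum; simpl; ring|]. rewrite !lsum_cons, IHxs, nmul_add. ring.
Qed.
Lemma lsum_ext f g : forall xs a, (forall n, f n = g n) -> lsum f a xs = lsum g a xs.
Proof. induction xs; intros b E; [reflexivity|]. rewrite !lsum_cons, E, (IHxs _ E). reflexivity. Qed.
Lemma lsum_zero f : forall xs a, (forall n, (a <= n)%nat -> f n = O) -> lsum f a xs = 0.
Proof.
  induction xs as [|x xs IH]; intros b E; [reflexivity|].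
  rewrite lsum_cons, E, IH; [simpl; ring|intros; apply E; lia|lia].
Qed.
Lemma lsum_unit m : forall xs a, (m < length xs)%nat ->
  lsum (fun n => if Nat.eqb n (a + m) then 1 else 0)%nat a xs = nth m xs 0.
Proof.
  revert m. induction m as [|m IH]; intros [|x xs] b Hm; simpl in Hm; try lia; rewrite lsum_cons.
  - rewrite Nat.add_0_r, Nat.eqb_refl, lsum_zero; [simpl; ring|].
    intros n Hn. destruct (Nat.eqb_spec n b); lia.
  - destruct (Nat.eqb_spec b (b + S m)); [lia|]. rewrite (lsum_ext _ (fun n => if Nat.eqb n (S b + m) then 1 else 0)%nat).
    + rewrite IH by lia. simpl. ring.
    + intro. replace (b + S m)%nat with (S b + m)%nat by lia. reflexivity.
Qed.

Lemma lcoef_nonneg t n : (0 <= lcoef t n)%Z.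
Proof. induction t; simpl; try lia; [destruct (Nat.eqb _ _)|destruct n]; lia. Qed.

Lemma leval_sum xs t : lwf (length xs) t = true ->
  leval xs t = lsum (fun n => Z.to_nat (lcoef t n)) 0 (1 :: xs).
Proof.
  induction t; cbn [lwf leval lcoef]; intro E.
  - apply Nat.ltb_lt in E. change (nth n xs 0) with (nth (S n) (1 :: xs) 0). rewrite <- (lsum_unit (S n) (1 :: xs) 0) by (simpl; lia).
    apply lsum_ext. intro m. simpl. destruct (Nat.eqb m (S n)); reflexivity.
  - symmetry. apply lsum_zero. reflexivity.
  - rewrite lsum_cons, lsum_zero; [simpl; ring|]. intros [|n] Hn; [lia|reflexivity].
  - apply andb_prop in E as [E1 E2]. rewrite IHt1, IHt2, <- lsum_add by auto.
    apply lsum_ext. intro m. pose proof (lcoef_nonneg t1 m). pose proof (lcoef_nonneg t2 m). lia.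
Qed.

Lemma lvec_cst xs p : lwf (length xs) (fst p) = true -> lwf (length xs) (snd p) = true ->
  leval xs (fst p) <= leval xs (snd p) -> cst (1 :: xs) (lvec (length xs) p).
Proof.
  destruct p as [a b]; cbn [fst snd]. intros Ha Hb Hl. split.
  - unfold lvec. rewrite length_map, length_seq. reflexivity.
  - unfold lvec; cbn [fst snd]. change (S (length xs)) with (length (1 :: xs)).
    rewrite !lev_lsum. rewrite !leval_sum in Hl by auto.
    set (A := lsum (fun n => Z.to_nat (lcoef a n)) 0 (1 :: xs)) in *.
    set (B := lsum (fun n => Z.to_nat (lcoef b n)) 0 (1 :: xs)) in *.
    assert (E : lsum (fun n => Z.to_nat (lcoef b n - lcoef a n)) 0 (1 :: xs) + A
      = lsum (fun n => zneg (lcoef b n - lcoef a n)) 0 (1 :: xs) + B).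
    { unfold A, B. rewrite <- !lsum_add. apply lsum_ext. intro n. unfold zneg.
      pose proof (lcoef_nonneg a n). pose proof (lcoef_nonneg b n). lia. }
    apply le_iff in Hl as [d Hd]. rewrite Hd in E. apply le_iff. exists d.
    apply add_cancel_r with A. rewrite E. ring.
Qed.

Lemma unitv_cst xs n : cst xs (map (fun m => if Nat.eqb m n then 1 else 0)%Z (seq 0 (length xs))).
Proof.
  split; [rewrite length_map, length_seq; reflexivity|].
  rewrite !lev_lsum. rewrite (lsum_zero (fun m => zneg _)).
  - apply le_iff. eexists. symmetry; apply add_0_l.
  - intros m _. destruct (Nat.eqb m n); reflexivity.
Qed.

(** The unit vectors added to the hypotheses say that the atoms are nonnegative. *)
Definition fmcheck (k : nat) (L : list (lexp * lexp)) : bool :=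
  (forallb (fun p => lwf k (fst p) && lwf k (snd p)) L &&
   fm k (map (unitv k) (seq 1 k) ++ map (lvec k) L))%bool.

Theorem fmcheck_sound xs L : fmcheck (length xs) L = true -> limp xs L.
Proof.
  unfold fmcheck. intro E. apply andb_prop in E as [E1 E2].
  assert (HH : (forall p, In p L -> leval xs (fst p) <= leval xs (snd p)) -> False).
  { intro HL. apply (fm_sound xs _ _ E2). intros c Hc. apply in_app_or in Hc as [Hc|Hc].
    - apply in_map_iff in Hc as (n & <- & _). apply (unitv_cst (1 :: xs)).
    - apply in_map_iff in Hc as (p & <- & Hp).
      rewrite forallb_forall in E1. pose proof (E1 p Hp) as Ep. apply andb_prop in Ep as [? ?].
      apply lvec_cst; auto. }
  clear E1 E2. induction L as [|p L IH]; simpl.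
  - apply HH. intros ? [].
  - intro Hp. apply IH. intro HL. apply HH. intros q [<-|Hq]; auto.
Qed.
End Linear.

Ltac m_in x xs :=
  lazymatch xs with
  | nil => constr:(false)
  | ?y :: ?ys => let b := match constr:(Set) with
                 | _ => let _ := match constr:(Set) with _ => constr_eq x y end in constr:(true)
                 | _ => m_in x ys end in b
  end.
Ltac m_atoms t xs :=
  lazymatch t with
  | s_zero _ => xs
  | s_one _ => xs
  | s_add _ ?a ?b => let ys := m_atoms a xs in m_atoms b ys
  | _ => let b := m_in t xs in
         lazymatch b with true => xs | false => constr:(t :: xs) end
  end.
Ltac m_idx x xs :=
  lazymatch xs with
  | ?y :: ?ys => match constr:(Set) with
                 | _ => let _ := match constr:(Set) with _ => constr_eq x y end in constr:(O)
                 | _ => let n := m_idx x ys in constr:(S n) end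
  end.
Ltac m_reify t xs :=
  lazymatch t with
  | s_zero _ => constr:(Lz)
  | s_one _ => constr:(Lo)
  | s_add _ ?a ?b => let u := m_reify a xs in let v := m_reify b xs in constr:(La u v)
  | _ => let n := m_idx t xs in constr:(Lv n)
  end.
Ltac m_gatoms g xs :=
  lazymatch g with
  | le ?a ?b -> ?g' => let ys := m_atoms a xs in let zs := m_atoms b ys in m_gatoms g' zs
  | _ => xs
  end.
Ltac m_greify g xs :=
  lazymatch g with
  | le ?a ?b -> ?g' => let u := m_reify a xs in let v := m_reify b xs in
      let l := m_greify g' xs in constr:((u, v) :: l)
  | _ => constr:(@nil (lexp * lexp))
  end.
(** Replacing [a < b] by [a + 1 <= b] is where discreteness of the order enters; the elimination
    itself only reasons over the rationals. *)
Ltac m_hyps :=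
  repeat match goal with
  | H : ~ (s_lt _ ?a ?b) |- _ => apply nlt_le in H
  | H : ~ (le ?a ?b) |- _ => apply nle_lt in H
  | H : s_lt _ ?a ?b -> False |- _ => apply nlt_le in H
  | H : le ?a ?b -> False |- _ => apply nle_lt in H
  | H : _ /\ _ |- _ => destruct H
  end;
  repeat match goal with
  | H : s_lt _ ?a ?b |- _ => apply lt_le1 in H
  end;
  repeat match goal with
  | H : le ?a ?b |- _ => revert H
  | H : @eq (dom rA) ?a ?b |- _ =>
      let H1 := fresh in let H2 := fresh in
      pose proof (eq_le a b H) as H1; pose proof (eq_le b a (eq_sym H)) as H2; clear H; revert H1 H2
  end.
Ltac m_solve :=
  m_hyps;
  lazymatch goal with |- ?g =>
    let t := lazymatch g with le ?a _ -> _ => type of a end in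
    let xs := m_gatoms g (@nil t) in
    let L := m_greify g xs in
    change (limp xs L); apply fmcheck_sound; vm_compute; reflexivity
  end.
Ltac ml :=
  intros;
  lazymatch goal with
  | |- s_lt _ ?a ?b => apply NNPP; intro; m_solve
  | |- le ?a ?b => apply NNPP; intro; m_solve
  | |- ~ _ => intro; m_solve
  | |- @eq _ _ _ => apply le_antisym; apply NNPP; intro; m_solve
  | |- False => m_solve
  | |- _ /\ _ => split; ml
  | |- _ => exfalso; m_solve
  end.

(** * Recursive functions and predicates of the model *)

Section Rec.
Context `{R : RM}.
Add Ring Mring3 : M_srt.

(* By comprehension these are the Delta^0_1 predicates with parameters. *)
Definition Dl (Q : M -> Prop) : Prop := exists X, forall x, s_mem rA x X <-> Q x.

Lemma Dl_ext Q Q' : (forall x, Q x <-> Q' x) -> Dl Q -> Dl Q'.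
Proof. intros E [X HX]. exists X. intro x. rewrite HX. apply E. Qed.

Lemma Dl_bd p e s : Bounded p -> Dl (fun x => sat rA p (x .: e) s).
Proof.
  intro HB. apply (ax_comp p p); [apply Sig_bd|apply Pi_bd|]; tauto.
Qed.

Lemma Dl_delta p q e s : Bounded p -> Bounded q ->
  (forall x, (exists y, sat rA p (y .: x .: e) s) <-> (forall y, sat rA q (y .: x .: e) s)) ->
  Dl (fun x => exists y, sat rA p (y .: x .: e) s).
Proof.
  intros HP HQ HE. apply (ax_comp (fex p) (fall q)).
  - apply Sig_ex, Pi_bd, HP.
  - apply Pi_all, Sig_bd, HQ.
  - exact HE.
Qed.

Lemma Dl_not Q : Dl Q -> Dl (fun x => ~ Q x).
Proof.
  intros [X HX]. eapply Dl_ext; [|apply (Dl_bd (fnot (fmem (tvar 0) 0)) e00 (X .: s00)); repeat constructor].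
  intro x. simpl. rewrite HX. tauto.
Qed.
Lemma Dl_and Q Q' : Dl Q -> Dl Q' -> Dl (fun x => Q x /\ Q' x).
Proof.
  intros [X HX] [Y HY].
  eapply Dl_ext; [|apply (Dl_bd (fand (fmem (tvar 0) 0) (fmem (tvar 0) 1)) e00 (X .: Y .: s00)); repeat constructor].
  intro x. simpl. rewrite HX, HY. tauto.
Qed.
Lemma Dl_or Q Q' : Dl Q -> Dl Q' -> Dl (fun x => Q x \/ Q' x).
Proof.
  intros H H'. eapply Dl_ext; [|apply Dl_not, Dl_and; [apply Dl_not, H|apply Dl_not, H']].
  intro x. simpl. tauto.
Qed.
Lemma Dl_imp Q Q' : Dl Q -> Dl Q' -> Dl (fun x => Q x -> Q' x).
Proof.
  intros H H'. eapply Dl_ext; [|apply Dl_or; [apply Dl_not, H|apply H']].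
  intro x. simpl. tauto.
Qed.
Lemma Dl_iff Q Q' : Dl Q -> Dl Q' -> Dl (fun x => Q x <-> Q' x).
Proof. intros. apply Dl_and; apply Dl_imp; auto. Qed.
Lemma Dl_const (P : Prop) : Dl (fun _ => P).
Proof.
  destruct (classic P) as [HP|HP].
  - eapply Dl_ext; [|apply (Dl_bd (fnot fbot) e00 s00); repeat constructor]. simpl; tauto.
  - eapply Dl_ext; [|apply (Dl_bd fbot e00 s00); repeat constructor]. simpl; tauto.
Qed.

Definition pr (a b : M) : M := (a + b) * (a + b) + a.
Definition tpr (a b : term) : term := tplus (ttimes (tplus a b) (tplus a b)) a.

Lemma mul_le a b c : a <= b -> a * c <= b * c.
Proof.
  rewrite !le_iff. intros [d ->]. exists (d * c). ring.
Qed.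
Lemma mul_le2 a b c d : a <= b -> c <= d -> a * c <= b * d.
Proof.
  rewrite !le_iff. intros [u ->] [v ->]. exists (a * v + u * c + u * v). ring.
Qed.
Lemma le_sq s : s <= s * s.
Proof.
  destruct (zero_or_S s) as [->|[m ->]]; apply le_iff; [exists 0|exists (m * (m + 1))]; ring.
Qed.
Lemma pr_ge1 a b : a <= pr a b.
Proof. unfold pr. ml. Qed.
Lemma pr_ge2 a b : b <= pr a b.
Proof. unfold pr. pose proof (le_sq (a + b)). ml. Qed.
Lemma pr_inj a b c d : pr a b = pr c d -> a = c /\ b = d.
Proof.
  unfold pr. intro E.
  assert (K : forall a b c d, (a + b) * (a + b) + a = (c + d) * (c + d) + c -> ~ a + b < c + d).
  { clear. intros a b c d E Hl. apply lt_le1 in Hl. pose proof (mul_le2 _ _ _ _ Hl Hl) as L.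
    replace ((a + b + 1) * (a + b + 1)) with ((a + b) * (a + b) + (a + b) + (a + b) + 1) in L by ring.
    ml. }
  pose proof (K _ _ _ _ E) as K1. pose proof (K _ _ _ _ (eq_sym E)) as K2.
  assert (Es : a + b = c + d) by ml. rewrite Es in E.
  assert (a = c) by ml. split; ml.
Qed.

Definition ispr (w : M) : Prop := exists a b, w = pr a b.
(* On codes which are not pairs both projections are 0. *)
Definition fst (w : M) : M :=
  epsilon (inhabits 0) (fun a => (exists b, w = pr a b) \/ (~ ispr w /\ a = 0)).
Definition snd (w : M) : M :=
  epsilon (inhabits 0) (fun b => (exists a, w = pr a b) \/ (~ ispr w /\ b = 0)).
Lemma fst_spec w : (exists b, w = pr (fst w) b) \/ (~ ispr w /\ fst w = 0).
Proof.
  unfold fst. apply epsilon_spec. destruct (classic (ispr w)) as [[a [b ->]]|H].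
  - exists a; left; eauto.
  - exists 0; auto.
Qed.
Lemma snd_spec w : (exists a, w = pr a (snd w)) \/ (~ ispr w /\ snd w = 0).
Proof.
  unfold snd. apply epsilon_spec. destruct (classic (ispr w)) as [[a [b ->]]|H].
  - exists b; left; eauto.
  - exists 0; auto.
Qed.
Lemma fst_pr a b : fst (pr a b) = a.
Proof.
  destruct (fst_spec (pr a b)) as [[b' E]|[H _]].
  - apply pr_inj in E. symmetry; tauto.
  - exfalso; apply H; exists a, b; auto.
Qed.
Lemma snd_pr a b : snd (pr a b) = b.
Proof.
  destruct (snd_spec (pr a b)) as [[b' E]|[H _]].
  - apply pr_inj in E. symmetry; tauto.
  - exfalso; apply H; exists a, b; auto.
Qed.
Lemma fst_npr w : ~ ispr w -> fst w = 0.
Proof. intro H. destruct (fst_spec w) as [[b E]|[_ E]]; auto. exfalso; apply H; exists (fst w), b; auto. Qed.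
Lemma snd_npr w : ~ ispr w -> snd w = 0.
Proof. intro H. destruct (snd_spec w) as [[b E]|[_ E]]; auto. exfalso; apply H; exists b, (snd w); auto. Qed.

Definition fpr (w : term) : form :=
  fbex (tplus w tone) (fbex (tplus (tlift w) tone) (feq (tlift (tlift w)) (tpr (tvar 1) (tvar 0)))).
Lemma fpr_sat w e s : sat rA (fpr w) e s <-> ispr (teval rA w e).
Proof.
  unfold fpr, fbex, tlift. simpl. repeat (setoid_rewrite teval_subst; simpl).
  change (fun n => e n) with e. split.
  - intros (a & _ & b & _ & E). exists a, b. exact E.
  - intros (a & b & E). exists a. split; [rewrite E; apply pr_ge1|].
    exists b. split; [rewrite E; apply pr_ge2|exact E].
Qed.

Lemma Dl2_iff Q : (exists A, Dl A /\ forall x y, A (pr x y) <-> Q x y) <->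
  Dl (fun w => Q (fst w) (snd w)).
Proof.
  split.
  - intros (A & [X HX] & HA).
    (* A number that is not a pair has both projections 0. The truth value of [Q 0 0] thus decides
       whether all such numbers are put in or left out. *)
    set (p := if excluded_middle_informative (Q 0 0)
              then forr (fnot (fpr (tvar 0))) (fmem (tvar 0) 0)
              else fand (fpr (tvar 0)) (fmem (tvar 0) 0)).
    eapply Dl_ext; [|apply (Dl_bd p e00 (X .: s00))].
    + intro w. cbv beta.
      assert (E : Q (fst w) (snd w) <-> (ispr w /\ A w) \/ (~ ispr w /\ Q 0 0)).
      { destruct (classic (ispr w)) as [[a [b ->]]|H].
        - rewrite fst_pr, snd_pr, HA. assert (ispr (pr a b)) by (exists a, b; auto). tauto.
        - rewrite fst_npr, snd_npr by auto. tauto. }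
      rewrite E. unfold p. destruct (excluded_middle_informative (Q 0 0)); cbn [sat fnot];
        rewrite fpr_sat; simpl; rewrite HX; destruct (classic (ispr w)); tauto.
    + unfold p. destruct (excluded_middle_informative _); repeat constructor.
  - intro HD. exists (fun w => Q (fst w) (snd w)). split; auto.
    intros. rewrite fst_pr, snd_pr. tauto.
Qed.

(** Recursive means that the graph is a set of the model. Totality is built in, as [f] is a function
    of the metatheory. *)
Definition Rc (f : M -> M) : Prop := Dl (fun w => snd w = f (fst w)).

Lemma Rc_iff f : Rc f <-> exists A, Dl A /\ forall x y, A (pr x y) <-> y = f x.
Proof. unfold Rc. rewrite <- (Dl2_iff (fun x y => y = f x)). tauto. Qed.

Lemma Rc_ext f g : (forall x, f x = g x) -> Rc f -> Rc g.
Proof. intros E. apply Dl_ext. intro x. now rewrite E. Qed.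

Lemma Rc_set f : Rc f -> exists X, forall x y, s_mem rA (pr x y) X <-> y = f x.
Proof.
  intros [X HX]. exists X. intros. rewrite HX, fst_pr, snd_pr. tauto.
Qed.

(** The composition is Delta^0_1: some [y] with [y = f x] satisfies [A], equivalently every such [y]
    does. *)
Lemma Dl_comp A f : Dl A -> Rc f -> Dl (fun x => A (f x)).
Proof.
  intros [X HX] Hf. apply Rc_set in Hf as [Y HY].
  assert (HY' : forall x y, s_mem rA ((x + y) * (x + y) + x) Y <-> y = f x) by exact HY.
  eapply Dl_ext; [|apply (Dl_delta (fand (fmem (tpr (tvar 1) (tvar 0)) 0) (fmem (tvar 0) 1))
    (fimp (fmem (tpr (tvar 1) (tvar 0)) 0) (fmem (tvar 0) 1)) e00 (Y .: X .: s00)); [repeat constructor..|]].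
  - intro x. simpl. split.
    + intros (y & H1 & H2). apply HY' in H1 as ->. apply HX, H2.
    + intro H. exists (f x). rewrite HY', HX. auto.
  - intro x. simpl. split.
    + intros (y & H1 & H2) z Hz. apply HY' in H1. apply HY' in Hz. congruence.
    + intro H. exists (f x). split; [apply HY'; auto|]. apply H, HY'; auto.
Qed.

Lemma Dl_poly2 (t u : term) : Dl (fun w => teval rA t (snd w .: fst w .: e00) = teval rA u (snd w .: fst w .: e00)).
Proof.
  apply (Dl2_iff (fun x y => teval rA t (y .: x .: e00) = teval rA u (y .: x .: e00))).
  set (p := fbex (tplus (tvar 0) tone) (fbex (tplus (tvar 1) tone)
     (fand (feq (tvar 2) (tpr (tvar 1) (tvar 0))) (feq (tsubst (sc (tvar 0) (sc (tvar 1) (fun _ => tzero))) t)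
        (tsubst (sc (tvar 0) (sc (tvar 1) (fun _ => tzero))) u))))).
  exists (fun x => sat rA p (x .: e00) s00). split; [apply Dl_bd; repeat constructor|].
  intros x y. simpl.
  assert (E : forall v a b w, teval rA (tsubst (sc (tvar 0) (sc (tvar 1) (fun _ => tzero))) v) (b .: a .: w)
              = teval rA v (b .: a .: e00)).
  { intros. rewrite teval_subst. f_equal. apply functional_extensionality; intros [|[|n]]; reflexivity. }
  split.
  - intros (a & _ & b & _ & E1 & E2). rewrite !E in E2. change (pr x y = pr a b) in E1.
    apply pr_inj in E1 as [-> ->]. exact E2.
  - intro H. exists x. split; [apply pr_ge1|]. exists y. split; [apply pr_ge2|].
    split; [reflexivity|]. rewrite !E. exact H.
Qed.

Lemma Dl_ltb : Dl (fun w => fst w < snd w).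
Proof.
  apply (Dl2_iff (fun x y => x < y)).
  set (p := fbex (tplus (tvar 0) tone) (fbex (tplus (tvar 1) tone)
     (fand (feq (tvar 2) (tpr (tvar 1) (tvar 0))) (flt (tvar 1) (tvar 0))))).
  exists (fun x => sat rA p (x .: e00) s00). split; [apply Dl_bd; repeat constructor|].
  intros x y. simpl. split.
  - intros (a & _ & b & _ & E1 & E2). change (pr x y = pr a b) in E1.
    apply pr_inj in E1 as [-> ->]. exact E2.
  - intro H. exists x. split; [apply pr_ge1|]. exists y. split; [apply pr_ge2|]. auto.
Qed.

Lemma Rc_poly1 (t : term) : Rc (fun x => teval rA t (x .: e00)).
Proof.
  eapply Dl_ext; [|apply (Dl_poly2 (tvar 0) (tsubst (fun n => match n with O => tvar 1 | _ => tzero end) t))].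
  intro w. simpl. rewrite teval_subst. 
  replace (fun n => teval rA match n with O => tvar 1 | S _ => tzero end (snd w .: fst w .: e00))
    with (fst w .: e00); [tauto|].
  apply functional_extensionality; intros [|n]; reflexivity.
Qed.

Lemma Rc_id : Rc (fun x => x).
Proof. exact (Rc_poly1 (tvar 0)). Qed.
Lemma Rc_const c : Rc (fun _ => c).
Proof.
  apply Rc_iff.
  set (p := fbex (tplus (tvar 0) tone) (feq (tvar 1) (tpr (tvar 0) (tvar 2)))).
  exists (fun x => sat rA p (x .: c .: e00) s00). split; [apply Dl_bd; repeat constructor|].
  intros x y. simpl. split.
  - intros (a & _ & E). change (pr x y = pr a c) in E. apply pr_inj in E; tauto.
  - intros ->. exists x. split; [apply pr_ge1|reflexivity].
Qed.

Lemma Rc_pair f g : Rc f -> Rc g -> Rc (fun x => pr (f x) (g x)).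
Proof.
  intros Hf Hg. apply Rc_set in Hf as [X HX]. apply Rc_set in Hg as [Y HY]. apply Rc_iff.
  set (p := fbex (tplus (tvar 0) tone) (fbex (tplus (tvar 1) tone)
     (fand (feq (tvar 2) (tpr (tvar 1) (tvar 0)))
      (fbex (tplus (tvar 0) tone) (fbex (tplus (tvar 1) tone)
       (fand (feq (tvar 2) (tpr (tvar 1) (tvar 0)))
        (fand (fmem (tpr (tvar 3) (tvar 1)) 0) (fmem (tpr (tvar 3) (tvar 0)) 1)))))))).
  exists (fun x => sat rA p (x .: e00) (X .: Y .: s00)). split; [apply Dl_bd; repeat constructor|].
  intros x y. simpl. split.
  - intros (a & _ & b & _ & E1 & c & _ & d & _ & E2 & E3 & E4). change (pr x y = pr a b) in E1.
    apply pr_inj in E1 as [<- <-]. apply HX in E3. apply HY in E4. rewrite <- E3, <- E4. exact E2.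
  - intros ->. exists x. split; [apply pr_ge1|]. exists (pr (f x) (g x)). split; [apply pr_ge2|].
    split; [reflexivity|]. exists (f x). split; [apply pr_ge1|]. exists (g x). split; [apply pr_ge2|].
    split; [reflexivity|]. split; [apply HX|apply HY]; reflexivity.
Qed.

Lemma Rc_fst : Rc fst.
Proof.
  apply Rc_iff.
  set (p := fbex (tplus (tvar 0) tone) (fbex (tplus (tvar 1) tone)
     (fand (feq (tvar 2) (tpr (tvar 1) (tvar 0)))
      (forr (fbex (tplus (tvar 1) tone) (feq (tvar 2) (tpr (tvar 1) (tvar 0))))
        (fand (fnot (fpr (tvar 1))) (feq (tvar 0) tzero)))))).
  exists (fun x => sat rA p (x .: e00) s00). split; [apply Dl_bd; repeat constructor|].
  intros x y. unfold p, fbex, fnot. cbn [sat]. setoid_rewrite fpr_sat. simpl. split.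
  - intros (a & _ & b & _ & E1 & E2). change (pr x y = pr a b) in E1.
    apply pr_inj in E1 as [<- <-]. destruct E2 as [(c & _ & ->)|[E2 ->]].
    + symmetry; apply fst_pr.
    + symmetry; apply fst_npr; auto.
  - intros ->. exists x. split; [apply pr_ge1|]. exists (fst x). split; [apply pr_ge2|].
    split; [reflexivity|]. destruct (fst_spec x) as [[b E]|E]; [left|right; exact E].
    exists b. split; [rewrite E at 1; apply pr_ge2|exact E].
Qed.
Lemma Rc_snd : Rc snd.
Proof.
  apply Rc_iff.
  set (p := fbex (tplus (tvar 0) tone) (fbex (tplus (tvar 1) tone)
     (fand (feq (tvar 2) (tpr (tvar 1) (tvar 0)))
      (forr (fbex (tplus (tvar 1) tone) (feq (tvar 2) (tpr (tvar 0) (tvar 1))))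
        (fand (fnot (fpr (tvar 1))) (feq (tvar 0) tzero)))))).
  exists (fun x => sat rA p (x .: e00) s00). split; [apply Dl_bd; repeat constructor|].
  intros x y. unfold p, fbex, fnot. cbn [sat]. setoid_rewrite fpr_sat. simpl. split.
  - intros (a & _ & b & _ & E1 & E2). change (pr x y = pr a b) in E1.
    apply pr_inj in E1 as [<- <-]. destruct E2 as [(c & _ & ->)|[E2 ->]].
    + symmetry; apply snd_pr.
    + symmetry; apply snd_npr; auto.
  - intros ->. exists x. split; [apply pr_ge1|]. exists (snd x). split; [apply pr_ge2|].
    split; [reflexivity|]. destruct (snd_spec x) as [[b E]|E]; [left|right; exact E].
    exists b. split; [rewrite E at 1; apply pr_ge1|exact E].
Qed.

Lemma Rc_comp f g : Rc f -> Rc g -> Rc (fun x => f (g x)).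
Proof.
  intros Hf Hg.
  apply Rc_set in Hg as [Y HY]. apply Rc_set in Hf as [X HX].
  assert (HY' : forall x y, s_mem rA ((x + y) * (x + y) + x) Y <-> y = g x) by exact HY.
  assert (HX' : forall x y, s_mem rA ((x + y) * (x + y) + x) X <-> y = f x) by exact HX.
  apply Rc_iff.
  set (pw := fun q => fbex (tplus (tvar 1) tone) (fbex (tplus (tvar 2) tone)
     (fand (feq (tvar 3) (tpr (tvar 1) (tvar 0))) q))).
  set (p := pw (fand (fmem (tpr (tvar 1) (tvar 2)) 0) (fmem (tpr (tvar 2) (tvar 0)) 1))).
  set (q := pw (fimp (fmem (tpr (tvar 1) (tvar 2)) 0) (fmem (tpr (tvar 2) (tvar 0)) 1))).
  exists (fun x => exists y, sat rA p (y .: x .: e00) (Y .: X .: s00)). split.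
  - apply Dl_delta with (q := q); [repeat constructor..|].
    intro w. simpl. split.
    + intros (y & a & Ha & b & Hb & E & H1 & H2) z. exists a. split; auto. exists b. split; auto. split; auto.
      intro Hz. apply HY' in H1. apply HY' in Hz. congruence.
    + intro H. destruct (H 0) as (a & Ha & b & Hb & E & H1). clear H1.
      exists (g a), a. split; auto. exists b. split; auto. split; auto. split; [apply HY'; auto|].
      destruct (H (g a)) as (a' & Ha' & b' & Hb' & E' & H1).
      assert (EE : pr a b = pr a' b') by (etransitivity; [symmetry; exact E|exact E']).
      apply pr_inj in EE as [<- <-]. apply H1, HY'; auto.
  - intros x y. simpl. split.
    + intros (z & a & Ha & b & Hb & E & H1 & H2). change (pr x y = pr a b) in E.
      apply pr_inj in E as [<- <-]. apply HY' in H1. apply HX' in H2. congruence.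
    + intros ->. exists (g x), x. split; [apply pr_ge1|]. exists (f (g x)). split; [apply pr_ge2|].
      split; [reflexivity|]. split; [apply HY'|apply HX']; reflexivity.
Qed.

Lemma Rc_comp2 (h : M -> M -> M) f g :
  Rc (fun w => h (fst w) (snd w)) -> Rc f -> Rc g -> Rc (fun x => h (f x) (g x)).
Proof.
  intros Hh Hf Hg. eapply Rc_ext; [|apply (Rc_comp _ _ Hh (Rc_pair _ _ Hf Hg))].
  intro x. simpl. now rewrite fst_pr, snd_pr.
Qed.
Lemma Dl_comp2 (Q : M -> M -> Prop) f g :
  Dl (fun w => Q (fst w) (snd w)) -> Rc f -> Rc g -> Dl (fun x => Q (f x) (g x)).
Proof.
  intros Hh Hf Hg. eapply Dl_ext; [|apply (Dl_comp _ _ Hh (Rc_pair _ _ Hf Hg))].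
  intro x. simpl. now rewrite fst_pr, snd_pr.
Qed.

Lemma Dl_eq f g : Rc f -> Rc g -> Dl (fun x => f x = g x).
Proof.
  apply (Dl_comp2 (fun a b => a = b)). eapply Dl_ext; [|apply (Dl_poly2 (tvar 1) (tvar 0))].
  intro; simpl; tauto.
Qed.
Lemma Dl_lt f g : Rc f -> Rc g -> Dl (fun x => f x < g x).
Proof. apply (Dl_comp2 (fun a b => a < b)), Dl_ltb. Qed.

Lemma Rc_op2 (t : term) : Rc (fun w => teval rA t (snd w .: fst w .: e00)).
Proof.
  apply Rc_iff.
  set (sg := sc (tvar 0) (sc (tvar 1) (fun _ => tzero))).
  set (sg0 := fun _ : nat => tzero).
  set (p := fbex (tplus (tvar 0) tone) (fbex (tplus (tvar 1) tone)
     (fand (feq (tvar 2) (tpr (tvar 1) (tvar 0)))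
      (forr (fbex (tplus (tvar 1) tone) (fbex (tplus (tvar 2) tone)
           (fand (feq (tvar 3) (tpr (tvar 1) (tvar 0))) (feq (tvar 2) (tsubst sg t)))))
        (fand (fnot (fpr (tvar 1))) (feq (tvar 0) (tsubst sg0 t))))))).
  exists (fun x => sat rA p (x .: e00) s00). split; [apply Dl_bd; repeat constructor|].
  assert (E : forall v a b w, teval rA (tsubst sg v) (b .: a .: w) = teval rA v (b .: a .: e00)).
  { intros. rewrite teval_subst. f_equal. apply functional_extensionality; intros [|[|n]]; reflexivity. }
  assert (E0 : forall v w, teval rA (tsubst sg0 v) w = teval rA v (0 .: 0 .: e00)).
  { intros. rewrite teval_subst. f_equal. apply functional_extensionality; intros [|[|n]]; reflexivity. }
  intros x y. unfold p, fbex, fnot. cbn [sat]. setoid_rewrite fpr_sat. simpl. setoid_rewrite E. setoid_rewrite E0. split.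
  - intros (a & _ & b & _ & E1 & E2). change (pr x y = pr a b) in E1.
    apply pr_inj in E1 as [<- <-]. destruct E2 as [(c & _ & d & _ & E2 & ->)|[E2 ->]].
    + change (x = pr c d) in E2. subst x. now rewrite fst_pr, snd_pr.
    + now rewrite fst_npr, snd_npr.
  - intros ->. exists x. split; [apply pr_ge1|]. eexists. split; [apply pr_ge2|].
    split; [reflexivity|]. destruct (classic (ispr x)) as [[a [b ->]]|Hx]; [left|right].
    + exists a. split; [apply pr_ge1|]. exists b. split; [apply pr_ge2|]. split; [reflexivity|].
      now rewrite fst_pr, snd_pr.
    + split; [exact Hx|]. now rewrite fst_npr, snd_npr.
Qed.

Lemma Rc_add f g : Rc f -> Rc g -> Rc (fun x => f x + g x).
Proof. apply (Rc_comp2 (fun a b => a + b)). exact (Rc_op2 (tplus (tvar 1) (tvar 0))). Qed.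
Lemma Rc_mul f g : Rc f -> Rc g -> Rc (fun x => f x * g x).
Proof. apply (Rc_comp2 (fun a b => a * b)). exact (Rc_op2 (ttimes (tvar 1) (tvar 0))). Qed.
Lemma Dl_le f g : Rc f -> Rc g -> Dl (fun x => f x <= g x).
Proof. intros Hf Hg. apply Dl_lt; auto using Rc_add, Rc_const. Qed.

Lemma Dl_ball b (Q : M -> M -> Prop) : Rc b -> Dl (fun w => Q (fst w) (snd w)) ->
  Dl (fun z => forall i, i < b z -> Q z i).
Proof.
  intros Hb [X HX].
  set (p := fbex (tplus (tvar 0) tone) (fbex (tplus (tvar 1) tone)
     (fand (feq (tvar 2) (tpr (tvar 1) (tvar 0)))
      (fball (tvar 0) (fmem (tpr (tvar 2) (tvar 0)) 0))))).
  assert (HD : Dl (fun w => sat rA p (w .: e00) (X .: s00))) by (apply Dl_bd; repeat constructor).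
  eapply Dl_ext; [|apply (Dl_comp _ _ HD (Rc_pair _ _ Rc_id Hb))].
  intro z. simpl. split.
  - intros (a & _ & c & _ & E & H) i Hi. change (pr z (b z) = pr a c) in E.
    apply pr_inj in E as [<- <-]. apply H in Hi. change (s_mem rA (pr z i) X) in Hi.
    apply HX in Hi. now rewrite fst_pr, snd_pr in Hi.
  - intro H. exists z. split; [apply pr_ge1|]. exists (b z). split; [apply pr_ge2|].
    split; [reflexivity|]. intros i Hi. change (s_mem rA (pr z i) X). apply HX.
    rewrite fst_pr, snd_pr. auto.
Qed.
Lemma Dl_bex b (Q : M -> M -> Prop) : Rc b -> Dl (fun w => Q (fst w) (snd w)) ->
  Dl (fun z => exists i, i < b z /\ Q z i).
Proof.
  intros Hb HQ. eapply Dl_ext; [|apply Dl_not, (Dl_ball b (fun z i => ~ Q z i)); auto using Dl_not].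
  intro z. simpl. split.
  - intro H. apply NNPP; intro Hn. apply H. intros i Hi HQi. apply Hn; eauto.
  - intros (i & Hi & HQi) H. exact (H i Hi HQi).
Qed.
Lemma Dl_ble b (Q : M -> M -> Prop) : Rc b -> Dl (fun w => Q (fst w) (snd w)) ->
  Dl (fun z => forall i, i <= b z -> Q z i).
Proof. intros Hb HQ. apply (Dl_ball (fun z => b z + 1)); auto using Rc_add, Rc_const. Qed.
Lemma Dl_bexle b (Q : M -> M -> Prop) : Rc b -> Dl (fun w => Q (fst w) (snd w)) ->
  Dl (fun z => exists i, i <= b z /\ Q z i).
Proof. intros Hb HQ. apply (Dl_bex (fun z => b z + 1)); auto using Rc_add, Rc_const. Qed.

Definition ifm (P : Prop) (a b : M) : M := if excluded_middle_informative P then a else b.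
Lemma ifm_t (P : Prop) a b : P -> ifm P a b = a.
Proof. unfold ifm; destruct (excluded_middle_informative P); tauto. Qed.
Lemma ifm_f (P : Prop) a b : ~ P -> ifm P a b = b.
Proof. unfold ifm; destruct (excluded_middle_informative P); tauto. Qed.

Lemma Rc_if Q f g : Dl Q -> Rc f -> Rc g -> Rc (fun x => ifm (Q x) (f x) (g x)).
Proof.
  intros HQ Hf Hg. unfold Rc.
  eapply Dl_ext; [|apply (Dl_or (fun w => Q (fst w) /\ snd w = f (fst w)) (fun w => ~ Q (fst w) /\ snd w = g (fst w)))].
  - intro w. simpl. destruct (classic (Q (fst w))); [rewrite ifm_t|rewrite ifm_f]; tauto.
  - apply Dl_and; [apply (Dl_comp Q fst); auto using Rc_fst|exact Hf].
  - apply Dl_and; [apply Dl_not, (Dl_comp Q fst); auto using Rc_fst|exact Hg].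
Qed.

Lemma ind_Dl Q : Dl Q -> Q 0 -> (forall x, Q x -> Q (x + 1)) -> forall x, Q x.
Proof.
  intros [X HX] H0 HS x. apply HX.
  pose proof (ind_bd (fmem (tvar 0) 0) e00 (X .: s00) ltac:(constructor)) as H.
  simpl in H. apply H.
  - apply HX, H0.
  - intros y Hy. apply HX, HS, HX, Hy.
Qed.

Lemma sind_Dl Q : Dl Q -> (forall x, (forall y, y < x -> Q y) -> Q x) -> forall x, Q x.
Proof.
  intros HQ HS x. apply HS. revert x.
  apply (ind_Dl (fun x => forall y, y < x -> Q y)).
  - apply (Dl_ball (fun x => x) (fun _ y => Q y)); [apply Rc_id|]. apply (Dl_comp Q snd); auto using Rc_snd.
  - intros y Hy. destruct (nlt0 _ Hy).
  - intros x IH y Hy. apply lt_S in Hy as [Hy| ->]; auto.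
Qed.

Lemma least Q : Dl Q -> (exists x, Q x) -> exists x, Q x /\ forall y, y < x -> ~ Q y.
Proof.
  intros HQ [x Hx]. apply NNPP; intro Hn.
  revert x Hx. apply (sind_Dl (fun x => ~ Q x)); [apply Dl_not, HQ|].
  intros x IH Hx. apply Hn. eauto.
Qed.

Lemma greatest Q b : Dl Q -> (exists x, x < b /\ Q x) ->
  exists x, x < b /\ Q x /\ forall y, x < y -> y < b -> ~ Q y.
Proof.
  intros HQ [x [Hx HQx]].
  destruct (least (fun y => y <= b /\ forall z, z < b -> y <= z -> ~ Q z)) as (y & (Hyb & Hy) & Hm).
  - apply Dl_and; [apply Dl_le; auto using Rc_id, Rc_const|].
    apply (Dl_ball (fun _ => b) (fun y z => y <= z -> ~ Q z)); [apply Rc_const|].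
    apply Dl_imp; [apply Dl_le; auto using Rc_fst, Rc_snd|].
    apply Dl_not, (Dl_comp Q snd); auto using Rc_snd.
  - exists b. split; [ml|]. intros. ml.
  - destruct (zero_or_S y) as [->|[y' ->]].
    + exfalso. apply (Hy x Hx); auto. ml.
    + exists y'. split; [ml|]. split.
      * apply NNPP; intro Hn. apply (Hm y'); [ml|]. split; [ml|]. intros z Hz Hyz.
        destruct (classic (y' = z)) as [<-|Hne]; [exact Hn|]. apply Hy; auto.
        destruct (lt_total y' z) as [|[|]]; [ml|contradiction|ml].
      * intros z Hz Hzb. apply Hy; auto. ml.
Qed.

(** Bounded search that stops at [b] in any case, hence is total; the value [b] alone does not tell
    whether [P b] holds. *)
Definition mub (b : M) (P : M -> Prop) : M :=
  epsilon (inhabits 0) (fun y => (P y \/ y = b) /\ forall z, z < y -> ~ P z /\ z <> b).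
Lemma mub_spec b P : Dl P -> (P (mub b P) \/ mub b P = b) /\ forall z, z < mub b P -> ~ P z /\ z <> b.
Proof.
  intro HP. unfold mub. apply epsilon_spec.
  destruct (least (fun y => P y \/ y = b)) as (x & H1 & H2).
  - apply Dl_or; auto using Dl_eq, Rc_id, Rc_const.
  - eauto.
  - exists x. split; auto. intros z Hz. apply H2 in Hz. tauto.
Qed.
Lemma mub_le b P : Dl P -> mub b P <= b.
Proof.
  intro HP. destruct (mub_spec b P HP) as [_ H]. apply NNPP. intro Hn.
  apply nle_lt in Hn. apply H in Hn. tauto.
Qed.
Lemma mub_ex b P y : Dl P -> P y -> y <= b -> P (mub b P) /\ mub b P <= y.
Proof.
  intros HP Hy Hb. destruct (mub_spec b P HP) as [H1 H2]. pose proof (mub_le b P HP).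
  assert (L : mub b P <= y).
  { apply NNPP. intro Hn. apply nle_lt in Hn. apply H2 in Hn. tauto. }
  split; auto. destruct H1 as [|E]; auto. assert (y = mub b P) by ml. congruence.
Qed.

Lemma Rc_mub b (Q : M -> M -> Prop) : Rc b -> Dl (fun w => Q (fst w) (snd w)) ->
  Rc (fun z => mub (b z) (Q z)).
Proof.
  intros Hb HQ.
  assert (HQz : forall z, Dl (Q z)).
  { intro z. eapply Dl_ext; [|apply (Dl_comp2 Q (fun _ => z) (fun x => x) HQ); auto using Rc_id, Rc_const].
    intro; simpl; tauto. }
  assert (U : forall z y, y = mub (b z) (Q z) <-> ((Q z y \/ y = b z) /\ forall x, x < y -> ~ Q z x /\ x <> b z)).
  { intros z y. destruct (mub_spec (b z) (Q z) (HQz z)) as [H1 H2]. split; [intros ->; auto|].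
    intros [H3 H4]. set (m := mub (b z) (Q z)) in *.
    destruct (lt_total y m) as [L|[L|L]]; auto.
    - apply H2 in L. tauto.
    - apply H4 in L. tauto. }
  eapply Dl_ext. { intro w. symmetry. apply U. }
  apply Dl_and.
  - apply Dl_or; [exact HQ|]. apply Dl_eq; [apply Rc_snd|apply Rc_comp; auto using Rc_fst].
  - apply (Dl_ball snd (fun w x => ~ Q (fst w) x /\ x <> b (fst w))); [apply Rc_snd|].
    assert (R1 : Rc (fun w => fst (fst w))) by (apply Rc_comp; apply Rc_fst).
    apply Dl_and; [apply Dl_not, (Dl_comp2 Q); auto using Rc_snd|].
    apply Dl_not, Dl_eq; [apply Rc_snd|]. apply (Rc_comp b (fun w => fst (fst w))); auto.
Qed.

(* Unbounded search; the value is unspecified when [P] is empty. *)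
Definition mu (P : M -> Prop) : M :=
  epsilon (inhabits 0) (fun y => P y /\ forall z, z < y -> ~ P z).
Lemma mu_spec P : Dl P -> (exists y, P y) -> P (mu P) /\ forall z, z < mu P -> ~ P z.
Proof. intros HP HE. unfold mu. apply epsilon_spec. apply least; auto. Qed.

Lemma Dl_slice (Q : M -> M -> Prop) z : Dl (fun w => Q (fst w) (snd w)) -> Dl (Q z).
Proof.
  intro HQ. eapply Dl_ext; [|apply (Dl_comp2 Q (fun _ => z) (fun x => x) HQ); auto using Rc_id, Rc_const].
  intro; simpl; tauto.
Qed.
Lemma Rc_slice (f : M -> M -> M) z : Rc (fun w => f (fst w) (snd w)) -> Rc (f z).
Proof.
  intro HQ. eapply Rc_ext; [|apply (Rc_comp2 f (fun _ => z) (fun x => x) HQ); auto using Rc_id, Rc_const].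
  intro; simpl; reflexivity.
Qed.

Lemma Rc_mu (Q : M -> M -> Prop) : Dl (fun w => Q (fst w) (snd w)) ->
  (forall z, exists y, Q z y) -> Rc (fun z => mu (Q z)).
Proof.
  intros HQ HE.
  assert (U : forall z y, y = mu (Q z) <-> (Q z y /\ forall x, x < y -> ~ Q z x)).
  { intros z y. destruct (mu_spec (Q z) (Dl_slice Q z HQ) (HE z)) as [H1 H2]. split; [intros ->; auto|].
    intros [H3 H4]. destruct (lt_total y (mu (Q z))) as [L|[L|L]]; auto.
    - apply H2 in L. tauto.
    - apply H4 in L. tauto. }
  eapply Dl_ext. { intro w. symmetry. apply U. }
  apply Dl_and; [exact HQ|].
  apply (Dl_ball snd (fun w x => ~ Q (fst w) x)); [apply Rc_snd|].
  apply Dl_not, (Dl_comp2 Q); auto using Rc_snd. apply Rc_comp; apply Rc_fst.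
Qed.

(** * Sigma^0_1 predicates: induction and collection *)

Definition Sg (Q : M -> Prop) : Prop :=
  exists A : M -> M -> Prop, Dl (fun w => A (fst w) (snd w)) /\ forall z, Q z <-> exists y, A z y.

Lemma Sg_ext Q Q' : (forall x, Q x <-> Q' x) -> Sg Q -> Sg Q'.
Proof. intros E (A & HA & H). exists A. split; auto. intro z. rewrite <- E. apply H. Qed.
Lemma Sg_Dl Q : Dl Q -> Sg Q.
Proof.
  intro H. exists (fun z _ => Q z). split; [apply (Dl_comp Q fst); auto using Rc_fst|].
  intro z. split; [exists 0; auto|intros [_ ?]; auto].
Qed.
Lemma Sg_ex1 (Q : M -> M -> Prop) : Dl (fun w => Q (fst w) (snd w)) -> Sg (fun z => exists y, Q z y).
Proof. intro H. exists Q. split; auto. tauto. Qed.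
Lemma Sg_ex (Q : M -> M -> Prop) : Sg (fun w => Q (fst w) (snd w)) -> Sg (fun z => exists y, Q z y).
Proof.
  intros (A & HA & H).
  exists (fun z y => A (pr z (fst y)) (snd y)). split.
  - apply (Dl_comp2 A); auto; [apply Rc_pair; auto using Rc_fst|]; apply Rc_comp; auto using Rc_fst, Rc_snd.
  - intro z. split.
    + intros [y Hy]. specialize (H (pr z y)). rewrite fst_pr, snd_pr in H. apply H in Hy as [u Hu].
      exists (pr y u). now rewrite fst_pr, snd_pr.
    + intros [y Hy]. exists (fst y). specialize (H (pr z (fst y))). rewrite fst_pr, snd_pr in H.
      apply H. eauto.
Qed.
Lemma Sg_and Q Q' : Sg Q -> Sg Q' -> Sg (fun z => Q z /\ Q' z).
Proof.
  intros (A & HA & H) (B & HB & H').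
  exists (fun z y => A z (fst y) /\ B z (snd y)). split.
  - apply Dl_and; [apply (Dl_comp2 A)|apply (Dl_comp2 B)]; auto using Rc_fst; apply Rc_comp; auto using Rc_fst, Rc_snd.
  - intro z. rewrite H, H'. split.
    + intros [[y Hy] [u Hu]]. exists (pr y u). now rewrite fst_pr, snd_pr.
    + intros [y [H1 H2]]. eauto.
Qed.

Lemma ind_Sg Q : Sg Q -> Q 0 -> (forall x, Q x -> Q (x + 1)) -> forall x, Q x.
Proof.
  intros (A & [X HX] & H) H0 HS x. apply H.
  pose proof (ind_ex (fmem (tpr (tvar 1) (tvar 0)) 0) e00 (X .: s00) ltac:(constructor)) as HI.
  assert (HX' : forall z y, s_mem rA ((z + y) * (z + y) + z) X <-> A z y).
  { intros. fold (pr z y). rewrite HX, fst_pr, snd_pr. tauto. }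
  simpl in HI. destruct HI with x as [y Hy].
  - apply H in H0 as [y Hy]. exists y. apply HX', Hy.
  - intros z [y Hy]. assert (HQ : Q z) by (apply H; exists y; apply HX', Hy).
    apply HS, H in HQ as [u Hu]. exists u. apply HX', Hu.
  - exists y. apply HX', Hy.
Qed.

Definition msub (a b : M) : M := mub a (fun d => a <= b + d).
Lemma Rc_msub f g : Rc f -> Rc g -> Rc (fun x => msub (f x) (g x)).
Proof.
  intros Hf Hg. unfold msub. apply (Rc_mub f (fun x d => f x <= g x + d)); auto.
  apply Dl_le; [|apply Rc_add]; auto using Rc_snd; apply Rc_comp; auto using Rc_fst.
Qed.
Lemma msub_spec a b : a <= b + msub a b /\ (b <= a -> a = b + msub a b).
Proof.
  assert (HD : Dl (fun d => a <= b + d)) by (apply Dl_le; [|apply Rc_add]; auto using Rc_const, Rc_id).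
  destruct (mub_ex a (fun d => a <= b + d) a HD) as [H1 H2]; [ml|ml|]. fold (msub a b) in *.
  split; auto. intro Hb. apply le_iff in Hb as [d Ed]. subst a.
  destruct (mub_ex (b + d) (fun u => b + d <= b + u) d HD) as [H3 H4]; [ml|ml|].
  fold (msub (b + d) b) in *. ml.
Qed.

(** A failure at [x] is pushed down to [msub x i] for growing [i]. This is a Sigma^0_1 induction,
    and it ends with a failure at 0. *)
Lemma ind_Pi Q : Sg (fun x => ~ Q x) -> Q 0 -> (forall x, Q x -> Q (x + 1)) -> forall x, Q x.
Proof.
  intros HS H0 HQ x. apply NNPP. intro Hx.
  assert (K : forall i, i <= x -> ~ Q (msub x i)).
  (* The disjunct [x < i] keeps the claim inductive beyond [x], where truncated subtraction no
     longer decreases. *)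
  { assert (K : forall i, x < i \/ ~ Q (msub x i)); [|intros i Hi; destruct (K i); auto; exfalso; ml].
    destruct HS as (A & HA & H).
    apply (ind_Sg (fun i => x < i \/ ~ Q (msub x i))).
    - apply (Sg_ext (fun i => exists y, x < i \/ A (msub x i) y)).
      + intro i. rewrite H. split; [intros [y [|]]; eauto|intros [|[y ?]]; [exists 0|]; eauto].
      + apply Sg_ex1, Dl_or.
        * apply Dl_lt; auto using Rc_const, Rc_fst.
        * apply (Dl_comp2 A); auto using Rc_msub, Rc_const, Rc_fst, Rc_snd.
    - right. replace (msub x 0) with x; auto. destruct (msub_spec x 0) as [_ E].
      rewrite add_0_l in E. apply E. ml.
    - intros i [Hi|Hi]; [left; ml|].
      destruct (classic (x < i + 1)) as [|Hn]; auto. right. intro HQi. apply Hi.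
      replace (msub x i) with (msub x (i + 1) + 1); [apply HQ, HQi|].
      destruct (msub_spec x i) as [_ E1]. destruct (msub_spec x (i + 1)) as [_ E2].
      assert (i + 1 <= x) by ml. assert (i <= x) by ml. specialize (E1 ltac:(auto)). specialize (E2 ltac:(auto)). ml. }
  apply (K x); [ml|]. replace (msub x x) with 0; auto.
  destruct (msub_spec x x) as [_ E]. assert (x <= x) by ml. specialize (E ltac:(auto)). ml.
Qed.

(** Sigma^0_1 induction on the number of indices already bounded: passing to [c + 1] only adds the
    witness for [c] to the bound. *)
Lemma collect b (A : M -> M -> Prop) : Dl (fun w => A (fst w) (snd w)) ->
  (forall i, i < b -> exists y, A i y) -> exists v, forall i, i < b -> exists y, y < v /\ A i y.
Proof.
  intros HA HE.
  assert (K : forall c, c <= b -> exists v, forall i, i < c -> exists y, y < v /\ A i y); [|apply K; ml].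
  assert (HD : Dl (fun w => forall i, i < fst w -> exists y, y < snd w /\ A i y)).
  { apply (Dl_ball fst (fun w i => exists y, y < snd w /\ A i y)); [apply Rc_fst|].
    apply (Dl_bex (fun w => snd (fst w)) (fun w y => A (snd w) y)).
    - apply Rc_comp; auto using Rc_fst, Rc_snd.
    - apply (Dl_comp2 A); auto using Rc_snd. apply Rc_comp; auto using Rc_fst, Rc_snd. }
  assert (K : forall c, exists v, c <= b -> forall i, i < c -> exists y, y < v /\ A i y).
  { apply (ind_Sg (fun c => exists v, c <= b -> forall i, i < c -> exists y, y < v /\ A i y)).
    - apply Sg_ex1. apply Dl_imp; [apply Dl_le; auto using Rc_fst, Rc_const|exact HD].
    - exists 0. intros _ i Hi. destruct (nlt0 _ Hi).
    - intros c [v Hv]. destruct (classic (c < b)) as [Hc|Hc].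
      + destruct (HE c Hc) as [y Hy]. exists (v + y + 1). intros _ i Hi.
        apply lt_S in Hi as [Hi| ->].
        * destruct (Hv ltac:(ml) i Hi) as (u & Hu & Au). exists u. split; auto. ml.
        * exists y. split; auto. ml.
      + exists 0. intro. exfalso. ml. }
  intros c Hc. destruct (K c) as [v Hv]. eauto.
Qed.

Lemma Sg_ball b (Q : M -> M -> Prop) : Rc b -> Sg (fun w => Q (fst w) (snd w)) ->
  Sg (fun z => forall i, i < b z -> Q z i).
Proof.
  intros Hb (A & HA & H).
  assert (H' : forall z i, Q z i <-> exists y, A (pr z i) y).
  { intros z i. specialize (H (pr z i)). rewrite fst_pr, snd_pr in H. exact H. }
  exists (fun z v => forall i, i < b z -> exists y, y < v /\ A (pr z i) y). split.
  - apply (Dl_ball (fun w => b (fst w)) (fun w i => exists y, y < snd w /\ A (pr (fst w) i) y)).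
    + apply Rc_comp; auto using Rc_fst.
    + apply (Dl_bex (fun w => snd (fst w)) (fun w y => A (pr (fst (fst w)) (snd w)) y)).
      * apply Rc_comp; auto using Rc_fst, Rc_snd.
      * assert (R1 : Rc (fun w => fst (fst w))) by (apply Rc_comp; apply Rc_fst).
        assert (R2 : Rc (fun w => snd (fst w))) by (apply Rc_comp; auto using Rc_fst, Rc_snd).
        apply (Dl_comp2 A); auto using Rc_snd. apply Rc_pair; [|exact R2].
        apply (Rc_comp fst (fun w => fst (fst w))); auto using Rc_fst.
  - intro z. split.
    + intro HQ. apply (collect (b z) (fun i y => A (pr z i) y)).
      * apply (Dl_comp2 A); auto using Rc_snd, Rc_pair, Rc_const, Rc_fst.
      * intros i Hi. apply H', HQ, Hi.
    + intros [v Hv] i Hi. destruct (Hv i Hi) as (y & _ & Hy). apply H'; eauto.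
Qed.
End Rec.

Ltac rc1 :=
  lazymatch goal with
  | |- Rc fst => apply Rc_fst
  | |- Rc snd => apply Rc_snd
  | |- Rc (fun z => z) => apply Rc_id
  | |- Rc (fun _ => ?c) => apply Rc_const
  | |- Rc (fun z => s_add _ (@?a z) (@?b z)) => apply (Rc_add a b)
  | |- Rc (fun z => s_mul _ (@?a z) (@?b z)) => apply (Rc_mul a b)
  | |- Rc (fun z => pr (@?a z) (@?b z)) => apply (Rc_pair a b)
  | |- Rc (fun z => msub (@?a z) (@?b z)) => apply (Rc_msub a b)
  | |- Rc (fun z => fst (@?a z)) => apply (Rc_comp fst a Rc_fst)
  | |- Rc (fun z => snd (@?a z)) => apply (Rc_comp snd a Rc_snd)
  | |- Rc (fun z => ifm (@?q z) (@?a z) (@?b z)) => apply (Rc_if q a b)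
  | |- Rc (fun z => mub (@?b z) (@?q z)) => apply (Rc_mub b q)
  | |- Dl (fun z => s_lt _ (@?a z) (@?b z)) => apply (Dl_lt a b)
  | |- Dl (fun z => le (@?a z) (@?b z)) => apply (Dl_le a b)
  | |- Dl (fun z => (@?a z) = (@?b z)) => apply (Dl_eq a b)
  | |- Dl (fun z => ~ (@?a z)) => apply (Dl_not a)
  | |- Dl (fun z => (@?a z) /\ (@?b z)) => apply (Dl_and a b)
  | |- Dl (fun z => (@?a z) \/ (@?b z)) => apply (Dl_or a b)
  | |- Dl (fun z => (@?a z) <-> (@?b z)) => apply (Dl_iff a b)
  | |- Dl (fun z => forall i, s_lt _ i (@?b z) -> @?q z i) => apply (Dl_ball b q)
  | |- Dl (fun z => forall i, le i (@?b z) -> @?q z i) => apply (Dl_ble b q)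
  | |- Dl (fun z => exists i, s_lt _ i (@?b z) /\ @?q z i) => apply (Dl_bex b q)
  | |- Dl (fun z => exists i, le i (@?b z) /\ @?q z i) => apply (Dl_bexle b q)
  | |- Dl (fun z => (@?a z) -> (@?b z)) => apply (Dl_imp a b)
  | |- Dl (fun _ => ?c) => apply (Dl_const c)
  end.

Section Comp3.
Context `{R : RM}.
Lemma Rc_comp3 (h : M -> M -> M -> M) f g k :
  Rc (fun w => h (fst w) (fst (snd w)) (snd (snd w))) -> Rc f -> Rc g -> Rc k ->
  Rc (fun x => h (f x) (g x) (k x)).
Proof.
  intros Hh Hf Hg Hk. eapply Rc_ext; [|apply (Rc_comp _ _ Hh (Rc_pair _ _ Hf (Rc_pair _ _ Hg Hk)))].
  intro x. simpl. now rewrite snd_pr, !fst_pr, snd_pr.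
Qed.
Lemma Dl_comp3 (h : M -> M -> M -> Prop) f g k :
  Dl (fun w => h (fst w) (fst (snd w)) (snd (snd w))) -> Rc f -> Rc g -> Rc k ->
  Dl (fun x => h (f x) (g x) (k x)).
Proof.
  intros Hh Hf Hg Hk. eapply Dl_ext; [|apply (Dl_comp _ _ Hh (Rc_pair _ _ Hf (Rc_pair _ _ Hg Hk)))].
  intro x. simpl. now rewrite snd_pr, !fst_pr, snd_pr.
Qed.
Lemma Sg_impD P Q : Dl P -> Sg Q -> Sg (fun z => P z -> Q z).
Proof.
  intros HP (A & HA & H). exists (fun z y => P z -> A z y). split.
  - apply Dl_imp; auto. apply (Dl_comp P fst); auto using Rc_fst.
  - intro z. rewrite H. split.
    + intro HH. destruct (classic (P z)) as [p|p]; [destruct (HH p) as [y Hy]; eauto|exists 0; tauto].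
    + intros [y Hy] p. eauto.
Qed.
End Comp3.

(** A hook of the search tactic [rc], rebound whenever new recursive operations become available. *)
Ltac rc_user := fail.
Ltac rc_hyp :=
  match goal with
  | H : Rc ?f |- Rc ?f => exact H
  | H : Dl ?f |- Dl ?f => exact H
  | H : Rc ?f |- Rc (fun z => ?f (@?g z)) => apply (Rc_comp f g H)
  | H : Dl ?f |- Dl (fun z => ?f (@?g z)) => apply (Dl_comp f g H)
  | H : Rc (fun w => ?f (fst w) (snd w)) |- Rc (fun z => ?f (@?a z) (@?b z)) => apply (Rc_comp2 f a b H)
  | H : Dl (fun w => ?f (fst w) (snd w)) |- Dl (fun z => ?f (@?a z) (@?b z)) => apply (Dl_comp2 f a b H)
  | H : Rc (fun w => ?f (fst w) (fst (snd w)) (snd (snd w))) |- Rc (fun z => ?f (@?a z) (@?b z) (@?c z)) =>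
      apply (Rc_comp3 f a b c H)
  | H : Dl (fun w => ?f (fst w) (fst (snd w)) (snd (snd w))) |- Dl (fun z => ?f (@?a z) (@?b z) (@?c z)) =>
      apply (Dl_comp3 f a b c H)
  end.
Ltac rc_eta :=
  lazymatch goal with
  | |- _ (fun _ => _) => fail
  | |- Rc ?f => change (Rc (fun z => f z))
  | |- Dl ?f => change (Dl (fun z => f z))
  end.
Ltac rc := repeat (cbv beta; first [rc_hyp | rc1 | rc_user | rc_eta]).
Ltac sg1 :=
  lazymatch goal with
  | |- Sg (fun z => exists y, @?q z y) => apply (Sg_ex q)
  | |- Sg (fun z => (@?a z) /\ (@?b z)) => apply (Sg_and a b)
  | |- Sg (fun z => forall i, s_lt _ i (@?b z) -> @?q z i) => apply (Sg_ball b q); [solve [rc]|]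
  | |- Sg (fun z => (@?a z) -> (@?b z)) => apply (Sg_impD a b); [solve [rc]|]
  end.
Ltac sg := repeat (cbv beta; first [apply Sg_Dl; solve [rc] | sg1]).

Ltac ind_dl := match goal with |- forall x, @?P x => apply (ind_Dl P); cbv beta end.
Ltac ind_sg := match goal with |- forall x, @?P x => apply (ind_Sg P); cbv beta end.
Ltac ind_pi := match goal with |- forall x, @?P x => apply (ind_Pi P); cbv beta end.

(** * Goedel's beta function *)

Section Beta.
Context `{R : RM}.
Add Ring Mring4 : M_srt.

Lemma divu d q r q' r' : r < d -> r' < d -> q * d + r = q' * d + r' -> q = q' /\ r = r'.
Proof.
  intros Hr Hr' E.
  assert (K : forall q r q' r', r < d -> r' < d -> q * d + r = q' * d + r' -> ~ q < q').
  { clear. intros q r q' r' Hr Hr' E Hl. apply lt_iff in Hl as [t ->].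
    replace ((q + t + 1) * d) with (q * d + t * d + d) in E by ring. ml. }
  pose proof (K _ _ _ _ Hr Hr' E). pose proof (K _ _ _ _ Hr' Hr (eq_sym E)).
  assert (q = q') by ml. subst q'. split; auto. ml.
Qed.

Definition rem (a d : M) : M := mub a (fun r => exists q, q <= a /\ a = q * d + r).
Lemma Rc_rem f g : Rc f -> Rc g -> Rc (fun x => rem (f x) (g x)).
Proof. intros. unfold rem. rc. Qed.
Lemma rem_spec a d : 0 < d -> exists q, q <= a /\ a = q * d + rem a d /\ rem a d < d.
Proof.
  intro Hd.
  assert (HD : Dl (fun r => exists q, q <= a /\ a = q * d + r)) by rc.
  destruct (mub_ex a (fun r => exists q, q <= a /\ a = q * d + r) a HD) as [(q & H1 & H2) H3].
  - exists 0. split; [ml|ring].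
  - ml.
  - fold (rem a d) in *. exists q. split; auto. split; auto.
    apply NNPP. intro Hn. apply nlt_le, le_iff in Hn as [r' Er].
    destruct (mub_spec a (fun r => exists q, q <= a /\ a = q * d + r) HD) as [_ Hm].
    fold (rem a d) in Hm. destruct (Hm r') as [Hm1 _].
    + ml.
    + apply Hm1. exists (q + 1). assert (Ea : a = (q + 1) * d + r') by (rewrite H2, Er; ring). split; auto.
      rewrite Ea. apply lt_le1 in Hd. rewrite add_0_l in Hd. apply le_iff in Hd as [d' ->].
      replace ((q + 1) * (1 + d')) with (q + 1 + (q + 1) * d') by ring. ml.
Qed.
Lemma rem_unique a d q r : a = q * d + r -> r < d -> rem a d = r.
Proof.
  intros E Hr. destruct (rem_spec a d) as (q' & _ & E' & Hr'); [ml|].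
  rewrite E in E' at 1. destruct (divu d q r q' (rem a d)) as [_ ?]; auto.
Qed.

Definition ap (c i : M) : M := rem (fst c) (1 + (i + 1) * snd c).
Lemma Rc_ap f g : Rc f -> Rc g -> Rc (fun x => ap (f x) (g x)).
Proof. intros. unfold ap. apply Rc_rem; rc. Qed.

Lemma common_multiple n : exists b, 0 < b /\ forall j, j <= n -> 0 < j -> exists q, q <= b /\ b = j * q.
Proof.
  revert n. ind_sg.
  - sg.
  - exists 1. split; [ml|]. intros j Hj Hj'. exfalso; ml.
  - intros n (b & Hb & HB). exists (b * (n + 1)). 
    assert (L : b <= b * (n + 1)) by (apply le_iff; exists (b * n); ring).
    split; [ml|]. intros j Hj Hj'. apply lt_S in Hj as [Hj| ->].
    + destruct (HB j Hj Hj') as (q & Hq & E). exists (q * (n + 1)). split.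
      * apply mul_le, Hq.
      * rewrite E. ring.
    + exists b. split; auto. ring.
Qed.

Lemma beta_inv n b : 0 < b -> (forall j, j <= n -> 0 < j -> exists q, q <= b /\ b = j * q) ->
  forall j l, j < l -> l < n -> exists u q, u * (1 + (j + 1) * b) = q * (1 + (l + 1) * b) + 1.
Proof.
  intros Hb HB j l Hj Hl. apply lt_iff in Hj as [d0 E]. set (d := d0 + 1).
  destruct (HB d) as (c & _ & Ec); [unfold d; ml|unfold d; ml|].
  destruct (zero_or_S b) as [->|[b0 Eb]]; [exfalso; ml|].
  assert (El : l = j + d) by (unfold d; rewrite E; ring).
  (* Modulo the larger modulus 1 + (l + 1) b, [v] is congruent to -(l + 1) and so is an inverse of
     [b]. Moreover c (l + 1) times the smaller modulus is congruent to c (l - j) = c d = b. *)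
  set (v := 1 + (l + 1) * b0).
  exists (c * (l + 1) * v), (b0 + v * c * (j + 1)).
  transitivity (v * (d * c) + v * c * (j + 1) * (1 + (l + 1) * b)).
  - rewrite El. ring.
  - rewrite <- Ec. unfold v. rewrite Eb. ring.
Qed.

Lemma beta_lemma f n : Rc f -> exists c, forall i, i < n -> ap c i = f i.
Proof.
  intro Hf.
  destruct (collect n (fun i y => y = f i)) as [B HB]; [rc|eauto|].
  destruct (common_multiple n) as (b0 & Hb0 & Hd0).
  (* The factor [B + 1] makes every modulus larger than the values of [f]; the factor [b0] makes the
     moduli coprime. *)
  set (b := b0 * (B + 1)).
  assert (LB : B + 1 <= b).
  { apply lt_le1 in Hb0. rewrite add_0_l in Hb0. apply (mul_le _ _ (B + 1)) in Hb0.
    rewrite mul_1_l in Hb0. exact Hb0. }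
  assert (Hd : forall j, j <= n -> 0 < j -> exists q, q <= b /\ b = j * q).
  { intros j Hj Hj'. destruct (Hd0 j Hj Hj') as (q & Hq & E). exists (q * (B + 1)).
    split; [apply mul_le, Hq|]. unfold b. rewrite E. ring. }
  assert (Hinv := beta_inv n b ltac:(ml) Hd).
  set (m := fun i => 1 + (i + 1) * b) in *.
  assert (Hm : Rc m) by (unfold m; rc).
  (* Chinese remaindering one modulus at a time: [P] is divisible by the moduli already treated and
     invertible modulo the remaining ones, and [a] has the prescribed remainders so far. *)
  assert (K : forall j, j <= n -> exists a P, (forall i, i < j -> exists q, P = q * m i) /\
     (forall l, l < n -> j <= l -> exists u q, u * P = q * m l + 1) /\
     (forall i, i < j -> exists q, a = q * m i + f i)).
  { ind_sg.
    - sg.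
    - intros _. exists 0, 1. split; [|split].
      + intros i Hi. exfalso; ml.
      + intros l _ _. exists 1, 0. ring.
      + intros i Hi. exfalso; ml.
    - intros j IH Hj. destruct IH as (a & P & H1 & H2 & H3); [ml|].
      destruct (H2 j) as (u & q & E); [ml|ml|]. set (w := (j + 1) * b).
      assert (Em : m j = 1 + w) by reflexivity.
      (* The correction to [a] must be f j - a modulo [m j]. As [m j] is [1 + w], the factor [w]
         acts as -1, and [a * w] replaces the missing -a; [u] inverts [P]. *)
      exists (a + P * (u * (f j + a * w))), (P * m j). split; [|split].
      + intros i Hi. apply lt_S in Hi as [Hi| ->].
        * destruct (H1 i Hi) as [q' ->]. exists (q' * m j). ring.
        * exists P. reflexivity.
      + intros l Hl Hjl. destruct (H2 l Hl) as (u1 & q1 & E1); [ml|].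
        destruct (Hinv j l) as (u2 & q2 & E2); [ml|ml|]. fold (m j) in E2. fold (m l) in E2.
        exists (u1 * u2), (q1 * q2 * m l + q1 + q2).
        transitivity ((u1 * P) * (u2 * m j)); [ring|]. rewrite E1, E2. ring.
      + intros i Hi. apply lt_S in Hi as [Hi| ->].
        * destruct (H1 i Hi) as [q' E']. destruct (H3 i Hi) as [q3 E3].
          exists (q3 + q' * (u * (f j + a * w))). rewrite E' at 1. rewrite E3 at 1. ring.
        * exists (a + q * (f j + a * w)).
          transitivity (a + (u * P) * (f j + a * w)); [ring|]. rewrite E, Em. ring. }
  destruct (K n) as (a & P & _ & _ & H3); [ml|].
  exists (pr a b). intros i Hi. unfold ap. rewrite fst_pr, snd_pr.
  destruct (H3 i Hi) as [q E]. apply (rem_unique a _ q); [exact E|].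
  destruct (HB i Hi) as (y & Hy & ->). replace ((i + 1) * b) with (i * b + b) by ring. ml.
Qed.

Definition tab (n : M) (f : M -> M) : M := mu (fun c => forall i, i < n -> ap c i = f i).
End Beta.

Ltac rc_user ::=
  lazymatch goal with
  | |- Rc (fun z => rem (@?a z) (@?b z)) => apply (Rc_rem a b)
  | |- Rc (fun z => ap (@?a z) (@?b z)) => apply (Rc_ap a b)
  end.

(** * Recursion and codes of finite sets *)

Section Iter.
Context `{R : RM}.
Add Ring Mring5 : M_srt.

Lemma tab_spec n f : Rc f -> forall i, i < n -> ap (tab n f) i = f i.
Proof.
  intro Hf. unfold tab. apply (mu_spec (fun c => forall i, i < n -> ap c i = f i)); [rc|apply beta_lemma, Hf].
Qed.
Lemma Rc_tab n f : Rc n -> Rc (fun w => f (fst w) (snd w)) -> Rc (fun z => tab (n z) (f z)).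
Proof.
  intros Hn Hf. apply (Rc_mu (fun z c => forall i, i < n z -> ap c i = f z i)); [rc|].
  intro z. apply beta_lemma. apply (Rc_slice f z Hf).
Qed.

Definition rvalid (g : M -> M -> M) (a n c : M) : Prop :=
  ap c 0 = a /\ forall i, i < n -> ap c (i + 1) = g i (ap c i).
Definition rec (g : M -> M -> M) (n a : M) : M := ap (mu (rvalid g a n)) n.

Lemma Dl_rvalid g a n : Rc (fun w => g (fst w) (snd w)) -> Dl (rvalid g a n).
Proof. intro Hg. unfold rvalid. rc. Qed.

Lemma rvalid_ex g a : Rc (fun w => g (fst w) (snd w)) -> forall n, exists c, rvalid g a n c.
Proof.
  intro Hg. ind_sg.
  - unfold rvalid. sg.
  - destruct (beta_lemma (fun _ => a) 1) as [c Hc]; [rc|]. exists c. split; [apply Hc; ml|].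
    intros i Hi. destruct (nlt0 _ Hi).
  - intros n [c [H0 HS]].
    destruct (beta_lemma (fun i => ifm (i <= n) (ap c i) (g n (ap c n))) (n + 1 + 1)) as [d Hd]; [rc|].
    exists d. split.
    + rewrite Hd, ifm_t; auto; ml.
    + intros i Hi. rewrite !Hd by ml. rewrite (ifm_t (i <= n)) by ml.
      apply lt_S in Hi as [Hi| ->].
      * rewrite ifm_t by ml. apply HS, Hi.
      * rewrite ifm_f by ml. reflexivity.
Qed.

Lemma rvalid_agree g a n c m d : Rc (fun w => g (fst w) (snd w)) ->
  rvalid g a n c -> rvalid g a m d -> forall i, i <= n -> i <= m -> ap c i = ap d i.
Proof.
  intros Hg [H0 HS] [H0' HS']. apply (ind_Dl (fun i => i <= n -> i <= m -> ap c i = ap d i)).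
  - rc.
  - congruence.
  - intros i IH Hn Hm. rewrite HS, HS', IH by ml. reflexivity.
Qed.

Lemma rec_0 g a : Rc (fun w => g (fst w) (snd w)) -> rec g 0 a = a.
Proof.
  intro Hg. unfold rec.
  destruct (mu_spec _ (Dl_rvalid g a 0 Hg) (rvalid_ex g a Hg 0)) as [[H _] _]. exact H.
Qed.
Lemma rec_S g a n : Rc (fun w => g (fst w) (snd w)) -> rec g (n + 1) a = g n (rec g n a).
Proof.
  intro Hg. unfold rec.
  destruct (mu_spec _ (Dl_rvalid g a n Hg) (rvalid_ex g a Hg n)) as [H _].
  destruct (mu_spec _ (Dl_rvalid g a (n + 1) Hg) (rvalid_ex g a Hg (n + 1))) as [H' _].
  rewrite (rvalid_agree g a _ _ _ _ Hg H H') by ml.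
  apply H'. ml.
Qed.
Lemma Rc_rec (g : M -> M -> M -> M) n a :
  Rc (fun w => g (fst w) (fst (snd w)) (snd (snd w))) -> Rc n -> Rc a ->
  Rc (fun z => rec (g z) (n z) (a z)).
Proof.
  intros Hg Hn Ha. unfold rec. apply Rc_ap; auto.
  apply (Rc_mu (fun z => rvalid (g z) (a z) (n z))).
  - unfold rvalid. rc.
  - intro z. apply rvalid_ex. rc.
Qed.

Definition msum (n : M) (f : M -> M) : M := rec (fun i v => v + f i) n 0.
Lemma Rc_msum n f : Rc n -> Rc (fun w => f (fst w) (snd w)) -> Rc (fun z => msum (n z) (f z)).
Proof. intros Hn Hf. apply (Rc_rec (fun z i v => v + f z i) n (fun _ => 0)); rc. Qed.
Lemma msum_0 f : Rc f -> msum 0 f = 0.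
Proof. intro Hf. apply rec_0. rc. Qed.
Lemma msum_S n f : Rc f -> msum (n + 1) f = msum n f + f n.
Proof. intro Hf. apply (rec_S (fun i v => v + f i)). rc. Qed.

Definition pow2 (n : M) : M := rec (fun _ v => v + v) n 1.
Lemma Rc_pow2 f : Rc f -> Rc (fun z => pow2 (f z)).
Proof. intro Hf. apply (Rc_rec (fun _ _ v => v + v) f (fun _ => 1)); rc. Qed.
Lemma pow2_0 : pow2 0 = 1.
Proof. apply rec_0. rc. Qed.
Lemma pow2_S n : pow2 (n + 1) = pow2 n + pow2 n.
Proof. apply (rec_S (fun _ v => v + v)). rc. Qed.
Lemma pow2_gt n : n < pow2 n.
Proof.
  revert n. ind_dl.
  - assert (H : Rc pow2) by (apply (Rc_pow2 (fun z => z)); rc). rc.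
  - rewrite pow2_0. ml.
  - intros n IH. rewrite pow2_S. ml.
Qed.
Lemma pow2_add a b : pow2 (a + b) = pow2 a * pow2 b.
Proof.
  revert b. ind_dl.
  - assert (H : Rc pow2) by (apply (Rc_pow2 (fun z => z)); rc). rc.
  - rewrite pow2_0, add_0_r. ring.
  - intros b IH. replace (a + (b + 1)) with (a + b + 1) by ring. rewrite !pow2_S, IH. ring.
Qed.
Lemma pow2_pos n : 1 <= pow2 n.
Proof. pose proof (pow2_gt n). ml. Qed.
Lemma pow2_mono a b : a <= b -> pow2 a <= pow2 b.
Proof.
  intro H. apply le_iff in H as [d ->]. rewrite pow2_add. pose proof (pow2_pos d) as L.
  apply (mul_le _ _ (pow2 a)) in L. rewrite mul_1_l in L. rewrite mul_comm. exact L.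
Qed.

(* Numbers code finite sets through their binary digits. *)
Definition mem (i c : M) : Prop :=
  exists q, q <= c /\ exists r, r < pow2 i /\ c = (q + q + 1) * pow2 i + r.
Lemma Dl_mem f g : Rc f -> Rc g -> Dl (fun z => mem (f z) (g z)).
Proof.
  intros Hf Hg. unfold mem.
  assert (H : Rc pow2) by (apply (Rc_pow2 (fun z => z)); rc). rc.
Qed.
Lemma mem_iff i c : mem i c <-> exists q r, r < pow2 i /\ c = (q + q + 1) * pow2 i + r.
Proof.
  split.
  - intros (q & _ & r & H). eauto.
  - intros (q & r & Hr & E). exists q. split; [|eauto].
    pose proof (pow2_pos i) as L. apply le_iff in L as [p Ep]. rewrite E, Ep.
    replace ((q + q + 1) * (1 + p)) with (q + q + 1 + (q + q + 1) * p) by ring. ml.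
Qed.
Lemma mem_pow2 i c : mem i c -> pow2 i <= c.
Proof.
  rewrite mem_iff. intros (q & r & _ & ->).
  replace ((q + q + 1) * pow2 i) with ((q + q) * pow2 i + pow2 i) by ring. ml.
Qed.
Lemma mem_lt i c : mem i c -> i < c.
Proof. intro H. apply mem_pow2 in H. pose proof (pow2_gt i). ml. Qed.
Lemma mem_bound i b c : c < pow2 b -> mem i c -> i < b.
Proof.
  intros Hc H. apply mem_pow2 in H. apply NNPP. intro Hn. apply nlt_le, pow2_mono in Hn. ml.
Qed.
Lemma mem_add i b c : c < pow2 b -> (mem i (c + pow2 b) <-> mem i c \/ i = b).
Proof.
  intro Hc. destruct (lt_total i b) as [Hi|[->|Hi]].
  - assert (i <> b) by (intros ->; exact (lt_irrefl _ Hi)).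
    apply lt_iff in Hi as [d ->].
    assert (E : pow2 (i + d + 1) = (pow2 d + pow2 d) * pow2 i) by (rewrite pow2_S, pow2_add; ring).
    rewrite !mem_iff. split.
    + intros (q & r & Hr & Eq). left.
      destruct (rem_spec c (pow2 i)) as (q' & _ & E1 & Hr'); [pose proof (pow2_pos i); ml|].
      rewrite E, E1 in Eq.
      destruct (divu (pow2 i) (q' + (pow2 d + pow2 d)) (rem c (pow2 i)) (q + q + 1) r) as [Eq1 _]; auto.
      { rewrite <- Eq. ring. }
      destruct (classic (pow2 d <= q)) as [L|L].
      * apply le_iff in L as [k ->]. exists k, (rem c (pow2 i)). split; auto. rewrite E1 at 1.
        assert (q' = k + k + 1) by ml. congruence.
      * exfalso. ml.
    + intros [(q & r & Hr & ->)|]; [|contradiction].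
      exists (q + pow2 d), r. split; auto. rewrite E. ring.
  - split; [auto|]. intros _. apply mem_iff. exists 0, c. split; auto. ring.
  - split.
    + intro H. exfalso. apply mem_pow2 in H. apply lt_le1, pow2_mono in Hi. rewrite pow2_S in Hi. ml.
    + intros [H| ->]; [|destruct (lt_irrefl _ Hi)]. exfalso. apply (mem_bound _ b) in H; auto. ml.
Qed.

Definition setc (b : M) (Q : M -> Prop) : M :=
  mu (fun c => c < pow2 b /\ forall i, i < b -> (mem i c <-> Q i)).
Lemma setc_ex Q : Dl Q -> forall b, exists c, c < pow2 b /\ forall i, i < b -> (mem i c <-> Q i).
Proof.
  intro HQ. ind_sg.
  - apply Sg_ex1. assert (H : Rc pow2) by (apply (Rc_pow2 (fun z => z)); rc).
    assert (H' : Dl (fun w => mem (fst w) (snd w))) by (apply Dl_mem; rc). rc.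
  - exists 0. rewrite pow2_0. split; [ml|]. intros i Hi. destruct (nlt0 _ Hi).
  - intros b (c & Hc & H). rewrite pow2_S. destruct (classic (Q b)) as [Hb|Hb].
    + exists (c + pow2 b). split; [ml|]. intros i Hi. rewrite (mem_add i b c Hc).
      apply lt_S in Hi as [Hi| ->]; [|tauto]. rewrite H by auto. split; [intros [|E]; auto|tauto].
      subst; destruct (lt_irrefl _ Hi).
    + exists c. split; [ml|]. intros i Hi. apply lt_S in Hi as [Hi| ->]; auto.
      split; [|tauto]. intro Hm. apply (mem_bound _ b) in Hm; auto. destruct (lt_irrefl _ Hm).
Qed.
Lemma setc_spec b Q : Dl Q -> setc b Q < pow2 b /\ forall i, mem i (setc b Q) <-> i < b /\ Q i.
Proof.
  intro HQ. destruct (mu_spec (fun c => c < pow2 b /\ forall i, i < b -> (mem i c <-> Q i))) as [[H1 H2] _].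
  - assert (H' : Dl (fun w => mem (fst w) (snd w))) by (apply Dl_mem; rc). rc.
  - apply setc_ex, HQ.
  - fold (setc b Q) in *. split; auto. intro i. split.
    + intro Hi. assert (i < b) by (eapply mem_bound; eauto). split; auto. apply H2; auto.
    + intros [Hi HQi]. apply H2; auto.
Qed.
Lemma setc_lt b Q : Dl Q -> setc b Q < pow2 b.
Proof. intro HQ. apply setc_spec, HQ. Qed.
Lemma mem_setc b Q i : Dl Q -> (mem i (setc b Q) <-> i < b /\ Q i).
Proof. intro HQ. apply setc_spec, HQ. Qed.
Lemma Rc_setc b (Q : M -> M -> Prop) : Rc b -> Dl (fun w => Q (fst w) (snd w)) ->
  Rc (fun z => setc (b z) (Q z)).
Proof.
  intros Hb HQ.
  apply (Rc_mu (fun z c => c < pow2 (b z) /\ forall i, i < b z -> (mem i c <-> Q z i))).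
  - assert (H : Rc pow2) by (apply (Rc_pow2 (fun z => z)); rc).
    assert (H' : Dl (fun w => mem (fst w) (snd w))) by (apply Dl_mem; rc). rc.
  - intro z. apply setc_ex. rc.
Qed.
End Iter.

Ltac rc_arith :=
  lazymatch goal with
  | |- Rc (fun z => rem (@?a z) (@?b z)) => apply (Rc_rem a b)
  | |- Rc (fun z => ap (@?a z) (@?b z)) => apply (Rc_ap a b)
  | |- Rc (fun z => pow2 (@?a z)) => apply (Rc_pow2 a)
  | |- Rc (fun z => msum (@?a z) (@?b z)) => apply (Rc_msum a b)
  | |- Rc (fun z => tab (@?a z) (@?b z)) => apply (Rc_tab a b)
  | |- Rc (fun z => setc (@?a z) (@?b z)) => apply (Rc_setc a b)
  | |- Rc (fun z => rec (@?g z) (@?a z) (@?b z)) => apply (Rc_rec g a b)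
  | |- Dl (fun z => mem (@?a z) (@?b z)) => apply (Dl_mem a b)
  end.
Ltac rc_user ::= rc_arith.

(** * Ordinals below omega^omega and large sets *)

(* An ordinal below omega^k is given by its coefficients: [s p] is that of omega^p. *)
Definition lto `{RM} (k : M) (s t : M -> M) : Prop :=
  exists p, p < k /\ (s p < t p /\ forall q, q < k -> p < q -> s q = t q).
Definition nz `{RM} (k : M) (s : M -> M) : Prop := exists p, p < k /\ 0 < s p.

Section Ord.
Context `{R : RM}.
Add Ring Mring6 : M_srt.

Lemma Dl_lto k (s t : M -> M -> M) : Rc k -> Rc (fun w => s (fst w) (snd w)) ->
  Rc (fun w => t (fst w) (snd w)) -> Dl (fun z => lto (k z) (s z) (t z)).
Proof. intros. unfold lto. rc. Qed.
Lemma Dl_nz k (s : M -> M -> M) : Rc k -> Rc (fun w => s (fst w) (snd w)) ->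
  Dl (fun z => nz (k z) (s z)).
Proof. intros. unfold nz. rc. Qed.

Lemma lto_irrefl k s : ~ lto k s s.
Proof. intros (p & _ & H & _). exact (lt_irrefl _ H). Qed.
Lemma lto_trans k s t u : lto k s t -> lto k t u -> lto k s u.
Proof.
  intros (p & Hp & H1 & H2) (q & Hq & H3 & H4).
  destruct (lt_total p q) as [L|[->|L]].
  - exists q. split; auto. rewrite (H2 q) by auto. split; auto.
    intros r Hr Hqr. rewrite H2 by (auto; ml). auto.
  - exists q. split; auto. split; [ml|]. intros r Hr Hqr. rewrite H2; auto.
  - exists p. split; auto. rewrite <- (H4 p) by auto. split; auto.
    intros r Hr Hqr. rewrite H2 by auto. apply H4; auto. ml.
Qed.
Lemma lto_ext k s t s' t' : (forall p, p < k -> s p = s' p) -> (forall p, p < k -> t p = t' p) ->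
  lto k s t -> lto k s' t'.
Proof.
  intros E E' (p & Hp & H1 & H2). exists p. split; auto. rewrite <- E, <- E' by auto. split; auto.
  intros q Hq Hpq. rewrite <- E, <- E' by auto. auto.
Qed.
Lemma lto_total k s t : Rc s -> Rc t -> lto k s t \/ (forall q, q < k -> s q = t q) \/ lto k t s.
Proof.
  intros Hs Ht. destruct (classic (exists q, q < k /\ s q <> t q)) as [HE|HN].
  - apply (greatest (fun q => s q <> t q)) in HE as (p & Hp & Hd & Hm); [|rc].
    assert (HE : forall q, q < k -> p < q -> s q = t q).
    { intros q Hq Hpq. apply NNPP. apply Hm; auto. }
    destruct (lt_total (s p) (t p)) as [L|[L|L]]; [left|contradiction|right; right]; exists p; repeat split; auto.
    intros; symmetry; auto.
  - right; left. intros q Hq. apply NNPP. intro Hn. apply HN. eauto.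
Qed.
(** Non-strict comparison is expressed as the negation of the reverse strict one; [lto_total]
    justifies this for recursive coefficient functions. *)
Lemma leo_lt k s t u : Rc s -> Rc t -> ~ lto k t s -> lto k u s -> lto k u t.
Proof.
  intros Hs Ht Hn Hl. destruct (lto_total k s t Hs Ht) as [H|[H|H]]; [eapply lto_trans; eauto| |contradiction].
  eapply lto_ext; [| |exact Hl]; auto.
Qed.
Lemma lto_nz k s t : lto k s t -> nz k t.
Proof. intros (p & Hp & H & _). exists p. split; auto. ml. Qed.
Lemma leo_nz k s t : Rc s -> Rc t -> ~ lto k t s -> nz k s -> nz k t.
Proof.
  intros Hs Ht Hn Hz. destruct (lto_total k s t Hs Ht) as [H|[H|H]]; [eapply lto_nz; eauto| |contradiction].
  destruct Hz as (p & Hp & Hz). exists p. split; auto. rewrite <- H; auto.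
Qed.

(* The largest ordinal below [t] whose lowered coefficients do not exceed [x]: the step of
   the fundamental sequences that define large sets. *)
Definition stp (k x t : M) : M :=
  ifm (nz k (ap t))
    (tab k (fun q => ifm (q < mub k (fun p => 0 < ap t p)) x
      (ifm (q = mub k (fun p => 0 < ap t p)) (msub (ap t q) 1) (ap t q)))) t.
Lemma Rc_stp k x t : Rc k -> Rc x -> Rc t -> Rc (fun z => stp (k z) (x z) (t z)).
Proof. intros. unfold stp, nz. rc. Qed.

Lemma stp_zero k x t : ~ nz k (ap t) -> stp k x t = t.
Proof. intro H. unfold stp. apply ifm_f, H. Qed.
Lemma stp_spec k x t : nz k (ap t) -> exists p, p < k /\ 0 < ap t p /\
  (forall q, q < p -> ap t q = 0 /\ ap (stp k x t) q = x) /\ ap (stp k x t) p + 1 = ap t p /\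
  (forall q, q < k -> p < q -> ap (stp k x t) q = ap t q).
Proof.
  intro H. pose proof H as (p & Hp & Hz). unfold stp. rewrite ifm_t by auto.
  set (m := mub k (fun p => 0 < ap t p)).
  assert (HD : Dl (fun p => 0 < ap t p)) by rc.
  destruct (mub_ex k _ p HD Hz) as [H1 H2]; [ml|]. fold m in H1, H2.
  assert (HT : forall i, i < k -> ap (tab k (fun q => ifm (q < m) x (ifm (q = m) (msub (ap t q) 1) (ap t q)))) i
    = ifm (i < m) x (ifm (i = m) (msub (ap t i) 1) (ap t i))).
  { apply (tab_spec k (fun q => ifm (q < m) x (ifm (q = m) (msub (ap t q) 1) (ap t q)))). rc. }
  exists m. split; [ml|]. split; auto. split; [|split].
  - intros q Hq. destruct (mub_spec k _ HD) as [_ Hm]. fold m in Hm.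
    destruct (Hm q Hq) as [Hm' _]. split; [ml|]. rewrite HT by ml. apply ifm_t, Hq.
  - rewrite HT by ml. rewrite ifm_f by ml. rewrite ifm_t by auto.
    destruct (msub_spec (ap t m) 1) as [_ E]. rewrite E at 2 by ml. ring.
  - intros q Hq Hmq. rewrite HT by ml. rewrite ifm_f by ml. rewrite ifm_f; auto. intro; subst; ml.
Qed.
Lemma stp_lt k x t : nz k (ap t) -> lto k (ap (stp k x t)) (ap t).
Proof.
  intro H. destruct (stp_spec k x t H) as (p & Hp & Hz & H1 & H2 & H3).
  exists p. split; auto. split; [ml|]. exact H3.
Qed.
Lemma stp_max k x t s : lto k s (ap t) -> (forall q, q < k -> s q <= x) -> ~ lto k (ap (stp k x t)) s.
Proof.
  intros Hl Hx (p' & Hp' & H1' & H2').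
  destruct (stp_spec k x t (lto_nz _ _ _ Hl)) as (p & Hp & Hz & H1 & H2 & H3).
  destruct Hl as (r & Hr & H4 & H5).
  destruct (lt_total p' p) as [L|[->|L]].
  - destruct (H1 p' L) as [_ E]. rewrite E in H1'. pose proof (Hx p' Hp'). ml.
  - destruct (lt_total r p) as [L|[->|L]].
    + destruct (H1 r L). ml.
    + ml.
    + rewrite <- H3, H2' in H4 by auto. exact (lt_irrefl _ H4).
  - rewrite H3 in H1' by auto. destruct (lt_total r p') as [L'|[->|L']].
    + rewrite H5 in H1' by auto. exact (lt_irrefl _ H1').
    + ml.
    + rewrite <- H2', H3 in H4 by (auto; ml). exact (lt_irrefl _ H4).
Qed.

Definition ini (k : M) : M := tab (k + 1) (fun p => ifm (p = k) 1 0).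
(** Largeness in the sense of Ketonen and Solovay: starting from omega^k, the ordinal is lowered
    once at each element of the set, and the set is large when zero is reached. Having this as a
    recursion makes largeness decidable in the model. *)
Definition run (k u F i : M) : M :=
  rec (fun j t => ifm (mem j F /\ u <= j) (stp (k + 1) j t) t) i (ini k).
Lemma Rc_stp2 : Rc (fun w => stp (fst w) (fst (snd w)) (snd (snd w))).
Proof. apply Rc_stp; rc. Qed.
Lemma Rc_run k u F i : Rc k -> Rc u -> Rc F -> Rc i -> Rc (fun z => run (k z) (u z) (F z) (i z)).
Proof.
  intros. unfold run, ini. pose proof Rc_stp2. rc.
Qed.
Lemma run_rcg k u F : Rc (fun w => ifm (mem (fst w) F /\ u <= fst w) (stp (k + 1) (fst w) (snd w)) (snd w)).
Proof. pose proof Rc_stp2. rc. Qed.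
Lemma run_0 k u F p : p < k + 1 -> ap (run k u F 0) p = ifm (p = k) 1 0.
Proof.
  intro Hp. unfold run. rewrite rec_0 by apply run_rcg.
  apply (tab_spec (k + 1) (fun p => ifm (p = k) 1 0)); auto. rc.
Qed.
Lemma run_skip k u F i : ~ (mem i F /\ u <= i) -> run k u F (i + 1) = run k u F i.
Proof.
  intro H. unfold run. rewrite (rec_S _ _ _ (run_rcg k u F)). cbv beta. apply ifm_f, H.
Qed.
Lemma run_step k u F i : mem i F -> u <= i -> run k u F (i + 1) = stp (k + 1) i (run k u F i).
Proof.
  intros H H'. unfold run. rewrite (rec_S _ _ _ (run_rcg k u F)). cbv beta. apply ifm_t; auto.
Qed.

(* The part of [F] in [u, v) is omega^k-large. *)
Definition LL (k F u v : M) : Prop := ~ nz (k + 1) (ap (run k u F v)).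
Lemma Dl_LL k F u v : Rc k -> Rc F -> Rc u -> Rc v -> Dl (fun z => LL (k z) (F z) (u z) (v z)).
Proof.
  intros. unfold LL.
  assert (Hr : Rc (fun z => run (k z) (u z) (F z) (v z))) by (apply Rc_run; rc).
  apply Dl_not, (Dl_nz (fun z => k z + 1) (fun z => ap (run (k z) (u z) (F z) (v z)))); [rc|].
  apply Rc_ap; [|rc]. apply (Rc_comp _ fst Hr); rc.
Qed.

Lemma Rc_run1 k u F : Rc (run k u F).
Proof. apply (Rc_run (fun _ => k) (fun _ => u) (fun _ => F) (fun z => z)); rc. Qed.

Lemma run_ext k u F F' v : (forall x, u <= x -> x < v -> (mem x F <-> mem x F')) ->
  forall i, i <= v -> run k u F i = run k u F' i.
Proof.
  intro HE. pose proof (Rc_run1 k u F). pose proof (Rc_run1 k u F'). ind_dl.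
  - rc.
  - intros _. unfold run. now rewrite !rec_0 by apply run_rcg.
  - intros i IH Hi. specialize (IH ltac:(ml)).
    destruct (classic (mem i F /\ u <= i)) as [[H1 H2]|H1].
    + assert (mem i F') by (apply HE; auto; ml). now rewrite !run_step, IH.
    + rewrite !run_skip; auto. intros [H3 H4]. apply H1. split; auto. apply HE; auto; ml.
Qed.
Lemma LL_ext k u F F' v : (forall x, u <= x -> x < v -> (mem x F <-> mem x F')) -> LL k F u v -> LL k F' u v.
Proof.
  intros HE. unfold LL. rewrite (run_ext k u F F' v HE v); auto. ml.
Qed.

Lemma run_nz k u F v : nz (k + 1) (ap (run k u F v)) -> forall i, i <= v -> nz (k + 1) (ap (run k u F i)).
Proof.
  intros Hv i Hi. apply NNPP. intro Hn.
  assert (K : forall j, run k u F (i + j) = run k u F i).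
  { pose proof (Rc_run1 k u F). ind_dl.
    - rc.
    - now rewrite add_0_r.
    - intros j IH. replace (i + (j + 1)) with (i + j + 1) by ring.
      destruct (classic (mem (i + j) F /\ u <= i + j)) as [[H1 H2]|H1].
      + rewrite run_step, IH by auto. apply stp_zero, Hn.
      + rewrite run_skip; auto. }
  apply le_iff in Hi as [d ->]. rewrite K in Hv. contradiction.
Qed.

Lemma run_le k u F i j : nz (k + 1) (ap (run k u F i)) -> ~ lto (k + 1) (ap (run k u F i)) (ap (run k u F (i + j))).
Proof.
  intro Hnz. pose proof (Rc_run1 k u F). revert j. ind_dl.
  - apply Dl_not, (Dl_lto (fun _ => k + 1) (fun _ => ap (run k u F i)) (fun j => ap (run k u F (i + j)))); rc.
  - rewrite add_0_r. apply lto_irrefl.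
  - intros j IH. replace (i + (j + 1)) with (i + j + 1) by ring.
    destruct (classic (mem (i + j) F /\ u <= i + j)) as [[H1 H2]|H1].
    + rewrite run_step by auto. intro L. apply IH.
      destruct (classic (nz (k + 1) (ap (run k u F (i + j))))) as [Hz|Hz].
      * eapply lto_trans; [exact L|]. apply stp_lt; auto.
      * rewrite stp_zero in L; auto.
    + rewrite run_skip; auto.
Qed.

(** A descent keeps the run away from zero. Each step of the run takes the largest ordinal that the
    coefficient bound allows ([stp_max]), hence cannot fall below [d x], which is nonzero and above
    all later values of [d]. *)
Lemma large_no_descent k F u v (d : M -> M -> M) : Rc (fun w => d (fst w) (snd w)) -> LL k F u v ->
  (forall x, mem x F -> u <= x -> x < v -> nz k (d x) /\ forall p, p < k -> d x p <= x) ->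
  (forall x y, mem x F -> u <= x -> mem y F -> y < v -> x < y -> lto k (d y) (d x)) -> False.
Proof.
  intros Hd HL H1 H2. pose proof (Rc_run1 k u F).
  (* A coefficient 0 at omega^k places the descent below the starting value of the run. *)
  set (d' := fun x p => ifm (p < k) (d x p) 0).
  assert (Hd' : Rc (fun w => d' (fst w) (snd w))) by (unfold d'; rc).
  assert (Ed : forall x p, p < k -> d' x p = d x p) by (intros; apply ifm_t; auto).
  assert (E0 : forall x, d' x k = 0) by (intros; apply ifm_f; ml).
  assert (L' : forall x y, lto k (d x) (d y) -> lto (k + 1) (d' x) (d' y)).
  { intros x y (p & Hp & A & B). exists p. rewrite !Ed by auto. split; [ml|]. split; auto.
    intros q Hq Hpq. apply lt_S in Hq as [Hq| ->]; [rewrite !Ed by auto; auto|now rewrite !E0]. }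
  assert (K : forall i, i <= v -> nz (k + 1) (ap (run k u F i)) /\
     forall y, y < v -> (mem y F /\ u <= y /\ i <= y) -> lto (k + 1) (d' y) (ap (run k u F i))).
  { ind_dl.
    - apply Dl_imp; [rc|]. apply Dl_and; [apply (Dl_nz (fun _ => k + 1) (fun i => ap (run k u F i))); rc|].
      apply Dl_ball; [rc|]. apply Dl_imp; [rc|].
      apply (Dl_lto (fun _ => k + 1) (fun w => d' (snd w)) (fun w => ap (run k u F (fst w)))); rc.
    - intros _. split.
      + exists k. split; [ml|]. rewrite run_0 by ml. rewrite ifm_t by auto. ml.
      + intros y Hy _. exists k. rewrite run_0, ifm_t, E0 by (auto; ml). split; [ml|]. split; [ml|]. intros; ml.
    - intros i IH Hi. destruct IH as [Hz HI]; [ml|].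
      destruct (classic (mem i F /\ u <= i)) as [[Hm Hu]|Hn].
      + rewrite run_step by auto.
        assert (Li : lto (k + 1) (d' i) (ap (run k u F i))) by (apply HI; [ml|]; split; auto; split; auto; ml).
        destruct (H1 i Hm Hu) as [Hnz Hdg]; [ml|].
        assert (Lm : ~ lto (k + 1) (ap (stp (k + 1) i (run k u F i))) (d' i)).
        { apply stp_max; auto. intros q Hq. apply lt_S in Hq as [Hq| ->]; [rewrite Ed by auto; auto|rewrite E0; ml]. }
        assert (R1 : Rc (d' i)) by rc. assert (R2 : Rc (ap (stp (k + 1) i (run k u F i)))) by rc.
        split.
        * eapply leo_nz; [exact R1|exact R2|exact Lm|]. destruct Hnz as (p & Hp & Hz').
          exists p. rewrite Ed by auto. split; auto. ml.
        * intros y Hy (Hmy & Huy & Hiy). eapply leo_lt; [exact R1|exact R2|exact Lm|].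
          apply L', H2; auto. ml.
      + rewrite run_skip by auto. split; auto. intros y Hy (Hmy & Huy & Hiy). apply HI; auto. repeat split; auto; ml. }
  apply HL, K. ml.
Qed.

Lemma run_top k u F i : nz (k + 1) (ap (run k u F i)) ->
  (ap (run k u F i) k = 1 /\ forall q, q < k -> ap (run k u F i) q = 0) \/ ap (run k u F i) k = 0.
Proof.
  intro Hnz. pose proof (run_nz k u F i Hnz) as HN. pose proof (Rc_run1 k u F).
  assert (K : forall j, j <= i -> (ap (run k u F j) k = 1 /\ forall q, q < k -> ap (run k u F j) q = 0) \/ ap (run k u F j) k = 0).
  { ind_dl.
    - rc.
    - intros _. left. rewrite run_0, ifm_t by (auto; ml). split; auto. intros q Hq.
      rewrite run_0 by ml. apply ifm_f. intro; subst; ml.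
    - intros j IH Hj. specialize (IH ltac:(ml)).
      destruct (classic (mem j F /\ u <= j)) as [[Hm Hu]|Hn]; [|rewrite run_skip; auto].
      rewrite run_step by auto. right.
      destruct (stp_spec (k + 1) j (run k u F j)) as (p & Hp & Hz & S1 & S2 & S3); [apply HN; ml|].
      destruct IH as [[I1 I2]|I1].
      + apply lt_S in Hp as [Hp| ->]; [rewrite I2 in Hz; ml|ml].
      + apply lt_S in Hp as [Hp| ->]; [rewrite S3; auto; ml|ml]. }
  apply K. ml.
Qed.
Lemma run_top0 k u F x : mem x F -> u <= x -> nz (k + 1) (ap (run k u F x)) -> ap (run k u F (x + 1)) k = 0.
Proof.
  intros Hm Hu Hnz. rewrite run_step by auto.
  destruct (stp_spec (k + 1) x (run k u F x)) as (p & Hp & Hz & S1 & S2 & S3); auto.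
  destruct (run_top k u F x) as [[I1 I2]|I1]; auto.
  - apply lt_S in Hp as [Hp| ->]; [rewrite I2 in Hz; ml|ml].
  - apply lt_S in Hp as [Hp| ->]; [rewrite S3; auto; ml|ml].
Qed.
Lemma run_digit k u F b i : 1 <= b -> (forall y, mem y F -> u <= y -> y < i -> y <= b) ->
  forall p, p < k + 1 -> ap (run k u F i) p <= b.
Proof.
  intros Hb HB. pose proof (Rc_run1 k u F).
  assert (K : forall j, j <= i -> forall p, p < k + 1 -> ap (run k u F j) p <= b); [|apply K; ml].
  ind_dl.
  - rc.
  - intros _ p Hp. rewrite run_0 by auto. unfold ifm. destruct (excluded_middle_informative _); ml.
  - intros j IH Hj p Hp. specialize (IH ltac:(ml)).
    destruct (classic (mem j F /\ u <= j)) as [[Hm Hu]|Hn]; [|rewrite run_skip; auto].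
    rewrite run_step by auto. destruct (classic (nz (k + 1) (ap (run k u F j)))) as [Hz|Hz];
      [|rewrite stp_zero; auto].
    destruct (stp_spec (k + 1) j _ Hz) as (p0 & Hp0 & Hz0 & S1 & S2 & S3).
    destruct (lt_total p p0) as [L|[->|L]].
    + destruct (S1 p L) as [_ ->]. apply HB; auto. ml.
    + pose proof (IH p0 Hp0). ml.
    + rewrite S3 by auto. auto.
Qed.

(** A run that does not end in zero is itself a descent, if it is read after each of its steps: the
    first step brings it below omega^k, and later steps insert only elements already passed as
    coefficients. *)
Lemma not_large_descent k F u v : ~ LL k F u v ->
  (forall x, mem x F -> u <= x -> x < v ->
     nz k (ap (run k u F (x + 1))) /\ forall p, p < k -> ap (run k u F (x + 1)) p <= x) /\
  (forall x y, mem x F -> u <= x -> mem y F -> y < v -> x < y ->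
     lto k (ap (run k u F (y + 1))) (ap (run k u F (x + 1)))).
Proof.
  intro HL. apply NNPP in HL. pose proof (run_nz k u F v HL) as HN.
  split.
  - intros x Hm Hu Hx. split.
    + destruct (HN (x + 1)) as (p & Hp & Hz); [ml|]. exists p. split; auto.
      apply lt_S in Hp as [Hp| ->]; auto. rewrite run_top0 in Hz; auto; [ml|]. apply HN; ml.
    (* [run_digit] requires a bound of at least 1, because of the initial coefficient of omega^k; so
       [x = 0] is computed by hand. *)
    + intros p Hp. destruct (zero_or_S x) as [->|[x' ->]].
      * rewrite run_step by auto. destruct (stp_spec (k + 1) 0 (run k u F 0)) as (p0 & Hp0 & Hz0 & S1 & S2 & S3).
        { apply HN; ml. }
        rewrite run_0 in Hz0 by auto. unfold ifm in Hz0. destruct (excluded_middle_informative _) as [->|]; [|ml].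
        destruct (S1 p Hp) as [_ ->]. ml.
      * apply (run_digit k u F (x' + 1)); [ml| |ml]. intros; ml.
  - intros x y Hmx Hux Hmy Hy Hxy.
    assert (L : lto (k + 1) (ap (run k u F (y + 1))) (ap (run k u F (x + 1)))).
    { rewrite (run_step k u F y) by (auto; ml). assert (Hly : nz (k + 1) (ap (run k u F y))) by (apply HN; ml).
      assert (Hle : x + 1 <= y) by ml. apply le_iff in Hle as [j ->].
      eapply leo_lt; [| |apply (run_le k u F (x + 1) j)|apply stp_lt]; auto; [rc|rc|]. apply HN; ml. }
    destruct L as (p & Hp & L1 & L2).
    assert (T0 : ap (run k u F (y + 1)) k = 0) by (apply run_top0; auto; [ml|apply HN; ml]).
    assert (T1 : ap (run k u F (x + 1)) k = 0) by (apply run_top0; auto; apply HN; ml).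
    apply lt_S in Hp as [Hp| ->]; [|rewrite T0, T1 in L1; ml].
    exists p. split; auto. split; auto. intros q Hq Hpq. apply L2; auto. ml.
Qed.

(** This form does not mention the run. Monotonicity follows from it at once, since a descent can be
    restricted to fewer elements and padded with zero coefficients. *)
Lemma large_iff k F u v : LL k F u v <->
  ~ exists d : M -> M -> M, Rc (fun w => d (fst w) (snd w)) /\
  (forall x, mem x F -> u <= x -> x < v -> nz k (d x) /\ forall p, p < k -> d x p <= x) /\
  (forall x y, mem x F -> u <= x -> mem y F -> y < v -> x < y -> lto k (d y) (d x)).
Proof.
  split.
  - intros HL (d & Hd & H1 & H2). eapply large_no_descent; eauto.
  - intro HN. apply NNPP. intro HL. apply HN. exists (fun x p => ap (run k u F (x + 1)) p).
    split; [pose proof (Rc_run1 k u F); rc|]. apply not_large_descent, HL.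
Qed.

Lemma LL_mono k F u v F' u' v' : LL k F u v ->
  (forall x, mem x F -> u <= x -> x < v -> mem x F' /\ u' <= x /\ x < v') -> LL k F' u' v'.
Proof.
  rewrite !large_iff. intros HL HS (d & Hd & H1 & H2). apply HL. exists d. split; auto. split.
  - intros x Hm Hu Hv. destruct (HS x Hm Hu Hv) as (A & B & C). auto.
  - intros x y Hm Hu Hmy Hy Hxy.
    destruct (HS x) as (A & B & C); [auto|auto|ml|].
    destruct (HS y) as (A' & B' & C'); [auto|ml|auto|]. auto.
Qed.
Lemma LL_exp k k' F u v : k <= k' -> LL k' F u v -> LL k F u v.
Proof.
  rewrite !large_iff. intros Hk HL (d & Hd & H1 & H2). apply HL.
  exists (fun x p => ifm (p < k) (d x p) 0). split; [rc|]. split.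
  - intros x Hm Hu Hv. destruct (H1 x Hm Hu Hv) as [(p & Hp & Hz) Hdg]. split.
    + exists p. rewrite ifm_t by auto. split; auto. ml.
    + intros q Hq. unfold ifm. destruct (excluded_middle_informative _); auto. ml.
  - intros x y Hm Hu Hmy Hy Hxy. destruct (H2 x y) as (p & Hp & L1 & L2); auto.
    exists p. rewrite !ifm_t by auto. split; [ml|]. split; auto. intros q Hq Hpq.
    unfold ifm. destruct (excluded_middle_informative _); auto.
Qed.
Lemma LL_nonempty k F u v : LL k F u v -> exists x, mem x F /\ u <= x /\ x < v.
Proof.
  intro HL. apply NNPP. intro HN. apply large_iff in HL. apply HL.
  exists (fun _ _ => 0). split; [rc|]. split.
  - intros x Hm Hu Hv. exfalso. apply HN. eauto.
  - intros x y Hm Hu Hmy Hy Hxy. exfalso. apply HN. exists x. repeat split; auto. ml.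
Qed.
Lemma LL_zero F u v x : mem x F -> u <= x -> x < v -> LL 0 F u v.
Proof.
  intros Hm Hu Hv. apply large_iff. intros (d & _ & H1 & _).
  destruct (H1 x Hm Hu Hv) as [(p & Hp & _) _]. exact (nlt0 _ Hp).
Qed.
End Ord.

Ltac rc_large :=
  lazymatch goal with
  | |- Rc (fun z => run (@?a z) (@?b z) (@?c z) (@?d z)) => apply (Rc_run a b c d)
  | |- Dl (fun z => LL (@?a z) (@?b z) (@?c z) (@?d z)) => apply (Dl_LL a b c d)
  | |- Dl (fun z => lto (@?k z) (@?s z) (@?t z)) => apply (Dl_lto k s t)
  | |- Dl (fun z => nz (@?k z) (@?s z)) => apply (Dl_nz k s)
  | |- _ => rc_arith
  end.
Ltac rc_user ::= rc_large.

(** * Partitions of large sets and their decomposition into blocks *)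

Section Large.
Context `{R : RM}.
Add Ring Mring7 : M_srt.

Lemma msum_ext n f g : Rc f -> Rc g -> (forall c, c < n -> f c = g c) -> msum n f = msum n g.
Proof.
  intros Hf Hg HE.
  assert (K : forall m, m <= n -> msum m f = msum m g); [|apply K; ml].
  ind_dl; [rc|now rewrite !msum_0|].
  intros m IH Hm. rewrite !msum_S, IH, HE by (auto; ml). reflexivity.
Qed.
Lemma msum_ge n f c : Rc f -> c < n -> f c <= msum n f.
Proof.
  intros Hf. revert n. ind_dl; [rc|intro H; destruct (nlt0 _ H)|].
  intros n IH H. rewrite msum_S by auto. apply lt_S in H as [H| ->]; [specialize (IH H)|]; ml.
Qed.
Lemma msum_le n f b : Rc f -> (forall c, c < n -> f c <= b) -> msum n f <= n * b.
Proof.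
  intros Hf HB. assert (K : forall m, m <= n -> msum m f <= m * b); [|apply K; ml].
  ind_dl; [rc|intros _; rewrite msum_0 by auto; ml|].
  intros m IH Hm. rewrite msum_S by auto. replace ((m + 1) * b) with (m * b + b) by ring.
  specialize (IH ltac:(ml)). specialize (HB m ltac:(ml)). ml.
Qed.
Lemma msum_lt n f g c0 : Rc f -> Rc g -> c0 < n -> f c0 < g c0 ->
  (forall c, c < n -> c <> c0 -> f c = g c) -> msum n f < msum n g.
Proof.
  intros Hf Hg Hc HL HE.
  assert (K : forall m, m <= n -> (c0 < m -> msum m f < msum m g) /\ (m <= c0 -> msum m f = msum m g)).
  { ind_dl; [rc| |].
    - intros _. rewrite !msum_0 by auto. split; intro H; ml.
    - intros m IH Hm. destruct IH as [I1 I2]; [ml|]. rewrite !msum_S by auto. split; intro H.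
      + apply lt_S in H as [H| ->].
        * rewrite (HE m) by (try (intro; subst; ml); ml). specialize (I1 H). ml.
        * specialize (I2 ltac:(ml)). ml.
      + rewrite I2, (HE m) by (try (intro; subst; ml); ml). reflexivity. }
  destruct (K n) as [K1 _]; [ml|auto].
Qed.

(** If all colour classes were small, the runs along them would stay nonzero, and their
    coefficientwise sum over the [a] colours would descend along [F]. It starts at a times omega^k,
    which is why one exponent is lost; sparsity keeps its coefficients at [x] below [x]. *)
Lemma pigeonhole k F u v (col : M -> M) a : LL (k + 1) F u v -> Rc col ->
  (forall x, mem x F -> u <= x -> x < v -> col x < a /\ a <= x) ->
  (forall x y, mem x F -> mem y F -> u <= x -> y < v -> x < y -> x * x <= y) ->
  exists c, c < a /\ LL k (setc v (fun x => mem x F /\ col x = c)) u v.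
Proof.
  intros HL Hcol Ha Hsp. apply NNPP. intro HN.
  set (Fc := fun c => setc v (fun x => mem x F /\ col x = c)).
  assert (HFc : Rc Fc) by (unfold Fc; rc).
  assert (HmF : forall c x, mem x (Fc c) <-> x < v /\ mem x F /\ col x = c) by (intros c x; unfold Fc; rewrite mem_setc; [tauto|rc]).
  assert (Hnz : forall c, c < a -> forall i, i <= v -> nz (k + 1) (ap (run k u (Fc c) i))).
  { intros c Hc. apply run_nz. apply NNPP. intro H. apply HN. exists c. split; auto. }
  set (S := fun i p => msum a (fun c => ap (run k u (Fc c) i) p)).
  assert (HS : Rc (fun w => S (fst w) (snd w))) by (unfold S; rc).
  assert (Hrc : forall i p, Rc (fun c => ap (run k u (Fc c) i) p)) by (intros; rc).
  assert (Hdec : forall i, mem i F -> u <= i -> i < v -> lto (k + 1) (S (i + 1)) (S i)).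
  { intros i Hm Hu Hv. destruct (Ha i Hm Hu Hv) as [Hc _].
    assert (Hmi : mem i (Fc (col i))) by (apply HmF; auto).
    destruct (stp_lt (k + 1) i (run k u (Fc (col i)) i)) as (p & Hp & L1 & L2); [apply Hnz; auto; ml|].
    rewrite <- run_step in L1, L2 by auto.
    assert (HE : forall c q, c < a -> c <> col i -> ap (run k u (Fc c) (i + 1)) q = ap (run k u (Fc c) i) q).
    { intros c q Hca Hne. rewrite run_skip; auto. intros [H _]. apply HmF in H. intuition. }
    exists p. split; auto. split.
    - apply (msum_lt a _ _ (col i)); auto.
    - intros q Hq Hpq. apply msum_ext; auto. intros c Hca.
      destruct (classic (c = col i)) as [->|Hne]; auto. }
  assert (Hskip : forall i, ~ (mem i F /\ u <= i) -> i < v -> forall p, S (i + 1) p = S i p).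
  { intros i Hn Hv p. apply msum_ext; auto. intros c Hc. rewrite run_skip; auto.
    intros [H1 H2]. apply HmF in H1. tauto. }
  apply large_iff in HL. apply HL. exists S. split; auto. split.
  - intros x Hm Hu Hv. destruct (Ha x Hm Hu Hv) as [Hc Hax]. split.
    + destruct (Hnz (col x) Hc x) as (p & Hp & Hz); [ml|]. exists p. split; auto.
      pose proof (msum_ge a (fun c => ap (run k u (Fc c) x) p) (col x) (Hrc x p) Hc) as L. cbv beta in L.
      unfold S. ml.
    (* [b] is the quotient of [x] by [a]. An earlier element y satisfies a y <= y y <= x, hence y <=
       b; so each of the [a] runs has coefficients at most [b], and a b <= x. *)
    + intros p Hp. destruct (rem_spec x a) as (b & _ & E & Hr); [ml|].
      assert (Lb : 1 <= b). { apply NNPP. intro H. assert (b = 0) by ml. subst b. rewrite mul_0_l in E. ml. }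
      assert (L : S x p <= a * b).
      { apply msum_le; auto. intros c Hca. apply run_digit; auto. intros y Hy Huy Hyx.
        apply HmF in Hy as (Hyv & Hym & _). apply NNPP. intro Hn. apply nle_lt, lt_le1 in Hn.
        destruct (Ha y Hym Huy Hyv) as [_ Hay]. pose proof (Hsp y x Hym Hm Huy Hv Hyx) as Hs.
        pose proof (mul_le2 _ _ _ _ Hn Hay) as L. replace ((b + 1) * a) with (b * a + a) in L by ring. ml. }
      rewrite mul_comm in L. ml.
  - intros x y Hmx Hux Hmy Hyv Hxy.
    assert (K : forall j, x + 1 + j <= v -> lto (k + 1) (S (x + 1 + j)) (S x)).
    { ind_dl; [rc| |].
      - intros _. rewrite add_0_r. apply Hdec; auto. ml.
      - intros j IH Hj. specialize (IH ltac:(ml)).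
        replace (x + 1 + (j + 1)) with (x + 1 + j + 1) in * by ring.
        destruct (classic (mem (x + 1 + j) F /\ u <= x + 1 + j)) as [[H1 H2]|H1].
        + eapply lto_trans; [apply Hdec; auto; ml|exact IH].
        + eapply lto_ext; [| |exact IH]; auto. intros p Hp. symmetry. apply Hskip; auto. ml. }
    assert (Hle : x + 1 <= y) by ml. apply le_iff in Hle as [j Ej]. subst y. apply K. ml.
Qed.

(** Along a descent the coefficient of omega^k never grows, and it has to drop after each block: if
    it kept its value throughout a block and beyond, the other coefficients would descend on that
    block, against its largeness. It is at most [h] at the first block, by [hi 0 <= h + 1], hence 0
    on block [h], where the descent is one below omega^k. *)
Lemma large_blocks k G u v lo hi h : Rc lo -> Rc hi ->
  (forall j, j <= h -> LL k G (lo j) (hi j) /\ u <= lo j /\ hi j <= v) ->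
  (forall j, j < h -> hi j <= lo (j + 1)) -> hi 0 <= h + 1 -> LL (k + 1) G u v.
Proof.
  intros Hlo Hhi HB HM H0. apply large_iff. intros (d & Hd & H1 & H2).
  assert (Hlead : forall x y, mem x G -> u <= x -> mem y G -> y < v -> x < y -> d y k <= d x k).
  { intros x y Hx Hu Hy Hv Hxy. destruct (H2 x y) as (p & Hp & L1 & L2); auto.
    apply lt_S in Hp as [Hp| ->]; [rewrite L2; auto; ml|ml]. }
  assert (K : forall j, j <= h -> forall x, x < v -> mem x G /\ lo j <= x -> d x k + j <= h).
  { ind_dl; [rc| |].
    - intros _ x Hv [Hm Hx]. rewrite add_0_r. destruct (HB 0) as (HL & Hu & Hv'); [ml|].
      destruct (classic (x < hi 0)) as [Hx'|Hx'].
      + destruct (H1 x) as [_ Hdg]; auto; [ml|]. specialize (Hdg k ltac:(ml)). ml.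
      + apply LL_nonempty in HL as (e & Hem & Hel & Heh).
        destruct (H1 e) as [_ Hdg]; auto; [ml|ml|]. specialize (Hdg k ltac:(ml)).
        pose proof (Hlead e x Hem ltac:(ml) Hm Hv ltac:(ml)). ml.
    - intros j IH Hj x Hv [Hm Hx]. specialize (IH ltac:(ml)).
      destruct (HB j) as (HL & Hu & Hv'); [ml|]. pose proof (HM j ltac:(ml)) as HMj.
      apply NNPP. intro HN. apply nle_lt in HN.
      assert (Ex : forall y, mem y G -> lo j <= y -> y < hi j -> d y k = d x k).
      { intros y Hy Hly Hyh. specialize (IH y ltac:(ml) ltac:(auto)).
        pose proof (Hlead y x Hy ltac:(ml) Hm Hv ltac:(ml)). ml. }
      apply large_iff in HL. apply HL. exists d. split; auto.
      assert (Hlow : forall y z, d y k = d z k -> lto (k + 1) (d y) (d z) -> lto k (d y) (d z)).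
      { intros y z E (p & Hp & L1 & L2). apply lt_S in Hp as [Hp| ->]; [|rewrite E in L1; ml].
        exists p. repeat split; auto. intros; apply L2; auto; ml. }
      split.
      + intros y Hy Hly Hyh. split.
        * apply (lto_nz _ (d x)). apply Hlow; [symmetry; auto|]. apply H2; auto; ml.
        * intros p Hp. destruct (H1 y) as [_ Hdg]; auto; [ml|ml|]. apply Hdg. ml.
      + intros y z Hy Hly Hz Hzh Hyz. apply Hlow; [|apply H2; auto; ml].
        rewrite (Ex y), (Ex z); auto; ml. }
  destruct (HB h) as (HL & Hu & Hv); [ml|].
  apply large_iff in HL. apply HL. exists d. split; auto.
  assert (Z : forall y, mem y G -> lo h <= y -> y < hi h -> d y k = 0).
  { intros y Hy Hl Hh. pose proof (K h ltac:(ml) y ltac:(ml) ltac:(auto)). ml. }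
  split.
  - intros y Hy Hl Hh. destruct (H1 y) as [(p & Hp & Hz) Hdg]; auto; [ml|ml|]. split.
    + exists p. split; auto. apply lt_S in Hp as [Hp| ->]; auto. rewrite Z in Hz; auto. ml.
    + intros q Hq. apply Hdg. ml.
  - intros y z Hy Hly Hz Hzh Hyz. destruct (H2 y z) as (p & Hp & L1 & L2); auto; [ml|ml|].
    apply lt_S in Hp as [Hp| ->]; [|rewrite !Z in L1; auto; ml].
    exists p. repeat split; auto. intros; apply L2; auto; ml.
Qed.

(* End points of the consecutive minimal k-large blocks of F from u0 on; the value is v + 1
   once the elements below v are exhausted. *)
Definition cut (k F u0 v i : M) : M :=
  rec (fun _ u => mub (v + 1) (fun w => w <= v /\ LL k F u w)) i u0.
Lemma Rc_cut k F u0 v : Rc (cut k F u0 v).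
Proof. unfold cut. rc. Qed.
Lemma cut_0 k F u0 v : cut k F u0 v 0 = u0.
Proof. apply rec_0. rc. Qed.
Lemma cut_S k F u0 v i : cut k F u0 v (i + 1) = mub (v + 1) (fun w => w <= v /\ LL k F (cut k F u0 v i) w).
Proof. apply (rec_S (fun _ u => mub (v + 1) (fun w => w <= v /\ LL k F u w))). rc. Qed.

Lemma cut_step k F u0 v i (c := cut k F u0 v) :
  (forall w, w < c (i + 1) -> w <= v -> ~ LL k F (c i) w) /\
  ((c (i + 1) <= v /\ LL k F (c i) (c (i + 1)) /\ c i < c (i + 1)) \/ c (i + 1) = v + 1).
Proof.
  unfold c. rewrite cut_S.
  assert (HD : Dl (fun w => w <= v /\ LL k F (cut k F u0 v i) w)) by rc.
  destruct (mub_spec (v + 1) _ HD) as [H1 H2]. split.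
  - intros w Hw Hv HL. apply H2 in Hw. tauto.
  - destruct H1 as [[H1 H3]|H1]; [left|right; auto]. split; auto. split; auto.
    apply LL_nonempty in H3 as (x & _ & Hx1 & Hx2). ml.
Qed.
Lemma cut_ge k F u0 v i : u0 <= v -> u0 + i <= cut k F u0 v i \/ cut k F u0 v i = v + 1.
Proof.
  intro Hv. pose proof (Rc_cut k F u0 v). revert i. ind_dl; [rc|left; rewrite cut_0; ml|].
  intros i IH. destruct (cut_step k F u0 v i) as [_ [(H1 & _ & H2)|H1]]; auto. left. destruct IH; ml.
Qed.
Lemma cut_mono k F u0 v i j : u0 <= v -> i <= j -> cut k F u0 v j <= v ->
  cut k F u0 v i <= v /\ cut k F u0 v i + (msub j i) <= cut k F u0 v j.
Proof.
  intros Hv Hij. apply le_iff in Hij as [d ->].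
  destruct (msub_spec (i + d) i) as [_ E]. assert (Ed : msub (i + d) i = d) by (specialize (E ltac:(ml)); ml).
  rewrite Ed. clear E Ed. pose proof (Rc_cut k F u0 v). revert d. ind_dl; [rc| |].
  - rewrite add_0_r. intro; ml.
  - intros d IH Hd. replace (i + (d + 1)) with (i + d + 1) in * by ring.
    destruct (cut_step k F u0 v (i + d)) as [_ [(H1 & _ & H2)|H1]]; [|ml].
    destruct IH; ml.
Qed.

(** A set that is large for [k + m] has omega^m-many blocks for [k]. A descent [d] indexed by the
    blocks, used for the upper [m] coefficients, combines with the run inside the current block,
    used for the lower [k], to a descent on all of [F]. *)
Lemma no_block_descent k m F u0 v (d : M -> M -> M) : 1 <= u0 -> u0 <= v -> LL (k + m) F u0 v ->
  Rc (fun w => d (fst w) (snd w)) ->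
  (forall i, cut k F u0 v i <= v -> nz m (d i) /\ (forall p, p < m -> d i p <= cut k F u0 v i) /\
     forall j, j < i -> lto m (d i) (d j)) -> False.
Proof.
  intros H1 Huv HL Hd HI. set (c := cut k F u0 v) in *.
  assert (Hc : Rc c) by apply Rc_cut.
  set (ix := fun x => mub v (fun i => x < c (i + 1))).
  assert (Hix : Rc ix) by (unfold ix; rc).
  assert (Eix : forall x, u0 <= x -> x < v -> c (ix x) <= x /\ x < c (ix x + 1)).
  { intros x Hu Hx. assert (HD : Dl (fun i => x < c (i + 1))) by rc.
    destruct (mub_ex v _ v HD) as [A B]; [|ml|].
    - destruct (cut_ge k F u0 v (v + 1) Huv) as [L|L]; fold c in L; ml.
    - split; auto. fold (ix x) in *. destruct (zero_or_S (ix x)) as [E|[i E]].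
      + rewrite E. unfold c. rewrite cut_0. auto.
      + destruct (mub_spec v _ HD) as [_ Hm]. fold (ix x) in Hm. destruct (Hm i) as [Hm' _]; [ml|].
        rewrite E. apply nlt_le, Hm'. }
  assert (Hnl : forall x, u0 <= x -> x < v -> forall w, w <= x -> nz (k + 1) (ap (run k (c (ix x)) F w))).
  { intros x Hu Hx w Hw. destruct (Eix x Hu Hx) as [E1 E2].
    destruct (cut_step k F u0 v (ix x)) as [A _]. fold c in A. apply NNPP. apply A; ml. }
  set (D := fun x p => ifm (p < k) (ap (run k (c (ix x)) F (x + 1)) p) (d (ix x) (msub p k))).
  assert (Elo : forall x p, p < k -> D x p = ap (run k (c (ix x)) F (x + 1)) p) by (intros; apply ifm_t; auto).
  assert (Ehi : forall x p, D x (k + p) = d (ix x) p).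
  { intros x p. unfold D. rewrite ifm_f by ml. f_equal.
    destruct (msub_spec (k + p) k) as [_ E]. specialize (E ltac:(ml)). ml. }
  apply large_iff in HL. apply HL. exists D. split; [unfold D; rc|]. split.
  - intros x Hm Hu Hx. destruct (Eix x Hu Hx) as [E1 E2].
    destruct (HI (ix x)) as (A & B & C); [ml|]. split.
    (* The lower part becomes 0 at an element that completes its block; it is the upper part that
       keeps the value nonzero. *)
    + destruct A as (p & Hp & Hz). exists (k + p). rewrite Ehi. split; auto. ml.
    + intros p Hp. destruct (classic (p < k)) as [Hpk|Hpk].
      * rewrite Elo by auto. apply (run_digit k (c (ix x)) F x); [ml| |ml]. intros; ml.
      * apply nlt_le, le_iff in Hpk as [q ->]. rewrite Ehi. specialize (B q ltac:(ml)). ml.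
  - intros x y Hmx Hux Hmy Hyv Hxy. destruct (Eix x Hux ltac:(ml)) as [E1 E2].
    destruct (Eix y ltac:(ml) Hyv) as [E3 E4].
    assert (Hij : ix x <= ix y).
    { apply NNPP. intro Hn. apply nle_lt, lt_le1 in Hn.
      assert (Hcx : c (ix x) <= v) by ml.
      destruct (cut_mono k F u0 v (ix y + 1) (ix x) Huv Hn Hcx) as [_ L].
      fold c in L. ml. }
    apply lt_S in Hij as [Hij|Hij].
    + destruct (HI (ix y)) as (_ & _ & C); [ml|]. destruct (C (ix x) Hij) as (p & Hp & L1 & L2).
      exists (k + p). rewrite !Ehi. split; [ml|]. split; auto. intros q Hq Hpq.
      assert (Hkq : k <= q) by ml. apply le_iff in Hkq as [q' ->]. rewrite !Ehi. apply L2; ml.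
    + set (u := c (ix x)) in *.
      assert (Hn1 : nz (k + 1) (ap (run k u F (x + 1)))).
      { unfold u. rewrite Hij. apply Hnl; auto; ml. }
      assert (Hn2 : nz (k + 1) (ap (run k u F y))).
      { unfold u. rewrite Hij. apply Hnl; auto; ml. }
      assert (T1 : ap (run k u F (x + 1)) k = 0).
      { apply run_top0; auto. apply Hnl; auto; ml. }
      assert (Huy : u <= y) by ml.
      assert (T2 : ap (run k u F (y + 1)) k = 0) by (apply run_top0; auto).
      assert (L : lto (k + 1) (ap (run k u F (y + 1))) (ap (run k u F (x + 1)))).
      { rewrite (run_step k u F y) by auto. clear T2.
        assert (Hle : x + 1 <= y) by ml. apply le_iff in Hle as [j Ej]. subst y.
        eapply leo_lt; [| |apply (run_le k u F (x + 1) j)|apply stp_lt]; auto; rc. }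
      destruct L as (p & Hp & L1 & L2).
      apply lt_S in Hp as [Hp| ->]; [|rewrite T1, T2 in L1; ml].
      exists p. rewrite !Elo by auto. rewrite <- Hij. fold u. split; [ml|]. split; auto.
      intros q Hq Hpq. destruct (classic (q < k)) as [Hqk|Hqk].
      * rewrite !Elo by auto. rewrite <- Hij. apply L2; auto. ml.
      * apply nlt_le, le_iff in Hqk as [q' ->]. rewrite !Ehi, <- Hij. reflexivity.
Qed.

Lemma first_elem F u v : (exists x, mem x F /\ u <= x /\ x < v) ->
  exists x, mem x F /\ u <= x /\ x < v /\ forall y, mem y F -> u <= y -> x <= y.
Proof.
  intros (x & H1 & H2 & H3). destruct (least (fun x => mem x F /\ u <= x)) as (x0 & [A B] & C); [rc|eauto|].
  exists x0. repeat split; auto.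
  - apply NNPP. intro Hn. apply (C x); auto. ml.
  - intros y Hy Huy. apply NNPP. intro Hn. apply (C y); auto. ml.
Qed.

(** The case [m = 1] of [no_block_descent]: if there were fewer than [x0] blocks, the countdown from
    [x0] would be a descent along them. The blocks end right after an element of [F], so that
    sparsity can be applied to their end points. *)
Lemma block_split k F u v : 1 <= u -> LL (k + 1) F u v ->
  exists x0 c, Rc c /\ mem x0 F /\ u <= x0 /\ x0 < v /\ c 0 = x0 /\
  (forall y, mem y F -> u <= y -> x0 <= y) /\
  forall j, j < x0 -> c j < c (j + 1) /\ c (j + 1) <= v /\ LL k F (c j) (c (j + 1)) /\
    exists e, c (j + 1) = e + 1 /\ mem e F.
Proof.
  intros H1 HL. destruct (first_elem F u v (LL_nonempty _ _ _ _ HL)) as (x0 & A & B & C & D).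
  assert (HL' : LL (k + 1) F x0 v).
  { apply (LL_mono _ _ _ _ F x0 v HL). intros x Hm Hu Hv. auto. }
  exists x0, (cut k F x0 v). split; [apply Rc_cut|]. repeat (split; [solve [auto | apply cut_0]|]).
  assert (Hall : forall j, j < x0 -> cut k F x0 v (j + 1) <= v).
  { intros j Hj. apply NNPP. intro Hn.
    apply (no_block_descent k 1 F x0 v (fun i _ => msub x0 i)); [ml|ml|auto|rc|].
    intros i Hi. assert (Hij : i <= j).
    { apply NNPP. intro Hij. apply Hn. apply (cut_mono k F x0 v (j + 1) i); auto; ml. }
    destruct (msub_spec x0 i) as [_ E]. specialize (E ltac:(ml)). split; [|split].
    - exists 0. split; ml.
    - intros p _. destruct (cut_ge k F x0 v i) as [L|L]; ml.
    - intros j' Hj'. destruct (msub_spec x0 j') as [_ E']. specialize (E' ltac:(ml)).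
      exists 0. split; [ml|]. split; [ml|]. intros; ml. }
  intros j Hj. specialize (Hall j Hj).
  destruct (cut_step k F x0 v j) as [S1 [(S2 & S3 & S4)|S2]]; [|ml].
  repeat (split; [solve [auto]|]).
  (* If the last position of the block were not in [F], the block could be shortened, against its
     minimality. *)
  destruct (zero_or_S (cut k F x0 v (j + 1))) as [E|[e E]]; [ml|]. exists e. split; auto.
  apply NNPP. intro Hn. apply (S1 e); [ml|ml|]. rewrite E in S3.
  apply (LL_mono _ _ _ _ F (cut k F x0 v j) e S3). intros x Hm Hu Hv. repeat split; auto.
  apply lt_S in Hv as [Hv| ->]; auto. contradiction.
Qed.
End Large.

(** * Ramsey's theorem for pairs and large sets *)

Section Ramsey.
Context `{R : RM}.
Add Ring Mring8 : M_srt.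

(** One exponential bounds the number of sets of earlier elements, which serve as colours. The
    second is used in [homogeneous_chain], with 2^(2m) groups: finite Ramsey finds m homogeneous
    ones among them, and sets of groups are again used as colours. *)
Definition gr (v : M) : M := pow2 (pow2 (v + v)).
(** The quantifiers are bounded by [F] to make the predicate recursive; this loses nothing, as
    members are smaller than the code of their set. *)
Definition sparse (F : M) : Prop :=
  forall x, x < F -> forall y, y < F -> mem x F -> mem y F -> x < y -> gr (x + 1) <= y.
Lemma Dl_sparse f : Rc f -> Dl (fun z => sparse (f z)).
Proof. intros. unfold sparse, gr. rc. Qed.
Lemma sparse_gr F x y : sparse F -> mem x F -> mem y F -> x < y -> gr (x + 1) <= y.
Proof. intros HS Hx Hy. apply HS; auto using mem_lt. Qed.
Lemma gr_pow v : pow2 v <= gr v.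
Proof.
  unfold gr. apply pow2_mono. pose proof (pow2_gt (v + v)). ml.
Qed.
Lemma gr_sq v : v * v <= gr v.
Proof.
  unfold gr. pose proof (pow2_gt v) as L. pose proof (pow2_gt (pow2 (v + v))).
  assert (L' : v <= pow2 v) by ml. pose proof (mul_le2 _ _ _ _ L' L') as L2. rewrite <- pow2_add in L2. ml.
Qed.
Lemma sparse_sq F x y : sparse F -> mem x F -> mem y F -> x < y -> x * x <= y.
Proof.
  intros HS Hx Hy Hxy. pose proof (sparse_gr F x y HS Hx Hy Hxy). pose proof (gr_sq (x + 1)) as L.
  assert (Hl : x <= x + 1) by ml. pose proof (mul_le2 _ _ _ _ Hl Hl). ml.
Qed.
Lemma sparse_pow F x y : sparse F -> mem x F -> mem y F -> x < y -> pow2 (x + 1) <= y.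
Proof.
  intros HS Hx Hy Hxy. pose proof (sparse_gr F x y HS Hx Hy Hxy). pose proof (gr_pow (x + 1)). ml.
Qed.
Lemma sparse_sub F G : (forall x, mem x G -> mem x F) -> sparse F -> sparse G.
Proof. intros HI HS x _ y _ Hx Hy Hxy. eapply sparse_gr; eauto. Qed.

Lemma incr_mono (c : M -> M) N : Rc c -> (forall j, j < N -> c j <= c (j + 1)) ->
  forall i j, i <= j -> j <= N -> c i <= c j.
Proof.
  intros Hc HI i j Hij. apply le_iff in Hij as [d ->]. revert d. ind_dl; [rc|rewrite add_0_r; intro; ml|].
  intros d IH Hd. specialize (IH ltac:(ml)). specialize (HI (i + d) ltac:(ml)).
  replace (i + (d + 1)) with (i + d + 1) by ring. ml.
Qed.

Definition disj (lo hi : M -> M) (N : M) : Prop := forall i j, i < j -> j < N -> hi i <= lo j.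

(** The sets chosen in the different intervals must depend recursively on the index for their union
    to be coded; taking the least code achieves this. *)
Lemma select (Phi : M -> M -> Prop) F lo hi N : Dl (fun w => Phi (fst w) (snd w)) -> Rc lo -> Rc hi ->
  disj lo hi N ->
  (forall j, j < N -> exists H, Phi j H /\ forall x, x < H -> mem x H -> mem x F /\ lo j <= x /\ x < hi j) ->
  exists F' Hs, Rc Hs /\ (forall j, j < N -> Phi j (Hs j)) /\
  (forall x, mem x F' -> mem x F /\ exists j, j < N /\ mem x (Hs j)) /\
  (forall j x, j < N -> mem x (Hs j) -> mem x F' /\ lo j <= x /\ x < hi j) /\
  (forall j x, j < N -> mem x F' -> lo j <= x -> x < hi j -> mem x (Hs j)).
Proof.
  intros HPhi Hlo Hhi HD HE.
  set (Q := fun j H => j < N -> Phi j H /\ forall x, x < H -> mem x H -> mem x F /\ lo j <= x /\ x < hi j).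
  assert (HQ : Dl (fun w => Q (fst w) (snd w))) by (unfold Q; rc).
  assert (HQE : forall j, exists H, Q j H).
  { intro j. destruct (classic (j < N)) as [Hj|Hj]; [destruct (HE j Hj) as [H HH]; exists H; intro; auto|].
    exists 0. intro; contradiction. }
  set (Hs := fun j => mu (Q j)).
  assert (HHs : Rc Hs) by (apply (Rc_mu Q HQ HQE)).
  assert (HS : forall j, j < N -> Phi j (Hs j) /\ forall x, mem x (Hs j) -> mem x F /\ lo j <= x /\ x < hi j).
  { intros j Hj. destruct (mu_spec (Q j) (Dl_slice Q j HQ) (HQE j)) as [Hm _].
    destruct (Hm Hj) as [A B]. split; auto. intros x Hx. apply B; auto. apply mem_lt, Hx. }
  set (F' := setc F (fun x => exists j, j < N /\ mem x (Hs j))).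
  assert (HF' : forall x, mem x F' <-> x < F /\ exists j, j < N /\ mem x (Hs j)).
  { intro x. unfold F'. rewrite mem_setc; [tauto|rc]. }
  exists F', Hs. split; auto. split; [intros; apply HS; auto|]. split; [|split].
  - intros x Hx. apply HF' in Hx as [_ (j & Hj & Hx)]. destruct (HS j Hj) as [_ B]. split; [apply B|]; eauto.
  - intros j x Hj Hx. destruct (HS j Hj) as [_ B]. destruct (B x Hx) as (B1 & B2 & B3). split; auto.
    apply HF'. split; [apply mem_lt, B1|eauto].
  - intros j x Hj Hx Hl Hh. apply HF' in Hx as [_ (i & Hi & Hx)].
    destruct (lt_total i j) as [L|[->|L]]; auto; exfalso; destruct (HS i Hi) as [_ B]; destruct (B x Hx) as (B1 & B2 & B3).
    + pose proof (HD i j L Hj). ml.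
    + pose proof (HD j i L Hi). ml.
Qed.

Lemma refine k F lo hi N (col : M -> M -> M) : sparse F -> Rc lo -> Rc hi -> disj lo hi N ->
  Rc (fun w => col (fst w) (snd w)) ->
  (forall j, j < N -> LL (k + 1) F (lo j) (hi j) /\
     exists a, forall x, mem x F -> lo j <= x -> x < hi j -> col j x < a /\ a <= x) ->
  exists F', (forall x, mem x F' -> mem x F /\ exists j, j < N /\ lo j <= x /\ x < hi j) /\
  forall j, j < N -> LL k F' (lo j) (hi j) /\
    forall x y, mem x F' -> mem y F' -> lo j <= x -> x < hi j -> lo j <= y -> y < hi j -> col j x = col j y.
Proof.
  intros HS Hlo Hhi HD Hcol HB.
  set (Phi := fun j H => LL k H (lo j) (hi j) /\
    forall x, x < H -> forall y, y < H -> mem x H -> mem y H -> col j x = col j y).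
  destruct (select Phi F lo hi N) as (F' & Hs & H1 & H2 & H3 & H4 & H5); auto.
  - unfold Phi. rc.
  - intros j Hj. destruct (HB j Hj) as [HL [a Ha]].
    destruct (pigeonhole k F (lo j) (hi j) (col j) a HL) as (c & Hc & HLc); auto; [rc| |].
    { intros x y Hx Hy _ _ Hxy. eapply sparse_sq; eauto. }
    set (H := setc (hi j) (fun x => mem x F /\ lo j <= x /\ col j x = c)).
    assert (HH : forall x, mem x H <-> x < hi j /\ mem x F /\ lo j <= x /\ col j x = c).
    { intro x. unfold H. rewrite mem_setc; [tauto|rc]. }
    exists H. split; [split|].
    + eapply LL_ext; [|exact HLc]. intros x Hl Hh. rewrite mem_setc by rc. rewrite HH. tauto.
    + intros x _ y _ Hx Hy. apply HH in Hx, Hy. destruct Hx as (_ & _ & _ & ->), Hy as (_ & _ & _ & ->). auto.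
    + intros x _ Hx. apply HH in Hx. tauto.
  - exists F'. split.
    + intros x Hx. destruct (H3 x Hx) as [Hm (j & Hj & Hxj)]. split; auto. exists j. split; auto.
      apply H4 in Hxj; tauto.
    + intros j Hj. destruct (H2 j Hj) as [A B]. split.
      * eapply LL_ext; [|exact A]. intros x Hl Hh. split; intro Hx; [apply (H4 j x Hj Hx)|apply (H5 j x); auto].
      * intros x y Hx Hy Hlx Hhx Hly Hhy.
        assert (mem x (Hs j)) by (apply (H5 j x); auto). assert (mem y (Hs j)) by (apply (H5 j y); auto).
        apply B; auto using mem_lt.
Qed.

Variable P : M -> M -> Prop.
Hypothesis HP : Dl (fun w => P (fst w) (snd w)).

(** Three exponents are spent: one to split into blocks, one to make the colour of a pair
    independent of its upper element within a block, and one to make it independent of its lower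
    element. *)
Lemma uniform_grouping s F u v N : sparse F -> 1 <= u -> LL (s + 1 + 1 + 1) F u v ->
  (forall x, mem x F -> u <= x -> x < v -> pow2 N <= x) ->
  exists F' c, Rc c /\ (forall x, mem x F' -> mem x F /\ u <= x /\ x < v) /\ u <= c 0 /\
  (forall j, j < N -> c j <= c (j + 1) /\ c (j + 1) <= v /\ LL s F' (c j) (c (j + 1)) /\
     exists e, c (j + 1) = e + 1 /\ mem e F) /\
  (forall i j x x' y y', i < j -> j < N -> mem x F' -> mem x' F' -> mem y F' -> mem y' F' ->
    c i <= x -> x < c (i + 1) -> c i <= x' -> x' < c (i + 1) ->
    c j <= y -> y < c (j + 1) -> c j <= y' -> y' < c (j + 1) -> (P x y <-> P x' y')).
Proof.
  intros HS Hu HL HN.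
  destruct (block_split _ F u v Hu HL) as (x0 & c & Hc & Hx0 & Hux0 & Hx0v & Hc0 & Hmin & HB).
  assert (HNx : N < x0). { pose proof (HN x0 Hx0 Hux0 Hx0v). pose proof (pow2_gt N). ml. }
  assert (Hmono : forall i j, i <= j -> j <= x0 -> c i <= c j).
  { apply incr_mono; auto. intros j Hj. destruct (HB j Hj). ml. }
  set (lo := c). set (hi := fun j => c (j + 1)).
  assert (Hlo : Rc lo) by exact Hc. assert (Hhi : Rc hi) by (unfold hi; rc).
  assert (HD : disj lo hi N) by (intros i j Hi Hj; apply Hmono; ml).
  assert (Hcv : forall j, j < N -> hi j <= v) by (intros j Hj; apply HB; ml).
  assert (Hul : forall j, j < N -> u <= lo j).
  { intros j Hj. pose proof (Hmono 0 j ltac:(ml) ltac:(ml)). unfold lo. rewrite Hc0 in *. ml. }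
  (* The colour of [y] is the set of earlier elements that [P] relates to it. Block 0 gets a
     constant colour: nothing precedes it, and its first element [x0] does not exceed the number of
     subsets of [x0]. *)
  set (col1 := fun j y => ifm (j = 0) 0 (setc (c j) (fun x => mem x F /\ P x y))).
  destruct (refine (s + 1) F lo hi N col1) as (F1 & HF1 & HB1); auto.
  { unfold col1. rc. }
  { intros j Hj. split; [apply HB; ml|]. unfold col1. destruct (zero_or_S j) as [->|[j' ->]].
    - exists 1. intros x Hx Hlx Hhx. rewrite ifm_t by auto. split; [ml|]. pose proof (Hul 0 Hj). ml.
    - exists (pow2 (c (j' + 1))). intros x Hx Hlx Hhx. rewrite ifm_f by apply S_neq0. split.
      + apply setc_lt. rc.
      + destruct (HB j') as (_ & _ & _ & e & Ee & He); [ml|]. rewrite Ee. eapply sparse_pow; eauto.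
        unfold lo in Hlx. ml. }
  set (rep := fun i => mub (hi i) (fun y => mem y F1 /\ c i <= y)).
  assert (Hrep : Rc rep) by (unfold rep; rc).
  assert (Hreps : forall i, i < N -> mem (rep i) F1 /\ c i <= rep i /\ rep i < hi i).
  { intros i Hi. destruct (HB1 i Hi) as [HLi _]. apply LL_nonempty in HLi as (y & Hy & Hly & Hhy).
    destruct (mub_ex (hi i) (fun y => mem y F1 /\ c i <= y) y) as [[A B] C]; [rc|auto|ml|].
    fold (rep i) in *. repeat split; auto. ml. }
  (* Upper elements may now be replaced by representatives, so the colour of [x] is a set of block
     indices below [N]; the hypothesis [pow2 N <= x] admits that many colours. *)
  set (col2 := fun j x => setc N (fun i => j < i /\ P x (rep i))).
  destruct (refine s F1 lo hi N col2) as (F2 & HF2 & HB2); auto.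
  { eapply sparse_sub; [|exact HS]. intros x Hx. apply HF1, Hx. }
  { unfold col2. rc. }
  { intros j Hj. split; [apply HB1; auto|]. exists (pow2 N). intros x Hx Hlx Hhx. split.
    - unfold col2. apply setc_lt. rc.
    - apply HF1 in Hx as [Hx _]. apply HN; auto; [pose proof (Hul j Hj)|pose proof (Hcv j Hj)]; ml. }
  exists F2, c. split; auto. split; [|split; [ml|split]].
  - intros x Hx. destruct (HF2 x Hx) as [Hx1 (j & Hj & Hl & Hh)]. apply HF1 in Hx1 as [Hx1 _].
    split; auto. pose proof (Hul j Hj). pose proof (Hcv j Hj). split; ml.
  - intros j Hj. destruct (HB j) as (A & B & _ & D); [ml|]. split; [ml|]. split; auto.
    split; [apply HB2; auto|auto].
  - intros i j x x' y y' Hij Hj Hx Hx' Hy Hy' L1 L2 L3 L4 L5 L6 L7 L8.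
    assert (Hi : i < N) by ml. destruct (Hreps j Hj) as (R1 & R2 & R3).
    assert (K : forall x y, mem x F2 -> mem y F2 -> c i <= x -> x < hi i -> c j <= y -> y < hi j ->
      (P x y <-> P x (rep j))).
    { clear x x' y y' Hx Hx' Hy Hy' L1 L2 L3 L4 L5 L6 L7 L8. intros x y Hx Hy L1 L2 L3 L4.
      destruct (HF2 x Hx) as [Hx1 _]. apply HF1 in Hx1 as [HxF _].
      destruct (HF2 y Hy) as [Hy1 _]. destruct (HB1 j Hj) as [_ HC].
      specialize (HC y (rep j) Hy1 R1 L3 L4 R2 R3). unfold col1 in HC.
      rewrite !ifm_f in HC by (intro; subst; ml).
      assert (Hxj : x < c j) by (pose proof (HD i j Hij Hj); unfold lo in *; ml).
      assert (E : forall z, mem x (setc (c j) (fun x => mem x F /\ P x z)) <-> P x z).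
      { intro z. rewrite mem_setc by rc. tauto. }
      rewrite <- (E y), HC, E. tauto. }
    rewrite (K x y), (K x' y') by auto.
    destruct (HB2 i Hi) as [_ HC]. specialize (HC x x' Hx Hx' L1 L2 L3 L4). unfold col2 in HC.
    assert (E : forall z, mem j (setc N (fun i0 => i < i0 /\ P z (rep i0))) <-> P z (rep j)).
    { intro z. rewrite mem_setc by rc. tauto. }
    rewrite <- (E x), HC, E. tauto.
Qed.
End Ramsey.

(** * Cardinalities and the finite Ramsey theorem *)

Section Count.
Context `{R : RM}.
Definition cn (b E : M) : M := msum b (fun x => ifm (mem x E) 1 0).
Lemma Rc_cn b E : Rc b -> Rc E -> Rc (fun z => cn (b z) (E z)).
Proof. intros. unfold cn. rc. Qed.
End Count.
Ltac rc_count :=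
  lazymatch goal with
  | |- Rc (fun z => cn (@?a z) (@?b z)) => apply (Rc_cn a b)
  | |- Dl (fun z => sparse (@?a z)) => apply (Dl_sparse a)
  | |- _ => rc_large
  end.
Ltac rc_user ::= rc_count.

Section FiniteRamsey.
Context `{R : RM}.
Add Ring Mring9 : M_srt.

Lemma cn_S b E : cn (b + 1) E = cn b E + ifm (mem b E) 1 0.
Proof. apply (msum_S b (fun x => ifm (mem x E) 1 0)). rc. Qed.
Lemma cn_0 E : cn 0 E = 0.
Proof. unfold cn. apply (msum_0 (fun x => ifm (mem x E) 1 0)). rc. Qed.

Lemma cn_empty b E : (forall x, ~ mem x E) -> cn b E = 0.
Proof.
  intro HN. assert (HR : Rc (fun z => cn z E)) by (apply (Rc_cn (fun z => z) (fun _ => E)); rc).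
  revert b. ind_dl; [rc|apply cn_0|]. intros b IH. rewrite cn_S, IH, ifm_f; [ring|auto].
Qed.

Lemma cn_split b E x A B : x < b -> mem x E -> ~ mem x A -> ~ mem x B ->
  (forall y, y <> x -> (mem y E <-> mem y A \/ mem y B)) -> (forall y, mem y A -> ~ mem y B) ->
  cn b E = cn b A + cn b B + 1.
Proof.
  intros Hx HE HA HB H1 H2.
  pose proof (fun E => Rc_cn (fun z => z) (fun _ => E) Rc_id (Rc_const E)) as HR.
  assert (K : forall c, (c <= x -> cn c E = cn c A + cn c B) /\ (x < c -> cn c E = cn c A + cn c B + 1)).
  { ind_dl.
    - pose proof (HR E). pose proof (HR A). pose proof (HR B). rc.
    - rewrite !cn_0. split; intro; ml.
    - intros c [I1 I2]. rewrite !cn_S. destruct (classic (c = x)) as [->|Hne].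
      + rewrite (ifm_t (mem x E)), (ifm_f (mem x A)), (ifm_f (mem x B)) by auto.
        specialize (I1 ltac:(ml)). split; intro; ml.
      + assert (EE : ifm (mem c E) 1 0 = ifm (mem c A) 1 0 + ifm (mem c B) 1 0).
        { specialize (H1 c Hne). specialize (H2 c). unfold ifm.
          repeat destruct (excluded_middle_informative _); try tauto; ring. }
        rewrite EE. destruct (lt_total c x) as [L|[L|L]]; [|contradiction|].
        * specialize (I1 ltac:(ml)). split; intro; ml.
        * specialize (I2 L). split; intro; ml. }
  apply K, Hx.
Qed.

Variable Q : M -> M -> Prop.
Hypothesis HQ : Dl (fun w => Q (fst w) (snd w)).

Definition homg (Q : M -> M -> Prop) (H : M) : Prop :=
  forall x, x < H -> forall y, y < H -> mem x H -> mem y H -> x < y -> Q x y.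
Lemma homg_iff Q' H : homg Q' H <-> forall x y, mem x H -> mem y H -> x < y -> Q' x y.
Proof. unfold homg. split; intros HH x y; intros; apply HH; auto using mem_lt. Qed.

Lemma cn_add1 b H x H' : x < b -> ~ mem x H -> (forall y, mem y H' <-> y = x \/ mem y H) -> cn b H' = cn b H + 1.
Proof.
  intros Hx Hn HE. rewrite (cn_split b H' x H (setc 0 (fun _ => False))); auto.
  - rewrite (cn_empty b (setc 0 (fun _ => False))); [ring|]. intro y. rewrite mem_setc by rc. tauto.
  - apply HE. auto.
  - rewrite mem_setc by rc. tauto.
  - intros y Hy. rewrite HE, mem_setc by rc. tauto.
  - intros y _. rewrite mem_setc by rc. tauto.
Qed.

(** Induction on [n], splitting the other elements by their colour with the least one and adjoining
    that element on the matching side. The split of [n] into [a] and the rest records which colour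
    is to gain. The bound on [H] makes the statement Pi^0_1. *)
Lemma finite_ramsey B : forall n E, E < pow2 B -> pow2 n <= cn B E -> forall a, a <= n ->
  exists H, H < pow2 B /\ ((forall x, x < H -> mem x H -> mem x E) /\
   ((a <= cn B H /\ homg Q H) \/ (n <= a + cn B H /\ homg (fun x y => ~ Q x y) H))).
Proof.
  pose proof (Rc_cn fst snd Rc_fst Rc_snd) as HR.
  ind_pi.
  - apply (Sg_ext (fun n => exists E, ~ (E < pow2 B -> pow2 n <= cn B E -> forall a, a <= n ->
      exists H, H < pow2 B /\ ((forall x, x < H -> mem x H -> mem x E) /\
      ((a <= cn B H /\ homg Q H) \/ (n <= a + cn B H /\ homg (fun x y => ~ Q x y) H)))))).
    + intro n. split; [intros [E HE] HA; apply HE, HA|]. intro HN. apply not_all_ex_not, HN.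
    + apply Sg_ex, Sg_Dl. unfold homg. rc.
  - intros E HE HC a Ha. exists 0. split; [pose proof (pow2_pos B); ml|].
    split; [intros x Hx; destruct (nlt0 _ Hx)|]. left. split; [ml|]. intros x Hx. destruct (nlt0 _ Hx).
  - intros n IH E HE HC a Ha. rewrite pow2_S in HC.
    assert (H0 : exists H, H < pow2 B /\ (forall x, ~ mem x H)).
    { exists 0. split; [pose proof (pow2_pos B); ml|]. intros x Hx. apply mem_lt in Hx. exact (nlt0 _ Hx). }
    destruct (zero_or_S a) as [->|[a' ->]].
    { destruct H0 as (H & A & C). exists H. split; auto. split; [intros x _ Hx; destruct (C x Hx)|].
      left. split; [ml|]. intros x _ y _ Hx. destruct (C x Hx). }
    destruct (classic (a' = n)) as [->|Hne].
    { destruct H0 as (H & A & C). exists H. split; auto. split; [intros x _ Hx; destruct (C x Hx)|].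
      right. split; [ml|]. intros x _ y _ Hx. destruct (C x Hx). }
    assert (Ha' : a' + 1 <= n) by (destruct (lt_total a' n) as [|[|]]; [ml|contradiction|ml]).
    assert (Hex : exists x, mem x E).
    { apply NNPP. intro HN. rewrite cn_empty in HC by (intros x Hx; apply HN; eauto).
      pose proof (pow2_pos n). ml. }
    destruct (least (fun x => mem x E)) as (x & Hx & Hmin); [rc|auto|].
    assert (HxB : x < B) by (eapply mem_bound; eauto).
    set (A := setc B (fun y => mem y E /\ x < y /\ Q x y)).
    set (C := setc B (fun y => mem y E /\ x < y /\ ~ Q x y)).
    assert (HA : forall y, mem y A <-> y < B /\ mem y E /\ x < y /\ Q x y).
    { intro y. unfold A. rewrite mem_setc; [tauto|rc]. }
    assert (HCm : forall y, mem y C <-> y < B /\ mem y E /\ x < y /\ ~ Q x y).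
    { intro y. unfold C. rewrite mem_setc; [tauto|rc]. }
    assert (HAb : A < pow2 B) by (apply setc_lt; rc).
    assert (HCb : C < pow2 B) by (apply setc_lt; rc).
    rewrite (cn_split B E x A C) in HC; auto.
    2:{ rewrite HA. intros (_ & _ & L & _). exact (lt_irrefl _ L). }
    2:{ rewrite HCm. intros (_ & _ & L & _). exact (lt_irrefl _ L). }
    2:{ intros y Hy. rewrite HA, HCm. split; [|tauto]. intro Hm.
        assert (y < B) by (apply (mem_bound y B E); auto).
        assert (x < y). { destruct (lt_total x y) as [|[|L]]; auto; [congruence|]. destruct (Hmin y L Hm). }
        tauto. }
    2:{ intros y. rewrite HA, HCm. tauto. }
    assert (Hadd : forall H, H < pow2 B -> (forall y, y < H -> mem y H -> x < y) -> exists H', H' < pow2 B /\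
      (forall y, mem y H' <-> y = x \/ mem y H) /\ cn B H' = cn B H + 1).
    { intros H HHb HHx. exists (setc B (fun y => y = x \/ mem y H)).
      assert (HH' : forall y, mem y (setc B (fun y => y = x \/ mem y H)) <-> y = x \/ mem y H).
      { intro y. rewrite mem_setc by rc. split; [tauto|]. intro Hy. split; auto.
        destruct Hy as [->|Hy]; auto. eapply mem_bound; eauto. }
      split; [apply setc_lt; rc|]. split; auto. apply (cn_add1 B H x); auto.
      intro Hm. apply (lt_irrefl x). apply HHx; auto. apply mem_lt, Hm. }
    (* The two halves together have at least 2^(n+1) - 1 elements, so one of them has at least
       2^n. *)
    destruct (classic (pow2 n <= cn B A)) as [Hbig|Hsm].
    + destruct (IH A HAb Hbig a') as (H & HHb & HHA & [[K1 K2]|[K1 K2]]); [ml| |].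
      * destruct (Hadd H HHb) as (H' & HHb' & HH' & Ec).
        { intros y Hy Hm. apply HHA in Hm; auto. apply HA in Hm. tauto. }
        exists H'. split; auto. split.
        { intros y _ Hy. apply HH' in Hy as [->|Hy]; auto. apply HHA in Hy; [|apply mem_lt, Hy]. apply HA in Hy; tauto. }
        left. split; [rewrite Ec; ml|]. apply homg_iff. intros y z Hy Hz Hyz. apply HH' in Hy, Hz.
        destruct Hy as [->|Hy]; destruct Hz as [->|Hz].
        -- destruct (lt_irrefl _ Hyz).
        -- apply HHA in Hz; [|apply mem_lt, Hz]. apply HA in Hz. tauto.
        -- exfalso. apply HHA in Hy; [|apply mem_lt, Hy]. apply HA in Hy. ml.
        -- exact (proj1 (homg_iff Q H) K2 y z Hy Hz Hyz).
      * exists H. split; auto. split.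
        { intros y Hl Hy. apply HHA in Hy; auto. apply HA in Hy; tauto. }
        right. split; auto. ml.
    + destruct (IH C HCb ltac:(ml) (a' + 1)) as (H & HHb & HHA & [[K1 K2]|[K1 K2]]); [ml| |].
      * exists H. split; auto. split.
        { intros y Hl Hy. apply HHA in Hy; auto. apply HCm in Hy; tauto. }
        left. auto.
      * destruct (Hadd H HHb) as (H' & HHb' & HH' & Ec).
        { intros y Hy Hm. apply HHA in Hm; auto. apply HCm in Hm. tauto. }
        exists H'. split; auto. split.
        { intros y _ Hy. apply HH' in Hy as [->|Hy]; auto. apply HHA in Hy; [|apply mem_lt, Hy]. apply HCm in Hy; tauto. }
        right. split; [rewrite Ec; ml|]. apply homg_iff. intros y z Hy Hz Hyz. apply HH' in Hy, Hz.
        destruct Hy as [->|Hy]; destruct Hz as [->|Hz].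
        -- destruct (lt_irrefl _ Hyz).
        -- apply HHA in Hz; [|apply mem_lt, Hz]. apply HCm in Hz. tauto.
        -- exfalso. apply HHA in Hy; [|apply mem_lt, Hy]. apply HCm in Hy. ml.
        -- exact (proj1 (homg_iff (fun x y => ~ Q x y) H) K2 y z Hy Hz Hyz).
Qed.

Lemma cn_mono H x y : x <= y -> cn x H <= cn y H.
Proof.
  intro L. apply le_iff in L as [d ->]. assert (HRE : Rc (fun z => cn z H)) by (apply (Rc_cn (fun z => z) (fun _ => H)); rc).
  revert d. ind_dl; [rc|rewrite add_0_r; ml|]. intros d IH.
  replace (x + (d + 1)) with (x + d + 1) by ring. rewrite cn_S. ml.
Qed.

Lemma enumerate B H : exists h, Rc h /\
  (forall j, j < cn B H -> mem (h j) H /\ h j < B) /\ (forall i j, i < j -> j < cn B H -> h i < h j).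
Proof.
  assert (HRE : Rc (fun z => cn z H)) by (apply (Rc_cn (fun z => z) (fun _ => H)); rc).
  set (h := fun j => mub B (fun x => mem x H /\ cn x H = j)).
  assert (Hh : forall j, j < cn B H -> mem (h j) H /\ h j < B /\ cn (h j) H = j).
  { intros j Hj. destruct (least (fun y => j < cn y H)) as (y & Hy & Hm); [rc|eauto|].
    destruct (zero_or_S y) as [->|[x ->]]; [rewrite cn_0 in Hy; destruct (nlt0 _ Hy)|].
    pose proof (Hm x ltac:(ml)) as Hx. rewrite cn_S in Hy.
    destruct (classic (mem x H)) as [Hmx|Hmx]; [rewrite ifm_t in Hy by auto|rewrite ifm_f in Hy by auto; ml].
    assert (Ec : cn x H = j) by ml.
    assert (HxB : x < B). { apply NNPP. intro Hn. apply nlt_le in Hn. pose proof (cn_mono H _ _ Hn). ml. }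
    destruct (mub_ex B (fun x => mem x H /\ cn x H = j) x) as [[A1 A2] A3]; [rc|auto|ml|].
    fold (h j) in *. repeat split; auto. ml. }
  exists h. split; [unfold h; rc|]. split; [intros j Hj; destruct (Hh j Hj); tauto|].
  intros i j Hij Hj. destruct (Hh i) as (_ & _ & E1); [ml|]. destruct (Hh j Hj) as (_ & _ & E2).
  apply NNPP. intro Hn. apply nlt_le in Hn. pose proof (cn_mono H _ _ Hn). ml.
Qed.
End FiniteRamsey.

(** * Chains of blocks and Ramsey's theorem for large sets *)

Section Chain.
Context `{R : RM}.
Add Ring Mring10 : M_srt.

(** Colours are fixed only between different blocks; inside a block the induction hypothesis of the
    Ramsey theorem will be applied. The condition on [hi 0] is the one under which [large_blocks]
    gains an exponent. *)
Definition chain (Q : M -> M -> Prop) (s F u v G : M) (lo hi : M -> M) (h : M) : Prop :=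
  Rc lo /\ Rc hi /\ (forall x, mem x G -> mem x F /\ u <= x /\ x < v) /\
  (forall j, j <= h -> LL s G (lo j) (hi j) /\ u <= lo j /\ hi j <= v) /\
  (forall i j, i < j -> j <= h -> hi i <= lo j) /\ hi 0 <= h + 1 /\
  (forall i j x y, i < j -> j <= h -> mem x G -> mem y G ->
    lo i <= x -> x < hi i -> lo j <= y -> y < hi j -> Q x y).

Lemma chain_cons (Q : M -> M -> Prop) s F u v W l0 h0 G lo hi m : Rc lo -> Rc hi ->
  LL s W l0 h0 -> (forall x, mem x W -> l0 <= x -> x < h0 -> mem x F) -> u <= l0 -> l0 <= h0 -> h0 <= v -> h0 <= m + 1 ->
  (forall x, mem x G -> mem x F /\ u <= x /\ x < v) ->
  (forall j, j < m -> LL s G (lo j) (hi j) /\ h0 <= lo j /\ hi j <= v) ->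
  (forall i j, i < j -> j < m -> hi i <= lo j) ->
  (forall j x y, j < m -> mem x W -> mem y G -> l0 <= x -> x < h0 -> lo j <= y -> y < hi j -> Q x y) ->
  (forall i j x y, i < j -> j < m -> mem x G -> mem y G ->
    lo i <= x -> x < hi i -> lo j <= y -> y < hi j -> Q x y) ->
  exists G' lo' hi' h, chain Q s F u v G' lo' hi' h.
Proof.
  intros Hlo Hhi HLW HWF Hul Hlh Hhv Hm HG HB HD HQ0 HQ.
  set (G' := setc v (fun x => (mem x W /\ l0 <= x /\ x < h0) \/ (mem x G /\ h0 <= x))).
  assert (HG' : forall x, mem x G' <-> x < v /\ ((mem x W /\ l0 <= x /\ x < h0) \/ (mem x G /\ h0 <= x))).
  { intro x. unfold G'. rewrite mem_setc; [tauto|rc]. }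
  set (lo' := fun j => ifm (j = 0) l0 (lo (msub j 1))).
  set (hi' := fun j => ifm (j = 0) h0 (hi (msub j 1))).
  assert (Elo : forall j, lo' (j + 1) = lo j).
  { intro j. unfold lo'. rewrite ifm_f by apply S_neq0. f_equal.
    destruct (msub_spec (j + 1) 1) as [_ E]. specialize (E ltac:(ml)). ml. }
  assert (Ehi : forall j, hi' (j + 1) = hi j).
  { intro j. unfold hi'. rewrite ifm_f by apply S_neq0. f_equal.
    destruct (msub_spec (j + 1) 1) as [_ E]. specialize (E ltac:(ml)). ml. }
  assert (Elo0 : lo' 0 = l0) by (apply ifm_t; auto). assert (Ehi0 : hi' 0 = h0) by (apply ifm_t; auto).
  exists G', lo', hi', m. unfold chain. split; [unfold lo'; rc|]. split; [unfold hi'; rc|].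
  split; [|split; [|split; [|split]]].
  - intros x Hx. apply HG' in Hx as [Hv [(A & B & C)|[A B]]]; [|apply HG; auto].
    split; auto. split; auto. ml.
  - intros j Hj. destruct (zero_or_S j) as [->|[j' ->]].
    + rewrite Elo0, Ehi0. split; auto. apply (LL_mono _ _ _ _ _ _ _ HLW). intros x A B C.
      repeat split; auto. apply HG'. split; [ml|auto].
    + rewrite Elo, Ehi. destruct (HB j') as (A & B & C); [ml|]. split; [|split; [ml|auto]].
      apply (LL_mono _ _ _ _ _ _ _ A). intros x A1 B1 C1. repeat split; auto. apply HG'. split; [ml|].
      right. split; auto. ml.
  - intros i j Hij Hj. destruct (zero_or_S j) as [->|[j' ->]]; [destruct (nlt0 _ Hij)|]. rewrite Elo.
    destruct (zero_or_S i) as [->|[i' ->]].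
    + rewrite Ehi0. apply HB. ml.
    + rewrite Ehi. apply HD; ml.
  - rewrite Ehi0. ml.
  - intros i j x y Hij Hj Hx Hy L1 L2 L3 L4. apply HG' in Hx as [_ Hx], Hy as [_ Hy].
    destruct (zero_or_S j) as [->|[j' ->]]; [destruct (nlt0 _ Hij)|]. rewrite Elo, Ehi in *.
    destruct (HB j') as (_ & B & _); [ml|].
    assert (HyG : mem y G). { destruct Hy as [(_ & _ & Hy)|[Hy _]]; auto. exfalso; ml. }
    destruct (zero_or_S i) as [->|[i' ->]].
    + rewrite Elo0, Ehi0 in *. apply (HQ0 j' x y); auto; [ml|]. destruct Hx as [(Hx & _)|[_ Hx]]; auto. exfalso; ml.
    + rewrite Elo, Ehi in *. destruct (HB i') as (_ & B' & _); [ml|].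
      apply (HQ i' j'); auto; [ml|ml|]. destruct Hx as [(_ & _ & Hx)|[Hx _]]; auto. exfalso; ml.
Qed.

Lemma cn_full N : cn N (setc N (fun _ => True)) = N.
Proof.
  assert (K : forall b, b <= N -> cn b (setc N (fun _ => True)) = b); [|apply K; ml].
  ind_dl; [rc|intros _; apply cn_0|]. intros b IH Hb. rewrite cn_S, IH, ifm_t by (try (apply mem_setc; [rc|]; split; auto); ml).
  reflexivity.
Qed.

Definition Pb (P : M -> M -> Prop) (b : bool) (x y : M) : Prop := if b then P x y else ~ P x y.
Lemma Pb_iff P b x y x' y' : (P x y <-> P x' y') -> (Pb P b x y <-> Pb P b x' y').
Proof. destruct b; simpl; tauto. Qed.
Lemma Pb_not P b x y : ~ Pb P b x y -> Pb P (negb b) x y.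
Proof. destruct b; simpl; tauto. Qed.

Variable P : M -> M -> Prop.
Hypothesis HP : Dl (fun w => P (fst w) (snd w)).

(** One exponent yields two blocks, the other a pigeonhole in each. In the second block the colour
    towards all of the first is made independent of the upper element; in the first, the colour
    towards one representative [r] of the second is then made constant. The latter has two colours,
    whence [1 + 1 <= u]. *)
Lemma head_and_tail k F u v : sparse F -> 1 + 1 <= u -> LL (k + 1 + 1) F u v ->
  exists b l0 h0 h1 G0 Y, u <= l0 /\ l0 <= h0 /\ h0 <= h1 /\ h1 <= v /\ 1 <= h0 /\
  LL k G0 l0 h0 /\ LL k Y h0 h1 /\ (forall x, mem x G0 -> mem x F) /\ (forall x, mem x Y -> mem x F) /\
  (forall y, mem y F -> h0 <= y -> pow2 h0 <= y) /\
  (forall x y, mem x G0 -> l0 <= x -> x < h0 -> mem y Y -> h0 <= y -> y < h1 -> Pb P b x y).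
Proof.
  intros HS Hu HL.
  destruct (block_split _ F u v ltac:(ml) HL) as (x0 & c & Hc & Hx0 & Hux0 & Hx0v & Hc0 & _ & HB).
  destruct (HB 0) as (A1 & A2 & A3 & e & A4 & A5); [ml|].
  destruct (HB (0 + 1)) as (B1 & B2 & B3 & _); [ml|].
  set (c1 := c (0 + 1)) in *. set (c2 := c (0 + 1 + 1)) in *.
  assert (Hpow : forall y, mem y F -> c1 <= y -> pow2 c1 <= y).
  { intros y Hy Hl. rewrite A4 in *. eapply sparse_pow; eauto. ml. }
  destruct (pigeonhole k F c1 c2 (fun y => setc c1 (fun x => mem x F /\ P x y)) (pow2 c1) B3) as (cy & _ & HY).
  { rc. }
  { intros x Hx Hl Hh. split; [apply setc_lt; rc|auto]. }
  { intros x y Hx Hy _ _ Hxy. eapply sparse_sq; eauto. }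
  set (Y := setc c2 (fun y => mem y F /\ setc c1 (fun x => mem x F /\ P x y) = cy)) in *.
  assert (EY : forall y, mem y Y -> mem y F /\ setc c1 (fun x => mem x F /\ P x y) = cy).
  { intros y Hy. unfold Y in Hy. rewrite mem_setc in Hy; [tauto|rc]. }
  destruct (LL_nonempty _ _ _ _ HY) as (r & Hr & Hr1 & Hr2).
  destruct (pigeonhole k F (c 0) c1 (fun x => ifm (P x r) 0 1) (1 + 1) A3) as (c' & _ & HG).
  { rc. }
  { intros x Hx Hl Hh. rewrite Hc0 in Hl. split; [unfold ifm; destruct (excluded_middle_informative _); ml|ml]. }
  { intros x y Hx Hy _ _ Hxy. eapply sparse_sq; eauto. }
  set (G0 := setc c1 (fun x => mem x F /\ ifm (P x r) 0 1 = c')) in *.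
  assert (EG : forall x, mem x G0 -> mem x F /\ ifm (P x r) 0 1 = c').
  { intros x Hx. unfold G0 in Hx. rewrite mem_setc in Hx; [tauto|rc]. }
  exists (if excluded_middle_informative (c' = 0) then true else false), (c 0), c1, c2, G0, Y.
  repeat (split; [solve [auto | ml | apply EG | apply EY]|]).
  intros x y Hx Hl Hh Hy Hly Hhy. apply EG in Hx as [HxF Ex]. apply EY in Hy as [HyF Ey]. apply EY in Hr as [HrF Er].
  assert (E : forall z, mem x (setc c1 (fun x => mem x F /\ P x z)) <-> P x z).
  { intro z. rewrite mem_setc by rc. tauto. }
  assert (Exy : P x y <-> P x r) by (rewrite <- (E y), Ey, <- Er, E; tauto).
  assert (E01 : s_one rA <> 0). { intro E0. apply (S_neq0 0). rewrite add_0_l. exact E0. }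
  destruct (excluded_middle_informative (c' = 0)) as [Z|Z]; simpl; rewrite Exy;
    destruct (classic (P x r)) as [HPx|HPx]; auto; exfalso.
  - rewrite ifm_f in Ex by auto. apply E01. congruence.
  - rewrite ifm_t in Ex by auto. congruence.
Qed.

(** The colour of the chain cannot be chosen in advance, so a head is kept ready for either colour.
    [G0] has colour [b0] with the whole tail. If all pairs of groups in the tail have colour [b0]
    too, they continue [G0]. Otherwise some group [i] has the other colour with a later group [j];
    inside group [j] finite Ramsey produces many subgroups of one colour, preceded by [G0] or by
    group [i] as that colour requires. The cost is 2 for [head_and_tail] and 3 for each of the two
    groupings. *)
Lemma homogeneous_chain s F u v : sparse F -> 1 + 1 <= u ->
  LL (s + 1 + 1 + 1 + 1 + 1 + 1 + 1 + 1) F u v ->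
  exists b G lo hi h, chain (Pb P b) s F u v G lo hi h.
Proof.
  intros HS Hu HL.
  destruct (head_and_tail _ F u v HS Hu HL)
    as (b0 & l0 & h0 & h1 & G0 & Y & C1 & C2 & C3 & C4 & C5 & HLG & HLY & HGF & HYF & Hpow & Hcol).
  assert (HSY : sparse Y) by (eapply sparse_sub; eauto).
  destruct (uniform_grouping P HP _ Y h0 h1 h0 HSY C5 HLY) as (F2 & d & Hd & HF2 & Hd0 & HB2 & HU2).
  { intros x Hx Hl Hh. auto. }
  assert (Hdm : forall i j, i <= j -> j <= h0 -> d i <= d j).
  { apply incr_mono; auto. intros j Hj. apply HB2, Hj. }
  assert (HLG' : LL s G0 l0 h0) by (eapply LL_exp; [|exact HLG]; ml).
  destruct (classic (forall i j x y, i < j -> j < h0 -> mem x F2 -> mem y F2 ->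
    d i <= x -> x < d (i + 1) -> d j <= y -> y < d (j + 1) -> Pb P b0 x y)) as [HA|HA].
  - exists b0. apply (chain_cons (Pb P b0) s F u v G0 l0 h0 F2 d (fun j => d (j + 1)) h0); auto; try ml; try rc.
    + intros x Hx. apply HF2 in Hx as (A & B & C). split; [auto|ml].
    + intros j Hj. destruct (HB2 j Hj) as (A & B & C & _). split; [|split; [|ml]].
      * eapply LL_exp; [|exact C]; ml.
      * pose proof (Hdm 0 j ltac:(ml) ltac:(ml)). ml.
    + intros i j Hi Hj. apply Hdm; ml.
    + intros j x y Hj Hx Hy L1 L2 L3 L4. destruct (HF2 y Hy) as (A & B & C). auto.
  - assert (HE : exists i j x y, i < j /\ j < h0 /\ mem x F2 /\ mem y F2 /\
      d i <= x /\ x < d (i + 1) /\ d j <= y /\ y < d (j + 1) /\ ~ Pb P b0 x y).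
    { apply NNPP. intro HN. apply HA. intros i j x y. intros. apply NNPP. intro. apply HN. exists i, j, x, y. tauto. }
    clear HA. destruct HE as (i & j & x1 & y1 & Hij & Hj & Hx1 & Hy1 & L1 & L2 & L3 & L4 & HPn).
    assert (Hcol2 : forall x y, mem x F2 -> mem y F2 -> d i <= x -> x < d (i + 1) -> d j <= y -> y < d (j + 1) ->
      Pb P (negb b0) x y).
    { intros x y Hx Hy L5 L6 L7 L8. apply Pb_not. rewrite (Pb_iff P b0 x y x1 y1); auto.
      apply (HU2 i j); auto. }
    clear HPn x1 y1 Hx1 Hy1 L1 L2 L3 L4.
    assert (Hi : i < h0) by ml.
    destruct (HB2 i Hi) as (I1 & I2 & I3 & e & I4 & I5). destruct (HB2 j Hj) as (J1 & J2 & J3 & _).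
    (* [m] bounds the ends of both possible heads, so [m] further groups suffice for a chain, and
       2^(2m) groups guarantee [m] homogeneous ones. *)
    set (m := d (i + 1)) in *. set (N := pow2 (m + m)).
    assert (Hmj : m <= d j) by (apply Hdm; ml).
    assert (Hd0i : d 0 <= d i) by (apply Hdm; ml).
    assert (HS2 : sparse F2). { eapply sparse_sub; [|exact HSY]. intros x Hx. apply HF2, Hx. }
    destruct (uniform_grouping P HP _ F2 (d j) (d (j + 1)) N HS2 ltac:(ml) J3) as (F3 & d' & Hd' & HF3 & Hd0' & HB3 & HU3).
    { intros x Hx Hl Hh. apply HF2 in Hx as (A & B & C). unfold N. change (gr m <= x). rewrite I4 in *.
      apply (sparse_gr Y e x); auto. ml. }
    assert (Hdm' : forall i j, i <= j -> j <= N -> d' i <= d' j).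
    { apply incr_mono; auto. intros j' Hj'. apply HB3, Hj'. }
    set (rep := fun a => mub (d' (a + 1)) (fun y => mem y F3 /\ d' a <= y)).
    assert (Hrep : Rc rep) by (unfold rep; rc).
    assert (Hreps : forall a, a < N -> mem (rep a) F3 /\ d' a <= rep a /\ rep a < d' (a + 1)).
    { intros a Ha. destruct (HB3 a Ha) as (_ & _ & HLa & _). apply LL_nonempty in HLa as (y & Hy & Hly & Hhy).
      destruct (mub_ex (d' (a + 1)) (fun y => mem y F3 /\ d' a <= y) y) as [[A B] C]; [rc|auto|ml|].
      fold (rep a) in *. repeat split; auto. ml. }
    destruct (finite_ramsey (fun a c => P (rep a) (rep c)) ltac:(rc) N (m + m) (setc N (fun _ => True))) with (a := m)
      as (H & HHb & _ & HH); [apply setc_lt; rc|rewrite cn_full; unfold N; ml|ml|].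
    assert (HH' : exists b3, m <= cn N H /\ forall a c, mem a H -> mem c H -> a < c -> Pb P b3 (rep a) (rep c)).
    { destruct HH as [[K1 K2]|[K1 K2]]; [exists true|exists false]; (split; [ml|]); exact (proj1 (homg_iff _ H) K2). }
    clear HH. destruct HH' as (b3 & Hcm & Hhom).
    destruct (enumerate N H) as (f & Hf & Hf1 & Hf2).
    assert (HfN : forall a, a < m -> f a < N) by (intros a Ha; apply Hf1; ml).
    assert (Hfin : forall W l1 g1, LL s W l1 g1 -> (forall x, mem x W -> l1 <= x -> x < g1 -> mem x F) ->
      u <= l1 -> l1 <= g1 -> g1 <= v -> g1 <= m ->
      (forall x y, mem x W -> l1 <= x -> x < g1 -> mem y F2 -> d j <= y -> y < d (j + 1) -> Pb P b3 x y) ->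
      exists G lo hi h, chain (Pb P b3) s F u v G lo hi h).
    { intros W l1 g1 HLW HWF W1 W2 W3 W4 HWc.
      apply (chain_cons (Pb P b3) s F u v W l1 g1 F3 (fun a => d' (f a)) (fun a => d' (f a + 1)) m); auto; try ml; try rc.
      - intros x Hx. apply HF3 in Hx as (A & B & C). apply HF2 in A as (A & _). split; auto. ml.
      - intros a Ha. specialize (HfN a Ha). destruct (HB3 (f a) HfN) as (A & B & C & _).
        split; auto. pose proof (Hdm' 0 (f a) ltac:(ml) ltac:(ml)). split; ml.
      - intros a c Hac Hc. specialize (Hf2 a c Hac ltac:(ml)). specialize (HfN c Hc). apply Hdm'; ml.
      - intros a x y Ha Hx Hy L1 L2 L3 L4. destruct (HF3 y Hy) as (A & B & C). auto.
      - intros a c x y Hac Hc Hx Hy L1 L2 L3 L4.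
        pose proof (Hf2 a c Hac ltac:(ml)) as Hlt. pose proof (HfN c Hc) as HcN. pose proof (HfN a ltac:(ml)) as HaN.
        destruct (Hf1 a) as [Hma _]; [ml|]. destruct (Hf1 c) as [Hmc _]; [ml|].
        destruct (Hreps _ HaN) as (A1 & A2 & A3). destruct (Hreps _ HcN) as (B1 & B2 & B3).
        rewrite (Pb_iff P b3 x y (rep (f a)) (rep (f c))); [apply Hhom; auto|].
        apply (HU3 (f a) (f c)); auto. }
    exists b3. destruct (Bool.bool_dec b3 b0) as [->|Hne].
    + apply (Hfin G0 l0 h0); auto; try ml. intros x y Hx L1 L2 Hy L3 L4. destruct (HF2 y Hy) as (A & B & C). auto.
    + assert (Eb : b3 = negb b0) by (destruct b3, b0; simpl; congruence). subst b3.
      apply (Hfin F2 (d i) m); auto; try ml.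
      * eapply LL_exp; [|exact I3]; ml.
      * intros x Hx _ _. apply HYF. apply (HF2 x Hx).
Qed.

Lemma assemble (Q : M -> M -> Prop) s k F u v G lo hi h : Dl (fun w => Q (fst w) (snd w)) ->
  chain Q s F u v G lo hi h ->
  (forall j, j <= h -> exists H, (forall x, x < H -> mem x H -> mem x G /\ lo j <= x /\ x < hi j) /\
     homg Q H /\ LL k H (lo j) (hi j)) ->
  exists H, H < pow2 v /\ (forall x, x < H -> mem x H -> mem x F /\ u <= x /\ x < v) /\ homg Q H /\ LL (k + 1) H u v.
Proof.
  intros HQ (Hlo & Hhi & HGF & HB & HD & Hh & HC) HE.
  destruct (select (fun j H => homg Q H /\ LL k H (lo j) (hi j)) G lo hi (h + 1)) as (F' & Hs & H1 & H2 & H3 & H4 & H5).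
  - unfold homg. rc.
  - exact Hlo.
  - exact Hhi.
  - intros i j Hij Hj. apply HD; auto.
  - intros j Hj. destruct (HE j Hj) as (H & A & B & C). exists H. auto.
  - set (F'' := setc v (fun x => mem x F')).
    assert (HF'' : forall x, mem x F'' <-> x < v /\ mem x F') by (intro x; unfold F''; rewrite mem_setc; [tauto|rc]).
    exists F''. split; [apply setc_lt; rc|]. split; [|split].
    + intros x _ Hx. apply HF'' in Hx as [_ Hx]. apply H3 in Hx as [Hx _]. auto.
    + apply homg_iff. intros x y Hx Hy Hxy. apply HF'' in Hx as [_ Hx], Hy as [_ Hy].
      destruct (H3 x Hx) as [HxG (i & Hi & Hxi)]. destruct (H3 y Hy) as [HyG (j & Hj & Hyj)].
      destruct (H4 i x Hi Hxi) as (_ & X1 & X2). destruct (H4 j y Hj Hyj) as (_ & Y1 & Y2).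
      destruct (lt_total i j) as [L|[->|L]].
      * apply (HC i j); auto.
      * destruct (H2 j Hj) as [A _]. exact (proj1 (homg_iff Q (Hs j)) A x y Hxi Hyj Hxy).
      * exfalso. pose proof (HD j i L Hi). ml.
    + apply (large_blocks k F'' u v lo hi h); auto; [|intros j Hj; apply HD; ml].
      intros j Hj. destruct (HB j Hj) as (A & B & C). split; auto.
      destruct (H2 j Hj) as [_ HL]. apply (LL_mono _ _ _ _ _ _ _ HL). intros x X1 X2 X3. repeat split; auto.
      apply HF''. split; [ml|]. apply (H4 j x Hj X1).
Qed.

Definition ex8 (n : M) : M := n * (1 + 1 + 1 + 1 + 1 + 1 + 1 + 1).
(** The bound [H < pow2 v] makes this recursive in all arguments, so that its universal closure over
    [F], [u], [v] allows Pi^0_1 induction on [n]. *)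
Definition ramseyP (n F u v : M) : Prop :=
  sparse F -> 1 + 1 <= u -> LL (ex8 n) F u v -> forall k, k <= n -> exists H, H < pow2 v /\
    ((forall x, x < H -> mem x H -> mem x F /\ u <= x /\ x < v) /\
     ((homg P H /\ LL k H u v) \/ (homg (fun x y => ~ P x y) H /\ LL (msub n k) H u v))).

(** Take a chain of colour [b] and apply the induction hypothesis in every block, with the target
    for colour [b] lowered by one. If some block yields the other colour, its set has the full
    exponent required for that colour. Otherwise all blocks yield colour [b], and [assemble] joins
    them to a set with one more exponent. *)
Theorem ramsey_large : forall n F u v, ramseyP n F u v.
Proof.
  assert (Hsing : forall F u v e, LL e F u v -> exists H, H < pow2 v /\
    (forall x, x < H -> mem x H -> mem x F /\ u <= x /\ x < v) /\ (forall Q, homg Q H) /\ LL 0 H u v).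
  { intros F u v e HL. apply LL_nonempty in HL as (x & Hx & Hu & Hv).
    assert (HH : forall y, mem y (setc v (fun y => y = x)) <-> y = x).
    { intro y. rewrite mem_setc by rc. split; [tauto|intros ->; auto]. }
    exists (setc v (fun y => y = x)). split; [apply setc_lt; rc|]. split; [|split].
    - intros y _ Hy. apply HH in Hy as ->. auto.
    - intro Q. apply homg_iff. intros y z Hy Hz Hyz. apply HH in Hy as ->. apply HH in Hz as ->. destruct (lt_irrefl _ Hyz).
    - apply (LL_zero _ _ _ x); auto. apply HH; auto. }
  assert (HPn : Dl (fun w => ~ P (fst w) (snd w))) by rc.
  assert (msub0 : forall a, msub a a = 0).
  { intro a. destruct (msub_spec a a) as [_ E]. specialize (E ltac:(ml)). ml. }
  ind_pi.
  - apply (Sg_ext (fun n => exists w, ~ ramseyP n (fst w) (fst (snd w)) (snd (snd w)))).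
    + intro n. split.
      * intros [w Hw] HA. apply Hw, HA.
      * intro HN. apply NNPP. intro HE. apply HN. intros F u v. apply NNPP. intro Hn. apply HE.
        exists (pr F (pr u v)). now rewrite fst_pr, snd_pr, fst_pr, snd_pr.
    + apply Sg_ex, Sg_Dl. unfold ramseyP, homg, ex8. rc.
  - intros F u v HS Hu HL k Hk. destruct (Hsing F u v _ HL) as (H & A & B & C & D).
    exists H. split; auto. split; auto. left. split; auto. assert (k = 0) by ml. subst k. exact D.
  - intros n IH F u v HS Hu HL k Hk.
    (* For [k = 0] and for [k = n + 1] one of the two exponents is 0, and a singleton suffices. *)
    destruct (zero_or_S k) as [->|[k' ->]].
    { destruct (Hsing F u v _ HL) as (H & A & B & C & D). exists H. split; auto. }
    destruct (classic (k' = n)) as [->|Hne].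
    { destruct (Hsing F u v _ HL) as (H & A & B & C & D). exists H. split; auto. split; auto. right.
      rewrite msub0. auto. }
    assert (Hk' : k' + 1 <= n) by (destruct (lt_total k' n) as [|[|]]; [ml|contradiction|ml]).
    assert (Em : msub (n + 1) (k' + 1) = msub n k').
    { destruct (msub_spec (n + 1) (k' + 1)) as [_ E1]. destruct (msub_spec n k') as [_ E2].
      specialize (E1 ltac:(ml)). specialize (E2 ltac:(ml)). ml. }
    assert (Em' : msub (n + 1) (k' + 1) = msub n (k' + 1) + 1).
    { destruct (msub_spec (n + 1) (k' + 1)) as [_ E1]. destruct (msub_spec n (k' + 1)) as [_ E2].
      specialize (E1 ltac:(ml)). specialize (E2 ltac:(ml)). ml. }
    replace (ex8 (n + 1)) with (ex8 n + 1 + 1 + 1 + 1 + 1 + 1 + 1 + 1) in HL by (unfold ex8; ring).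
    destruct (homogeneous_chain _ F u v HS Hu HL) as (b & G & lo & hi & h & HCh).
    pose proof HCh as (Hlo & Hhi & HGF & HB & HD & Hh & HC).
    assert (HSG : sparse G). { eapply sparse_sub; [|exact HS]. intros x Hx. apply HGF, Hx. }
    assert (Hblk : forall j, j <= h -> forall k, k <= n -> exists H, H < pow2 v /\
      ((forall x, x < H -> mem x H -> mem x G /\ lo j <= x /\ x < hi j) /\
     ((homg P H /\ LL k H (lo j) (hi j)) \/ (homg (fun x y => ~ P x y) H /\ LL (msub n k) H (lo j) (hi j))))).
    { intros j Hj k Hkn. destruct (HB j Hj) as (A & B & C).
      destruct (IH G (lo j) (hi j) HSG ltac:(ml) A k Hkn) as (H & D1 & D2). exists H. split; auto.
      pose proof (pow2_mono _ _ C). ml. }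
    assert (Hup : forall j H k, j <= h -> (forall x, x < H -> mem x H -> mem x G /\ lo j <= x /\ x < hi j) ->
      (forall x, x < H -> mem x H -> mem x F /\ u <= x /\ x < v) /\ (LL k H (lo j) (hi j) -> LL k H u v)).
    { intros j H k Hj HH. destruct (HB j Hj) as (A & B & C). split.
      - intros x Hx Hm. apply HGF, HH; auto.
      - intro HLk. apply (LL_mono _ _ _ _ _ _ _ HLk). intros x X1 X2 X3. repeat split; auto; ml. }
    destruct b.
    + destruct (classic (exists j, j <= h /\ exists H, H < pow2 v /\ (forall x, x < H -> mem x H -> mem x G /\ lo j <= x /\ x < hi j) /\
        homg (fun x y => ~ P x y) H /\ LL (msub n k') H (lo j) (hi j))) as [(j & Hj & H & D0 & D1 & D2 & D3)|HN].
      * destruct (Hup j H (msub n k') Hj D1) as [U1 U2]. exists H. split; auto. split; auto. right. rewrite Em. auto.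
      * destruct (assemble P (ex8 n) k' F u v G lo hi h HP HCh) as (H & D1 & D2 & D3 & D4).
        { intros j Hj. destruct (Hblk j Hj k' ltac:(ml)) as (H & D0 & D1 & [[D2 D3]|[D2 D3]]); [exists H; auto|].
          exfalso. apply HN. exists j. split; auto. exists H. auto. }
        exists H. auto.
    + destruct (classic (exists j, j <= h /\ exists H, H < pow2 v /\ (forall x, x < H -> mem x H -> mem x G /\ lo j <= x /\ x < hi j) /\
        homg P H /\ LL (k' + 1) H (lo j) (hi j))) as [(j & Hj & H & D0 & D1 & D2 & D3)|HN].
      * destruct (Hup j H (k' + 1) Hj D1) as [U1 U2]. exists H. split; auto.
      * destruct (assemble (fun x y => ~ P x y) (ex8 n) (msub n (k' + 1)) F u v G lo hi h HPn HCh) as (H & D1 & D2 & D3 & D4).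
        { intros j Hj. destruct (Hblk j Hj (k' + 1) Hk') as (H & D0 & D1 & [[D2 D3]|[D2 D3]]); [|exists H; auto].
          exfalso. apply HN. exists j. split; auto. exists H. auto. }
        exists H. split; auto. split; auto. right. rewrite Em'. auto.
Qed.

Corollary ramsey_homogeneous k F u v : sparse F -> 1 + 1 <= u -> LL (ex8 (k + k)) F u v ->
  exists H, (forall x, mem x H -> mem x F /\ u <= x /\ x < v) /\ LL k H u v /\
    (homg P H \/ homg (fun x y => ~ P x y) H).
Proof.
  intros HS Hu HL. destruct (ramsey_large (k + k) F u v HS Hu HL k ltac:(ml)) as (H & _ & A & B).
  exists H. split; [intros x Hx; apply A; auto using mem_lt|].
  assert (E : msub (k + k) k = k). { destruct (msub_spec (k + k) k) as [_ E]. specialize (E ltac:(ml)). ml. }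
  rewrite E in B. tauto.
Qed.
End Chain.

(** * Ordinal codes in initial segments, and well-ordered exponents *)

Section Codes.
Context `{R : RM}.
Add Ring Mring11 : M_srt.

Definition sq (c : M) : Prop := exists k a b, c = pr k (pr a b).
Definition len (c : M) : M := fst c.
Definition ent (c i : M) : M := ap (snd c) i.
Definition ord (c : M) : Prop :=
  sq c /\ forall j, j < len c -> forall i, i < j -> ent c j <= ent c i.
Definition olt (c d : M) : Prop :=
  sq c /\ sq d /\ ((len c < len d /\ forall i, i < len c -> ent c i = ent d i) \/
   exists i, i < len c /\ (i < len d /\ (forall j, j < i -> ent c j = ent d j) /\ ent c i < ent d i)).

Lemma sq_pr k c : sq (pr k (pr (fst c) (snd c))).
Proof. red; eauto. Qed.
Lemma len_le c : sq c -> len c <= c.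
Proof. intros (k & a & b & ->). unfold len. rewrite fst_pr. apply pr_ge1. Qed.
Lemma ent_le c i : sq c -> ent c i <= c.
Proof.
  intros (k & a & b & ->). unfold ent, ap. rewrite snd_pr, fst_pr, snd_pr.
  assert (L : rem a (1 + (i + 1) * b) <= a) by (apply mub_le; rc).
  pose proof (pr_ge1 a b). pose proof (pr_ge2 k (pr a b)). ml.
Qed.

(** [pj] embeds a structure as an initial segment. It will be the identity of the model and the
    inclusion of the cut; both thus evaluate ordinal codes alike, since entries and lengths are
    bounded by the code. *)
Section Emb.
Variable A : struct.
Variable pj : dom A -> M.
Hypothesis pj_0 : pj (s_zero A) = 0.
Hypothesis pj_1 : pj (s_one A) = 1.
Hypothesis pj_add : forall x y, pj (s_add A x y) = pj x + pj y.
Hypothesis pj_mul : forall x y, pj (s_mul A x y) = pj x * pj y.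
Hypothesis pj_lt : forall x y, s_lt A x y <-> pj x < pj y.
Hypothesis pj_inj : forall x y, pj x = pj y -> x = y.
Hypothesis pj_init : forall x y, x <= pj y -> exists z, pj z = x.

Lemma pj_sp x y : pj (sp A x y) = pr (pj x) (pj y).
Proof. unfold sp, pr. now rewrite !pj_add, pj_mul, pj_add. Qed.

Lemma sLen_iff c k : sLen A c k <-> sq (pj c) /\ pj k = len (pj c).
Proof.
  split.
  - intros (a & b & ->). rewrite !pj_sp. split; [red; eauto|]. unfold len. now rewrite fst_pr.
  - intros ((k' & a & b & E) & Ek). unfold len in Ek. rewrite E, fst_pr in Ek. subst k'.
    destruct (pj_init (pr a b) c) as [w Ew]; [rewrite E; apply pr_ge2|].
    destruct (pj_init a w) as [a' Ea]; [rewrite Ew; apply pr_ge1|].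
    destruct (pj_init b w) as [b' Eb]; [rewrite Ew; apply pr_ge2|].
    exists a', b'. apply pj_inj. now rewrite !pj_sp, Ea, Eb.
Qed.
Lemma sSeq_iff c : sSeq A c <-> sq (pj c).
Proof.
  split.
  - intros (k & a & b & ->). rewrite !pj_sp. red; eauto.
  - intro Hs. destruct (pj_init (len (pj c)) c (len_le _ Hs)) as [k Ek].
    assert (HL : sLen A c k) by (apply sLen_iff; auto).
    destruct HL as (a & b & E). exists k, a, b. exact E.
Qed.
Lemma sEntry_iff c i e : sEntry A c i e <-> sq (pj c) /\ pj e = ent (pj c) (pj i).
Proof.
  split.
  - intros (k & a & b & -> & q & E & Hl). apply (f_equal pj) in E. apply pj_lt in Hl.
    repeat first [rewrite pj_add in * | rewrite pj_mul in * | rewrite pj_1 in *].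
    rewrite !pj_sp. split; [red; eauto|]. unfold ent, ap. rewrite snd_pr, fst_pr, snd_pr.
    symmetry. eapply rem_unique; eauto.
  - intros (Hs & Ee). apply sSeq_iff in Hs as (k & a & b & ->). exists k, a, b. split; auto.
    rewrite !pj_sp in Ee. unfold ent, ap in Ee. rewrite snd_pr, fst_pr, snd_pr in Ee.
    destruct (rem_spec (pj a) (1 + (pj i + 1) * pj b)) as (q & Hq & E & Hr); [ml|].
    destruct (pj_init q a Hq) as [q' <-]. exists q'. split.
    + apply pj_inj. repeat first [rewrite pj_add | rewrite pj_mul | rewrite pj_1]. rewrite Ee. exact E.
    + apply pj_lt. repeat first [rewrite pj_add | rewrite pj_mul | rewrite pj_1]. rewrite Ee. exact Hr.
Qed.
Lemma sEntry_ex c i : sq (pj c) -> exists e, sEntry A c i e /\ pj e = ent (pj c) (pj i).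
Proof.
  intro Hs. destruct (pj_init (ent (pj c) (pj i)) c (ent_le _ _ Hs)) as [e Ee].
  exists e. rewrite sEntry_iff. auto.
Qed.
Lemma sSame_iff c c' i : sq (pj c) -> sq (pj c') -> (sSame A c c' i <-> ent (pj c) (pj i) = ent (pj c') (pj i)).
Proof.
  intros Hc Hc'. split.
  - intro HS. destruct (sEntry_ex c i Hc) as (e & He & <-). destruct (sEntry_ex c' i Hc') as (e' & He' & <-).
    f_equal. apply HS; auto.
  - intros E e e' He He'. apply sEntry_iff in He as [_ He], He' as [_ He']. apply pj_inj. congruence.
Qed.
Lemma sOrd_iff c : sOrd A c <-> ord (pj c).
Proof.
  unfold sOrd, ord. rewrite sSeq_iff. split; intros [Hs HH]; split; auto.
  - intros j Hj i Hi. destruct (pj_init _ c (len_le _ Hs)) as [k Ek].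
    destruct (pj_init j k) as [j' <-]; [ml|]. destruct (pj_init i j') as [i' <-]; [ml|].
    destruct (sEntry_ex c i' Hs) as (e & He & <-). destruct (sEntry_ex c j' Hs) as (e' & He' & <-).
    destruct (HH k i' j' e e') as [L| ->]; auto.
    + apply sLen_iff; auto.
    + apply pj_lt; auto.
    + apply pj_lt; ml.
    + apply pj_lt in L. ml.
    + ml.
  - intros k i j ei ej Hk Hij Hj Hei Hej. apply sLen_iff in Hk as [_ Hk]. apply pj_lt in Hij, Hj.
    apply sEntry_iff in Hei as [_ Hei], Hej as [_ Hej].
    pose proof (HH (pj j) ltac:(ml) (pj i) Hij) as L. rewrite <- Hei, <- Hej in L.
    apply lt_S in L as [L|L]; [left; apply pj_lt; auto|right; auto].
Qed.
Lemma sOlt_iff c d : sOlt A c d <-> olt (pj c) (pj d).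
Proof.
  unfold sOlt, olt. split.
  - intros (k & k' & Hk & Hk' & HH). apply sLen_iff in Hk as [Hs Hk], Hk' as [Hs' Hk'].
    split; auto. split; auto. rewrite <- Hk, <- Hk'.
    destruct HH as [[L HE]|(i & Hi & Hi' & HE & e & e' & He & He' & L)]; [left|right].
    + split; [apply pj_lt; auto|]. intros i Hi. destruct (pj_init i k) as [i' <-]; [ml|].
      apply sSame_iff; auto. apply HE, pj_lt, Hi.
    + exists (pj i). split; [apply pj_lt; auto|]. split; [apply pj_lt; auto|]. split.
      * intros j Hj. destruct (pj_init j i) as [j' <-]; [ml|]. apply sSame_iff; auto. apply HE, pj_lt, Hj.
      * apply sEntry_iff in He as [_ <-], He' as [_ <-]. apply pj_lt, L.
  - intros (Hs & Hs' & HH).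
    destruct (pj_init _ c (len_le _ Hs)) as [k Ek]. destruct (pj_init _ d (len_le _ Hs')) as [k' Ek'].
    exists k, k'. rewrite !sLen_iff. split; auto. split; auto.
    rewrite <- Ek, <- Ek' in HH. destruct HH as [[L HE]|(i & Hi & Hi' & HE & L)]; [left|right].
    + split; [apply pj_lt; auto|]. intros i Hi. apply sSame_iff; auto. apply HE, pj_lt, Hi.
    + destruct (pj_init i k) as [i' <-]; [ml|]. exists i'. split; [apply pj_lt; auto|]. split; [apply pj_lt; auto|].
      split; [intros j Hj; apply sSame_iff; auto; apply HE, pj_lt, Hj|].
      destruct (sEntry_ex c i' Hs) as (e & He & Ee). destruct (sEntry_ex d i' Hs') as (e' & He' & Ee').
      exists e, e'. split; auto. split; auto. apply pj_lt. now rewrite Ee, Ee'.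
Qed.
End Emb.

Lemma wo_no_descent a (f : M -> M) : sWO rA a -> Rc f -> f 0 = a ->
  ~ (forall n, ord (f (n + 1)) /\ olt (f (n + 1)) (f n)).
Proof.
  intros HW Hf H0 HD. apply HW. apply Rc_set in Hf as [X HX].
  assert (HX' : forall x y, s_mem rA (sp rA x y) X <-> y = f x) by exact HX.
  exists X. setoid_rewrite HX'. split; [eauto|]. split; [congruence|]. split; [auto|].
  intros n m m' -> ->.
  rewrite (sOrd_iff rA (fun x => x)), (sOlt_iff rA (fun x => x)); auto; try reflexivity; try tauto; intros; eauto.
Qed.

Definition WOk (k : M) : Prop :=
  ~ exists d : M -> M -> M, Rc (fun w => d (fst w) (snd w)) /\ forall n, lto k (d (n + 1)) (d n).

Lemma WOk_0 : WOk 0.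
Proof. intros (d & _ & H). destruct (H 0) as (p & Hp & _). exact (nlt0 _ Hp). Qed.
Lemma WOk_1 : WOk 1.
Proof.
  intros (d & Hd & H).
  assert (K : forall n, d n 0 + n <= d 0 0).
  { ind_dl; [rc|ml|]. intros n IH. destruct (H n) as (p & Hp & L & _). assert (p = 0) by ml. subst p. ml. }
  specialize (K (d 0 0 + 1)). ml.
Qed.

(** In a descent the upper [l] coefficients never increase. If they drop below each of their values
    again, a recursive search extracts a descent of these alone; otherwise they are constant from
    some point on, and the lower [k] coefficients descend from there. *)
Lemma WOk_add k l : WOk k -> WOk l -> WOk (k + l).
Proof.
  intros Hk Hl (d & Hd & H).
  assert (Hst : forall n, lto l (fun p => d (n + 1) (k + p)) (fun p => d n (k + p)) \/
     ((forall p, p < l -> d (n + 1) (k + p) = d n (k + p)) /\ lto k (d (n + 1)) (d n))).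
  { intro n. destruct (H n) as (p & Hp & L & HE). destruct (classic (p < k)) as [Hpk|Hpk].
    - right. split; [intros q Hq; apply HE; ml|]. exists p. split; auto. split; auto. intros; apply HE; ml.
    - left. apply nlt_le, le_iff in Hpk as [q ->]. exists q. split; [ml|]. split; auto. intros r Hr Hqr. apply HE; ml. }
  assert (Hge : forall n m, lto l (fun p => d (n + m) (k + p)) (fun p => d n (k + p)) \/
     (forall p, p < l -> d (n + m) (k + p) = d n (k + p))).
  { intro n. ind_dl; [rc|right; intros; now rewrite add_0_r|].
    intros m IH. replace (n + (m + 1)) with (n + m + 1) by ring. destruct (Hst (n + m)) as [L|[E _]].
    - left. destruct IH as [IH|IH]; [eapply lto_trans; eauto|]. eapply lto_ext; [| |exact L]; auto.
    - destruct IH as [IH|IH]; [left|right].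
      + eapply lto_ext; [| |exact IH]; auto. intros; symmetry; auto.
      + intros p Hp. rewrite E by auto. auto. }
  destruct (classic (forall n, exists m, lto l (fun p => d m (k + p)) (fun p => d n (k + p)))) as [HE|HN].
  - set (nx := fun n => mu (fun m => lto l (fun p => d m (k + p)) (fun p => d n (k + p)))).
    assert (HD : Dl (fun w => lto l (fun p => d (snd w) (k + p)) (fun p => d (fst w) (k + p)))) by rc.
    assert (Hnx : Rc nx).
    { exact (Rc_mu (fun n m => lto l (fun p => d m (k + p)) (fun p => d n (k + p))) HD HE). }
    assert (Hs : forall n, lto l (fun p => d (nx n) (k + p)) (fun p => d n (k + p))).
    { intro n. apply (mu_spec (fun m => lto l (fun p => d m (k + p)) (fun p => d n (k + p)))); auto. rc. }
    set (a := fun j => rec (fun _ x => nx x) j 0).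
    apply Hl. exists (fun j p => d (a j) (k + p)). split; [unfold a; rc|].
    intro n. unfold a. rewrite (rec_S (fun _ x => nx x)) by rc. apply Hs.
  - apply not_all_ex_not in HN as [n HN]. apply Hk. exists (fun m p => d (n + m) p). split; [rc|].
    intro m. replace (n + (m + 1)) with (n + m + 1) by ring. destruct (Hst (n + m)) as [L|[_ L]]; auto.
    exfalso. apply HN. exists (n + m + 1). destruct (Hge n m) as [IH|IH]; [eapply lto_trans; eauto|].
    eapply lto_ext; [| |exact L]; auto.
Qed.
Lemma WOk_nmul k (n : nat) : WOk k -> WOk (nmul n k).
Proof. intro Hk. induction n; simpl; [apply WOk_0|apply WOk_add; auto]. Qed.

(** If no finite part of [X] were large, the runs along its initial parts would never reach zero,
    and together they would form an infinite descent below omega^k. *)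
Lemma large_exists k X u : WOk k -> Dl X -> (forall b, exists x, b <= x /\ X x) ->
  exists F v, (forall x, mem x F -> X x /\ u <= x /\ x < v) /\ LL k F u v.
Proof.
  intros HW HX Hinf. apply NNPP. intro HN.
  set (Fv := fun v => setc v (fun x => X x /\ u <= x)).
  assert (HF : forall v x, mem x (Fv v) <-> x < v /\ X x /\ u <= x).
  { intros v x. unfold Fv. rewrite mem_setc; [tauto|rc]. }
  assert (HRF : Rc Fv) by (unfold Fv; rc).
  assert (HnL : forall v, ~ LL k (Fv v) u v).
  { intros v HL. apply HN. exists (Fv v), v. split; auto. intros x Hx. apply HF in Hx. tauto. }
  set (nx := fun b => mu (fun x => b < x /\ X x /\ u <= x)).
  assert (HE : forall b, exists x, b < x /\ X x /\ u <= x).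
  { intro b. destruct (Hinf (b + u + 1)) as (x & Hx & HXx). exists x. split; [ml|]. split; auto. ml. }
  assert (HD : Dl (fun w => fst w < snd w /\ X (snd w) /\ u <= snd w)) by rc.
  assert (Hnx : Rc nx) by exact (Rc_mu (fun b x => b < x /\ X x /\ u <= x) HD HE).
  assert (Hs : forall b, b < nx b /\ X (nx b) /\ u <= nx b).
  { intro b. apply (mu_spec (fun x => b < x /\ X x /\ u <= x)); auto. rc. }
  set (a := fun j => rec (fun _ x => nx x) (j + 1) 0).
  assert (Ha : Rc a) by (unfold a; rc).
  assert (Ea : forall j, a (j + 1) = nx (a j)) by (intro j; apply (rec_S (fun _ x => nx x)); rc).
  assert (HaX : forall j, X (a j) /\ u <= a j).
  { intro j. unfold a. rewrite (rec_S (fun _ x => nx x)) by rc. apply Hs. }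
  apply HW. exists (fun j p => ap (run k u (Fv (a j + 1)) (a j + 1)) p). split; [rc|].
  intro n. destruct (not_large_descent k _ _ _ (HnL (a (n + 1) + 1))) as [_ HL].
  assert (Hlt : a n < a (n + 1)) by (rewrite Ea; apply Hs).
  destruct (HaX n) as [X1 X2]. destruct (HaX (n + 1)) as [Y1 Y2].
  (* A run depends only on the elements already passed, so runs along different initial parts agree
     where both are defined. *)
  rewrite (run_ext k u (Fv (a n + 1)) (Fv (a (n + 1) + 1)) (a n + 1)).
  - apply HL; auto; try ml; apply HF; repeat split; auto; ml.
  - intros x Hx1 Hx2. rewrite !HF. split; intros (P1 & P2 & P3); repeat split; auto; ml.
  - ml.
Qed.
End Codes.

(** * Exponent sequences, coefficients, and the end of a descent *)

Section OrdinalCodes.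
Context `{R : RM}.
Add Ring Mring12 : M_srt.

Lemma msum_upd n f g c0 x : Rc f -> Rc g -> c0 < n -> f c0 = g c0 + x ->
  (forall c, c < n -> c <> c0 -> f c = g c) -> msum n f = msum n g + x.
Proof.
  intros Hf Hg Hc HL HE.
  assert (K : forall m, m <= n -> (c0 < m -> msum m f = msum m g + x) /\ (m <= c0 -> msum m f = msum m g)).
  { ind_dl; [rc| |].
    - intros _. rewrite !msum_0 by auto. split; intro H; ml.
    - intros m IH Hm. destruct IH as [I1 I2]; [ml|]. rewrite !msum_S by auto. split; intro H.
      + apply lt_S in H as [H| ->].
        * rewrite (HE m) by (try (intro; subst; ml); ml). specialize (I1 H). ml.
        * specialize (I2 ltac:(ml)). ml.
      + rewrite I2, (HE m) by (try (intro; subst; ml); ml). reflexivity. }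
  destruct (K n) as [K1 _]; [ml|auto].
Qed.
Lemma msum_mono n f g : Rc f -> Rc g -> (forall c, c < n -> f c <= g c) -> msum n f <= msum n g.
Proof.
  intros Hf Hg HE. assert (K : forall m, m <= n -> msum m f <= msum m g); [|apply K; ml].
  ind_dl; [rc|intros; rewrite !msum_0 by auto; ml|]. intros m IH Hm. rewrite !msum_S by auto.
  specialize (IH ltac:(ml)). specialize (HE m ltac:(ml)). ml.
Qed.
Lemma msum_zero n f : Rc f -> (forall c, c < n -> f c = 0) -> msum n f = 0.
Proof.
  intros Hf HE. assert (L : msum n f <= n * 0) by (apply msum_le; auto; intros c Hc; rewrite HE; auto; ml).
  rewrite mul_0_r in L. ml.
Qed.
Lemma msum_cut n i f : Rc f -> i <= n -> (forall t, i <= t -> t < n -> f t = 0) -> msum n f = msum i f.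
Proof.
  intros Hf Hi HZ. apply le_iff in Hi as [d ->].
  assert (K : forall m, m <= d -> msum (i + m) f = msum i f); [|apply K; ml].
  ind_dl; [rc|intros; now rewrite add_0_r|]. intros m IH Hm.
  replace (i + (m + 1)) with (i + m + 1) by ring. rewrite msum_S, IH, HZ by (auto; ml). ring.
Qed.
Lemma msum_incr n i f : Rc f -> i <= n -> msum i f <= msum n f.
Proof.
  intros Hf Hi. apply le_iff in Hi as [d ->]. revert d. ind_dl; [rc|rewrite add_0_r; ml|].
  intros d IH. replace (i + (d + 1)) with (i + d + 1) by ring. rewrite msum_S by auto. ml.
Qed.

Lemma msub_1 a : msub (a + 1) 1 = a.
Proof. destruct (msub_spec (a + 1) 1) as [_ E]. specialize (E ltac:(ml)). ml. Qed.

(* The code of the ordinal with coefficients [s]: its exponent sequence takes the value p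
   at the positions t with tsum (p + 1) <= t < tsum p. *)
Definition tsum (k : M) (s : M -> M) (p : M) : M := msum k (fun q => ifm (p <= q) (s q) 0).
Definition tpos (k : M) (s : M -> M) (t : M) : M := mub k (fun p => tsum k s p <= t).
Definition ocode (k : M) (s : M -> M) : M :=
  let c := tab (tsum k s 0) (fun t => msub (tpos k s t) 1) in pr (tsum k s 0) (pr (fst c) (snd c)).

Lemma Rc_tsum k s p : Rc (fun w => s (fst w) (snd w)) -> Rc p -> Rc (fun z => tsum k (s z) (p z)).
Proof. intros. unfold tsum. rc. Qed.
Lemma Rc_ocode k (s : M -> M -> M) : Rc (fun w => s (fst w) (snd w)) -> Rc (fun z => ocode k (s z)).
Proof.
  intros. unfold ocode, tpos. cbv zeta.
  assert (H1 : Rc (fun w => tsum k (s (fst w)) (snd w))) by (apply (Rc_tsum k (fun w => s (fst w)) snd); rc).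
  assert (H2 : Rc (fun z => tsum k (s z) 0)) by (apply (Rc_tsum k s (fun _ => 0)); rc).
  assert (H3 : Rc (fun w => mub k (fun p => tsum k (s (fst w)) p <= snd w))).
  { apply (Rc_mub (fun _ => k) (fun w p => tsum k (s (fst w)) p <= snd w)); [rc|].
    apply Dl_le; [|rc]. apply (Rc_tsum k (fun w => s (fst (fst w))) snd); rc. }
  assert (H4 : Rc (fun z => tab (tsum k (s z) 0) (fun t => msub (mub k (fun p => tsum k (s z) p <= t)) 1))).
  { apply (Rc_tab (fun z => tsum k (s z) 0) (fun z t => msub (mub k (fun p => tsum k (s z) p <= t)) 1)); [exact H2|].
    apply Rc_msub; [exact H3|rc]. }
  apply Rc_pair; [exact H2|]. apply Rc_pair; [apply (Rc_comp fst _ Rc_fst H4)|apply (Rc_comp snd _ Rc_snd H4)].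
Qed.

Section OneCode.
Variables (k : M) (s : M -> M).
Hypothesis Hs : Rc s.
Let HT : Rc (tsum k s).
Proof. unfold tsum. rc. Qed.

Lemma tsum_mono p q : p <= q -> tsum k s q <= tsum k s p.
Proof.
  intro Hpq. apply msum_mono; [rc|rc|]. intros c Hc. unfold ifm.
  repeat destruct (excluded_middle_informative _); ml.
Qed.
Lemma tsum_step p : p < k -> tsum k s p = tsum k s (p + 1) + s p.
Proof.
  intro Hp. apply (msum_upd k _ _ p); [rc|rc|auto| |].
  - rewrite ifm_t, ifm_f by ml. ring.
  - intros c Hc Hne. unfold ifm. destruct (lt_total c p) as [L|[L|L]]; [|contradiction|];
    repeat destruct (excluded_middle_informative _); auto; ml.
Qed.
Lemma tsum_top p : k <= p -> tsum k s p = 0.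
Proof. intro Hp. apply msum_zero; [rc|]. intros c Hc. apply ifm_f. ml. Qed.
Lemma tpos_spec t : tpos k s t <= k /\ tsum k s (tpos k s t) <= t /\ forall p, p < tpos k s t -> t < tsum k s p.
Proof.
  assert (HD : Dl (fun p => tsum k s p <= t)) by rc.
  destruct (mub_ex k (fun p => tsum k s p <= t) k HD) as [A B]; [rewrite tsum_top; ml|ml|].
  fold (tpos k s t) in *. split; auto. split; auto. intros p Hp.
  destruct (mub_spec k (fun p => tsum k s p <= t) HD) as [_ Hm]. destruct (Hm p Hp) as [H _]. ml.
Qed.
Lemma ocode_sq : sq (ocode k s).
Proof. apply sq_pr. Qed.
Lemma ocode_len : len (ocode k s) = tsum k s 0.
Proof. unfold len, ocode. apply fst_pr. Qed.
Lemma ocode_ent t : t < tsum k s 0 -> ent (ocode k s) t + 1 = tpos k s t.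
Proof.
  intro Ht. unfold ent, ocode. rewrite snd_pr.
  assert (E : forall c, ap (pr (fst c) (snd c)) t = ap c t).
  { intro c. unfold ap. now rewrite fst_pr, snd_pr. }
  rewrite E, (tab_spec _ (fun t => msub (tpos k s t) 1)); auto; [|unfold tpos; rc].
  destruct (tpos_spec t) as (A & B & C). destruct (zero_or_S (tpos k s t)) as [E0|[p ->]].
  - rewrite E0 in B. ml.
  - now rewrite msub_1.
Qed.
Lemma ocode_ord : ord (ocode k s).
Proof.
  split; [apply ocode_sq|]. rewrite ocode_len. intros j Hj i Hi.
  pose proof (ocode_ent j Hj). pose proof (ocode_ent i ltac:(ml)).
  destruct (tpos_spec j) as (A & B & C). destruct (tpos_spec i) as (A' & B' & C').
  apply NNPP. intro Hn. assert (L : tpos k s i < tpos k s j) by ml. apply C in L. ml.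
Qed.
End OneCode.

(** If [p] is the highest exponent where the coefficients differ, the sequences agree below position
    [tsum k s p]. There the one of [t] still has the entry [p], whereas the one of [s] continues
    with a smaller entry or has ended. *)
Lemma ocode_olt k s t : Rc s -> Rc t -> lto k s t -> olt (ocode k s) (ocode k t).
Proof.
  intros Hs Ht (p & Hp & L & HE). split; [apply ocode_sq|]. split; [apply ocode_sq|].
  rewrite !ocode_len.
  assert (ET : forall q, p < q -> tsum k s q = tsum k t q).
  { intros q Hq. apply msum_ext; [rc|rc|]. intros c Hc. unfold ifm.
    destruct (excluded_middle_informative _); auto. apply HE; auto. ml. }
  assert (Lp : tsum k s p < tsum k t p).
  { rewrite (tsum_step k s Hs p Hp), (tsum_step k t Ht p Hp), (ET (p + 1)) by ml. ml. }
  set (i := tsum k s p) in *.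
  assert (Hi0 : tsum k t p <= tsum k t 0) by (apply tsum_mono; auto; ml).
  assert (His : i <= tsum k s 0) by (apply tsum_mono; auto; ml).
  assert (Eent : forall j, j < i -> ent (ocode k s) j = ent (ocode k t) j).
  { intros j Hj. pose proof (ocode_ent k s Hs j ltac:(ml)) as E1. pose proof (ocode_ent k t Ht j ltac:(ml)) as E2.
    destruct (tpos_spec k s Hs j) as (A & B & C). destruct (tpos_spec k t Ht j) as (A' & B' & C').
    assert (P1 : p < tpos k s j).
    { apply NNPP. intro Hn. apply nlt_le in Hn. pose proof (tsum_mono k s Hs _ _ Hn). unfold i in *. ml. }
    assert (P2 : p < tpos k t j).
    { apply NNPP. intro Hn. apply nlt_le in Hn. pose proof (tsum_mono k t Ht _ _ Hn). ml. }
    assert (tpos k s j = tpos k t j); [|ml].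
    destruct (lt_total (tpos k s j) (tpos k t j)) as [X|[X|X]]; auto; exfalso.
    - apply C' in X. rewrite <- ET in X by auto. ml.
    - apply C in X. rewrite ET in X by auto. ml. }
  assert (Eti : ent (ocode k t) i = p).
  { pose proof (ocode_ent k t Ht i ltac:(ml)) as E2. destruct (tpos_spec k t Ht i) as (A' & B' & C').
    assert (P2 : p < tpos k t i).
    { apply NNPP. intro Hn. apply nlt_le in Hn. pose proof (tsum_mono k t Ht _ _ Hn). ml. }
    assert (P3 : tpos k t i <= p + 1).
    { apply NNPP. intro Hn. apply nle_lt in Hn. apply C' in Hn. rewrite <- ET in Hn by ml.
      pose proof (tsum_mono k s Hs p (p + 1) ltac:(ml)). unfold i in *. ml. }
    ml. }
  destruct (classic (i < tsum k s 0)) as [Hlt|Hge].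
  - right. exists i. split; auto. split; [ml|]. split; auto. rewrite Eti.
    pose proof (ocode_ent k s Hs i Hlt) as E1. destruct (tpos_spec k s Hs i) as (A & B & C).
    apply NNPP. intro Hn. assert (X : p < tpos k s i) by ml. apply C in X. unfold i in X. ml.
  - left. split; [ml|]. intros j Hj. apply Eent. ml.
Qed.

Definition lead (a : M) : M := ifm (len a = 0) 0 (ent a 0).

(** The ordinals below omega^(lead a) are below [a], so a descent among them, with [a] put in front,
    is a descent from [a]. *)
Lemma wo_lead a : sWO rA a -> ord a -> WOk (lead a).
Proof.
  intros HW [Ha Hord] (d & Hd & HD). unfold lead in HD.
  destruct (classic (len a = 0)) as [E0|E0].
  { rewrite ifm_t in HD by auto. destruct (HD 0) as (p & Hp & _). exact (nlt0 _ Hp). }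
  rewrite ifm_f in HD by auto. set (k := ent a 0) in *.
  assert (Hdn : forall n, Rc (d n)) by (intro; rc).
  assert (HO : Rc (fun z => ocode k (d z))) by (apply Rc_ocode; auto).
  assert (HO' : Rc (fun n => ocode k (d (msub n 1)))).
  { apply (Rc_comp (fun z => ocode k (d z)) (fun n => msub n 1)); auto. rc. }
  apply (wo_no_descent a (fun n => ifm (n = 0) a (ocode k (d (msub n 1)))) HW).
  - apply (Rc_if (fun n => n = 0) (fun _ => a)); auto; rc.
  - apply ifm_t; auto.
  - intro n. rewrite (ifm_f (n + 1 = 0)) by apply S_neq0. rewrite msub_1. split; [apply ocode_ord; auto|].
    destruct (zero_or_S n) as [->|[m ->]].
    + rewrite ifm_t by auto. split; [apply ocode_sq|]. split; auto.
      assert (Hla : 0 < len a) by (destruct (lt_total 0 (len a)) as [|[|X]]; [auto|congruence|destruct (nlt0 _ X)]).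
      destruct (classic (len (ocode k (d 0)) = 0)) as [E|E].
      * left. rewrite E. split; auto. intros i Hi. destruct (nlt0 _ Hi).
      * right. exists 0.
        assert (Hl : 0 < len (ocode k (d 0))) by (destruct (lt_total 0 (len (ocode k (d 0)))) as [|[|X]]; [auto|congruence|destruct (nlt0 _ X)]).
        split; auto. split; auto. split; [intros j Hj; destruct (nlt0 _ Hj)|].
        rewrite ocode_len in Hl. pose proof (ocode_ent k (d 0) (Hdn 0) 0 Hl).
        destruct (tpos_spec k (d 0) (Hdn 0) 0) as (A & _). fold k. ml.
    + rewrite ifm_f by apply S_neq0. rewrite msub_1. apply ocode_olt; auto.
Qed.

Definition mult (c p : M) : M := msum (len c) (fun t => ifm (ent c t = p) 1 0).
Lemma Rc_mult f g : Rc f -> Rc g -> Rc (fun z => mult (f z) (g z)).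
Proof. intros. unfold mult, len, ent. rc. Qed.
Lemma mult_le c p : sq c -> mult c p <= c.
Proof.
  intro Hc. assert (L : mult c p <= len c * 1).
  { apply msum_le; [unfold ent; rc|]. intros t Ht. unfold ifm. destruct (excluded_middle_informative _); ml. }
  pose proof (len_le c Hc). replace (len c * 1) with (len c) in L by ring. ml.
Qed.

(** At the first difference let [p] be the entry of [d]. By monotonicity all remaining entries of
    [c] are below [p], so the multiplicities agree above [p] and that of [p] is smaller in [c]. *)
Lemma mult_lto k c d : ord c -> ord d -> olt c d -> ent d 0 <= k -> lto (k + 1) (mult c) (mult d).
Proof.
  intros [Hc HOc] [Hd HOd] (_ & _ & HL) Hk.
  assert (HE : exists i, i <= len c /\ i < len d /\ (forall j, j < i -> ent c j = ent d j) /\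
    forall t, i <= t -> t < len c -> ent c t < ent d i).
  { destruct HL as [[L HE]|(i & L1 & L2 & HE & L3)].
    - exists (len c). split; [ml|]. split; auto. split; auto. intros; ml.
    - exists i. split; [ml|]. split; auto. split; auto. intros t Ht Htc.
      apply lt_S in Ht as [Ht| <-]; auto. pose proof (HOc t Htc i Ht). ml. }
  destruct HE as (i & Hic & Hid & HEq & Hlow). set (p := ent d i) in *.
  assert (Hpk : p < k + 1).
  { destruct (zero_or_S i) as [E|[i' E]]; [unfold p; rewrite E; ml|].
    pose proof (HOd i Hid 0 ltac:(ml)). unfold p. ml. }
  assert (HRc : forall x q, Rc (fun t => ifm (ent x t = q) 1 0)) by (intros; unfold ent; rc).
  assert (Ec : forall q, p <= q -> mult c q = msum i (fun t => ifm (ent c t = q) 1 0)).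
  { intros q Hq. apply msum_cut; auto. intros t Ht Htc. apply ifm_f. specialize (Hlow t Ht Htc). intro E. rewrite E in Hlow. ml. }
  assert (Ecd : forall q, msum i (fun t => ifm (ent c t = q) 1 0) = msum i (fun t => ifm (ent d t = q) 1 0)).
  { intro q. apply msum_ext; auto. intros t Ht. now rewrite HEq. }
  exists p. split; auto. split.
  - rewrite Ec, Ecd by ml.
    pose proof (msum_incr (len d) (i + 1) (fun t => ifm (ent d t = p) 1 0) (HRc d p) ltac:(ml)) as L.
    rewrite msum_S in L by auto. rewrite (ifm_t (ent d i = p)) in L by auto. unfold mult. ml.
  - intros q Hq Hpq. rewrite Ec, Ecd by ml. symmetry. apply msum_cut; auto; [ml|].
    intros t Ht Htd. apply ifm_f. intro E. apply lt_S in Ht as [Ht| <-]; [|fold p in E; ml].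
    pose proof (HOd t Htd i Ht). fold p in H. ml.
Qed.

Lemma olt_head c d k : olt c d -> len c = 0 \/ (ent d 0 <= k -> ent c 0 <= k).
Proof.
  intros (_ & _ & [[L HE]|(i & L1 & L2 & HE & L3)]).
  - destruct (zero_or_S (len c)) as [->|[l E]]; auto. right. rewrite HE by ml. auto.
  - right. destruct (zero_or_S i) as [->|[i' ->]]; [ml|]. rewrite HE by ml. auto.
Qed.

(** Whatever cut is placed between [u] and [v], the function [d] is no descending sequence inside
    it: at an argument below the cut it leaves the cut or fails to descend. *)
Definition killed (d : M -> M) (u v : M) : Prop :=
  exists x, x < u /\ (v <= d x \/ ~ (ord (d (x + 1)) /\ olt (d (x + 1)) (d x))).

(** Suppose that no minimal [e]-large block kills [d]. Then [d] descends at least as long as there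
    are blocks, with values bounded by the block ends, and the multiplicities of its ordinals form a
    descent with [k + 1] coefficients along the blocks, against [no_block_descent]. *)
Lemma kill_descent e k F u v d : Rc d -> 1 + 1 <= u -> LL (e + (k + 1)) F u v ->
  ord (d 0) -> d 0 <= u -> ent (d 0) 0 <= k \/ len (d 0) = 0 ->
  exists u' v', u <= u' /\ v' <= v /\ LL e F u' v' /\ killed d u' v'.
Proof.
  intros Hd Hu HL Ho0 H0 Hl0. apply NNPP. intro HN.
  assert (HB : forall u' v', u <= u' -> v' <= v -> LL e F u' v' -> forall x, x < u' ->
    d x < v' /\ ord (d (x + 1)) /\ olt (d (x + 1)) (d x)).
  { intros u' v' H1 H2 H3 x Hx. apply NNPP. intro Hn. apply HN. exists u', v'. repeat split; auto.
    exists x. split; auto. destruct (classic (v' <= d x)) as [|Hv]; auto. right. intros [A B]. apply Hn.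
    split; [ml|auto]. }
  assert (Huv : u <= v). { destruct (LL_nonempty _ _ _ _ HL) as (x & _ & A & B). ml. }
  set (c := cut e F u v) in *. assert (HRc : Rc c) by apply Rc_cut.
  (* all blocks seen so far certify that d descends up to their index *)
  assert (HDs : forall i, c i <= v -> forall x, x <= i -> ord (d (x + 1)) /\ olt (d (x + 1)) (d x)).
  { intros i Hi x Hx. destruct (zero_or_S i) as [E|[i' E]].
    - assert (x = 0) by ml. subst x. apply (HB u v); auto; [ml|ml| |ml]. eapply LL_exp; [|exact HL]. ml.
    - subst i. destruct (cut_step e F u v i') as [_ CS]. fold c in CS. destruct CS as [(S1 & S2 & S3)|S1]; [|ml].
      destruct (cut_mono e F u v 0 i' Huv ltac:(ml)) as [_ L]; [fold c; ml|]. rewrite cut_0 in L. fold c in L.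
      assert (Em : msub i' 0 = i'). { destruct (msub_spec i' 0) as [_ E]. specialize (E ltac:(ml)). ml. }
      rewrite Em in L. apply (HB (c i') (c (i' + 1))); auto; ml. }
  (* For positive [i] the block ending at [c i] would kill [d] at [i] if [d i] were not below its
     end: its start is at least u + i - 1, which exceeds [i] because [1 + 1 <= u]. *)
  assert (Hdig : forall i, c i <= v -> d i <= c i).
  { intros i Hi. destruct (zero_or_S i) as [E|[i' E]].
    - subst i. unfold c. rewrite cut_0. auto.
    - subst i. destruct (cut_step e F u v i') as [_ CS]. fold c in CS. destruct CS as [(S1 & S2 & S3)|S1]; [|ml].
      destruct (cut_mono e F u v 0 i' Huv ltac:(ml)) as [_ L]; [fold c; ml|]. rewrite cut_0 in L. fold c in L.
      assert (Em : msub i' 0 = i'). { destruct (msub_spec i' 0) as [_ E]. specialize (E ltac:(ml)). ml. }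
      rewrite Em in L. destruct (HB (c i') (c (i' + 1)) ltac:(ml) S1 S2 (i' + 1)) as [L' _]; ml. }
  apply (no_block_descent e (k + 1) F u v (fun i => mult (d i))); auto; [ml|apply Rc_mult; rc|].
  intros i Hi. fold c in Hi. fold c.
  assert (Hord : forall x, x <= i + 1 -> ord (d x)).
  { intros x Hx. destruct (zero_or_S x) as [->|[x' ->]]; auto. apply (HDs i Hi). ml. }
  assert (Hhd : forall x, x <= i -> ent (d x) 0 <= k \/ len (d x) = 0).
  { ind_dl; [unfold ent, len; rc|auto|]. intros x IH Hx. specialize (IH ltac:(ml)).
    destruct (HDs i Hi x ltac:(ml)) as [_ Hol]. destruct IH as [IH|IH].
    - destruct (olt_head _ _ k Hol); auto.
    - exfalso. destruct Hol as (_ & _ & [[L _]|(y & _ & L & _)]); rewrite IH in L; exact (nlt0 _ L). }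
  assert (Hst : forall x, x <= i -> lto (k + 1) (mult (d (x + 1))) (mult (d x))).
  { intros x Hx. destruct (HDs i Hi x Hx) as [O1 O2]. destruct (Hhd x Hx) as [Hh|Hh].
    - apply mult_lto; auto. apply Hord. ml.
    - exfalso. destruct O2 as (_ & _ & [[L _]|(y & _ & L & _)]); rewrite Hh in L; exact (nlt0 _ L). }
  split; [|split].
  - eapply lto_nz. apply (Hst i). ml.
  - intros p _. destruct (Hord i ltac:(ml)) as [Hsq _]. pose proof (mult_le (d i) p Hsq). pose proof (Hdig i Hi). ml.
  - intros j Hj. apply lt_iff in Hj as [t Et]. subst i.
    assert (HRm : Rc (fun w => mult (d (fst w)) (snd w))) by (apply Rc_mult; rc).
    assert (K : forall r, r <= t -> lto (k + 1) (mult (d (j + r + 1))) (mult (d j))).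
    { ind_dl.
      - apply Dl_imp; [rc|]. apply (Dl_lto (fun _ => k + 1) (fun r => mult (d (j + r + 1))) (fun _ => mult (d j))); [rc| |];
        apply (Rc_mult (fun w => d _) snd); rc.
      - intros _. rewrite add_0_r. apply Hst. ml.
      - intros r IH Hr. eapply lto_trans; [|apply IH; ml].
        replace (j + (r + 1) + 1) with (j + r + 1 + 1) by ring. apply Hst. ml. }
    apply K. ml.
Qed.
End OrdinalCodes.

(** * The construction of a Ramsey cut *)

Section Cut.
Context `{R : RM}.
Add Ring Mring13 : M_srt.

Fixpoint num (n : nat) : M := match n with O => 0 | S n => num n + 1 end.

(* One step of the construction divides the exponent by 19 = 8 * 2 + 3: the Ramsey theorem
   for large sets costs the factor 8 * 2, the gap and the end of a descent the rest. *)
Definition D19 : M := (1 + 1 + 1 + 1 + 1 + 1 + 1 + 1) * (1 + 1) + (1 + 1 + 1).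
Definition Ex (k j : M) : M := rec (fun _ v => v * D19) j k.
Lemma Rc_Ex k : Rc (Ex k).
Proof. unfold Ex. rc. Qed.
Lemma Ex_0 k : Ex k 0 = k.
Proof. apply rec_0. rc. Qed.
Lemma Ex_S k j : Ex k (j + 1) = Ex k j * D19.
Proof. apply (rec_S (fun _ v => v * D19)). rc. Qed.
Lemma Ex_ge k j : k <= Ex k j.
Proof.
  pose proof (Rc_Ex k). revert j. ind_dl; [rc|rewrite Ex_0; ml|].
  intros j IH. rewrite Ex_S. set (x := Ex k j) in *.
  replace (x * D19) with (x + x * ((1 + 1 + 1 + 1 + 1 + 1 + 1 + 1) * (1 + 1) + (1 + 1))) by (unfold D19; ring). ml.
Qed.
Lemma WOk_Ex k (n : nat) : WOk k -> WOk (Ex k (num n)).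
Proof.
  intro Hk. induction n; simpl; [rewrite Ex_0; auto|].
  rewrite Ex_S. apply (WOk_nmul _ 19) in IHn.
  replace (Ex k (num n) * D19) with (nmul 19 (Ex k (num n))); auto. simpl nmul. unfold D19. ring.
Qed.

(** The code [c] is read in two ways: as a function, which gets a gap and is killed as a descent
    from [a], and as a colouring. The element [e] of [F] between [u] and [u'] makes the elements of
    the first large set cofinal in the cut, hence the cut closed under [gr] and [g]. *)
Definition stepR (k a c F u v F' u' v' : M) : Prop :=
  (forall x, mem x F' -> mem x F /\ u' <= x /\ x < v') /\ v' <= v /\ (exists e, mem e F /\ u <= e /\ e < u') /\
  (forall x, x < u -> ap c x <= u' \/ v' <= ap c x) /\
  (homg (fun x y => mem (pr x y) c) F' \/ homg (fun x y => ~ mem (pr x y) c) F') /\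
  (ap c 0 = a -> killed (ap c) u' v').

(** The first block only supplies the element passed by [u']. The second is thinned until no value
    of the function lies inside its span; then the descent is killed, and last the Ramsey theorem is
    applied, all later shrinking preserving what was reached. *)
Lemma cut_refine k a j F u v c : ord a -> a <= u -> ent a 0 <= k \/ len a = 0 -> 1 + 1 <= u -> sparse F ->
  LL (Ex (k + 1) (j + 1)) F u v ->
  exists F' u' v', LL (Ex (k + 1) j) F' u' v' /\ stepR k a c F u v F' u' v'.
Proof.
  intros Ho Hau Hla Hu HS HL. set (e := Ex (k + 1) j).
  assert (Hke : k + 1 <= e) by apply Ex_ge.
  (* From 19 e, the Ramsey theorem takes 16 e, the descent [k + 1 <= e], and the pigeonhole and the
     splitting take 1 each, which is at most [e]. *)
  assert (HL0 : LL (ex8 (e + e) + (k + 1) + 1 + 1) F u v).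
  { eapply LL_exp; [|exact HL]. rewrite Ex_S. fold e.
    replace (e * D19) with (ex8 (e + e) + e + e + e) by (unfold D19, ex8; ring). ml. }
  clear HL.
  destruct (block_split _ F u v ltac:(ml) HL0) as (x0 & cc & Hcc & Hx0 & Hux0 & Hx0v & Hc0 & _ & HB).
  destruct (HB 0) as (A1 & A2 & _ & e1 & A4 & A5); [ml|].
  destruct (HB (0 + 1)) as (B1 & B2 & B3 & _); [ml|].
  set (c1 := cc (0 + 1)) in *. set (c2 := cc (0 + 1 + 1)) in *. rewrite Hc0 in A1.
  (* The colour of [y] is the set of arguments below [u] with value at most [y]. When it is constant
     on the block, every value lies at or below the first element or above the last. Sparsity over
     the skipped block allows the 2^u colours. *)
  destruct (pigeonhole _ F c1 c2 (fun y => setc u (fun x => ap c x <= y)) (pow2 u) B3) as (cy & _ & HY).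
  { rc. }
  { intros x Hx Hl Hh. split; [apply setc_lt; rc|]. rewrite A4 in *.
    assert (Hp : pow2 (e1 + 1) <= x) by (eapply sparse_pow; eauto; ml).
    assert (pow2 u <= pow2 (e1 + 1)) by (apply pow2_mono; ml). ml. }
  { intros x y Hx Hy _ _ Hxy. eapply sparse_sq; eauto. }
  set (F1 := setc c2 (fun y => mem y F /\ setc u (fun x => ap c x <= y) = cy)) in *.
  assert (EF : forall y, mem y F1 -> y < c2 /\ mem y F /\ setc u (fun x => ap c x <= y) = cy).
  { intros y Hy. unfold F1 in Hy. rewrite mem_setc in Hy; [tauto|rc]. }
  assert (HS1 : sparse F1). { eapply sparse_sub; [|exact HS]. intros x Hx. apply EF, Hx. }
  destruct (first_elem F1 c1 c2 (LL_nonempty _ _ _ _ HY)) as (y0 & Y1 & Y2 & Y3 & Y4).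
  destruct (greatest (fun y => mem y F1) c2) as (y1 & Z1 & Z2 & Z3); [rc|eauto|].
  assert (HY' : LL (ex8 (e + e) + (k + 1)) F1 y0 (y1 + 1)).
  { apply (LL_mono _ _ _ _ _ _ _ HY). intros x X1 X2 X3. repeat split; auto.
    apply NNPP. intro Hn. apply (Z3 x); auto. ml. }
  assert (Hgap : forall x, x < u -> ap c x <= y0 \/ y1 + 1 <= ap c x).
  { intros x Hx. destruct (classic (ap c x <= y1)) as [L|L]; [left|right; ml].
    assert (E : forall y, mem y F1 -> (ap c x <= y <-> mem x cy)).
    { intros y Hy. apply EF in Hy as (_ & _ & <-). rewrite mem_setc by rc. tauto. }
    apply E; auto. apply (E y1); auto. }
  assert (Hk : exists u' v', y0 <= u' /\ v' <= y1 + 1 /\ LL (ex8 (e + e)) F1 u' v' /\ (ap c 0 = a -> killed (ap c) u' v')).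
  { destruct (classic (ap c 0 = a)) as [Ea|Ea].
    - destruct (kill_descent (ex8 (e + e)) k F1 y0 (y1 + 1) (ap c)) as (u' & v' & K1 & K2 & K3 & K4);
        [rc|ml|auto|rewrite Ea; auto|rewrite Ea; ml|rewrite Ea; auto|].
      exists u', v'. auto.
    - exists y0, (y1 + 1). split; [ml|]. split; [ml|]. split; [|tauto]. eapply LL_exp; [|exact HY']. ml. }
  destruct Hk as (u' & v' & K1 & K2 & K3 & K4).
  destruct (ramsey_homogeneous (fun x y => mem (pr x y) c) ltac:(rc) e F1 u' v' HS1 ltac:(ml) K3) as (H & H1 & H2 & H3).
  exists H, u', v'. split; auto. repeat split; auto.
  - apply H1 in H0 as (H0 & _). apply EF, H0.
  - apply (H1 x), H0.
  - apply (H1 x), H0.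
  - ml.
  - exists x0. repeat split; auto. ml.
  - intros x Hx. destruct (Hgap x Hx); [left|right]; ml.
Qed.

Variable g : M -> M.
Hypothesis Hg : Rc g.

(** A sequence growing so fast that any two of its elements are separated by [gr] and by all values
    of [g] up to the smaller one. *)
Definition fast (b j : M) : M := rec (fun _ x => gr (x + 1) + msum (x + 1) g + 1) j b.
Lemma fast_rc b : Rc (fast b).
Proof. unfold fast, gr. rc. Qed.
Lemma fast_S b j : fast b (j + 1) = gr (fast b j + 1) + msum (fast b j + 1) g + 1.
Proof. apply (rec_S (fun _ x => gr (x + 1) + msum (x + 1) g + 1)). unfold gr. rc. Qed.
Lemma gr_gt v : v < gr v.
Proof. pose proof (gr_pow v). pose proof (pow2_gt v). ml. Qed.
Lemma fast_mono b i j : i <= j -> fast b i + msub j i <= fast b j.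
Proof.
  intro H. apply le_iff in H as [d ->].
  assert (E : msub (i + d) i = d) by (destruct (msub_spec (i + d) i) as [_ E]; specialize (E ltac:(ml)); ml).
  rewrite E. pose proof (fast_rc b). clear E. revert d. ind_dl; [rc|rewrite !add_0_r; ml|].
  intros d IH. replace (i + (d + 1)) with (i + d + 1) by ring. rewrite fast_S. pose proof (gr_gt (fast b (i + d) + 1)). ml.
Qed.

Definition fset (b x : M) : Prop := exists j, j <= x /\ fast b j = x.
Lemma fset_sparse b x y : fset b x -> fset b y -> x < y ->
  gr (x + 1) <= y /\ forall z, z <= x -> g z <= y.
Proof.
  intros (i & Hi & Ei) (j & Hj & Ej) Hxy.
  assert (Hij : i + 1 <= j).
  { apply NNPP. intro Hn. apply nle_lt in Hn. pose proof (fast_mono b j i ltac:(ml)). ml. }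
  pose proof (fast_mono b (i + 1) j Hij) as L. rewrite fast_S, Ei, Ej in L. split; [ml|].
  intros z Hz. pose proof (msum_ge (x + 1) g z Hg Hz). ml.
Qed.
Lemma fset_inf b c : exists x, c <= x /\ fset b x.
Proof.
  exists (fast b c). pose proof (fast_mono b 0 c ltac:(ml)) as L.
  assert (E : msub c 0 = c) by (destruct (msub_spec c 0) as [_ E]; specialize (E ltac:(ml)); ml).
  rewrite E in L. split; [ml|]. exists c. split; auto. ml.
Qed.

Variable en : nat -> M.
Hypothesis en_surj : forall x, exists n, en n = x.
Variable J0 : M.
Hypothesis J0_ns : forall n, num n < J0.

(** If [Q] held of standard numbers only, it would be inductive, and Sigma^0_1 induction would make
    [J0] standard. *)
Lemma overspill (Q : M -> Prop) : Sg Q -> (forall n, Q (num n)) -> exists j, (forall n, num n < j) /\ Q j.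
Proof.
  intros HQ HN. apply NNPP. intro Hno.
  assert (K : forall j, Q j -> exists n, j = num n).
  { intros j Hj. apply NNPP. intro Hn. apply Hno. exists j. split; auto.
    induction n as [|n IH]; simpl.
    - destruct (zero_or_S j) as [E|[j' ->]]; [|ml]. exfalso. apply Hn. exists O. exact E.
    - destruct (lt_total (num n + 1) j) as [L|[L|L]]; auto; [|exfalso; ml].
      exfalso. apply Hn. exists (S n). symmetry. exact L. }
  assert (HA : forall j, Q j).
  { ind_sg; [exact HQ|exact (HN O)|]. intros j Hj. destruct (K j Hj) as [n ->]. exact (HN (S n)). }
  destruct (K J0 (HA J0)) as [n E]. pose proof (J0_ns n). rewrite E in H. exact (lt_irrefl _ H).
Qed.

Theorem good_cut a b0 : ord a -> sWO rA a -> exists I : M -> Prop,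
  I b0 /\ I a /\ (forall x y, x <= y -> I y -> I x) /\ (forall x, I x -> I (gr (x + 1))) /\ (forall x, I x -> I (g x)) /\
  (exists B, ~ I B) /\
  (forall c u, I u -> exists w, I w /\ forall x, x < u -> I (ap c x) -> ap c x <= w) /\
  (forall c, exists H, (forall n, I n -> exists m, I m /\ n < m /\ mem m H) /\
     ((forall i j, I i -> I j -> mem i H -> mem j H -> i < j -> mem (pr i j) c) \/
      (forall i j, I i -> I j -> mem i H -> mem j H -> i < j -> ~ mem (pr i j) c))) /\
  (forall c, ap c 0 = a -> exists x, I x /\ (~ I (ap c x) \/ ~ (ord (ap c (x + 1)) /\ olt (ap c (x + 1)) (ap c x)))).
Proof.
  intros Ho HW. set (k := lead a).
  (* An ordinal with leading exponent [k] has [k + 1] coefficients; moreover the exponent stays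
     positive when [k] is 0. *)
  assert (HWk : WOk (k + 1)) by (apply WOk_add; [apply wo_lead; auto|apply WOk_1]).
  assert (Hla : ent a 0 <= k \/ len a = 0).
  { unfold k, lead. destruct (classic (len a = 0)) as [E|E]; [auto|left; rewrite ifm_f by auto; ml]. }
  set (b1 := a + b0 + 1 + 1). assert (HX : Dl (fset b1)) by (unfold fset; pose proof (fast_rc b1); rc).
  destruct (overspill (fun j => exists w, (forall x, x < fst w -> mem x (fst w) -> fset b1 x /\ b1 <= x /\ x < snd w) /\
      LL (Ex (k + 1) j) (fst w) b1 (snd w))) as (J & HJ & w & Hw1 & Hw2).
  { apply Sg_ex, Sg_Dl. pose proof (Rc_Ex (k + 1)). rc. }
  { intro n. destruct (large_exists (Ex (k + 1) (num n)) (fset b1) b1) as (F & v & A & B); auto.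
    - apply WOk_Ex, HWk.
    - apply fset_inf.
    - exists (pr F v). rewrite fst_pr, snd_pr. auto. }
  set (F0 := fst w) in *. set (V0 := snd w) in *.
  assert (HF0 : forall x, mem x F0 -> fset b1 x /\ b1 <= x /\ x < V0) by (intros; apply Hw1; auto using mem_lt).
  assert (HS0 : sparse F0).
  { intros x _ y _ Hx Hy Hxy. apply (fset_sparse b1 x y); auto; apply HF0; auto. }
  (* Every code is treated infinitely often: a stage only creates a gap for arguments below the
     current [un n], while the cut needs one below each of its elements. *)
  set (c' := fun n : nat => en (Datatypes.fst (of_nat n))).
  (* Each stage uses up one factor 19. As [J] is nonstandard, [msub J (num n)] remains positive at
     all stages, which are indexed by standard numbers. *)
  set (Inv := fun (n : nat) (t : M * M * M) => let '(F, u, v) := t in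
    (forall x, mem x F -> mem x F0 /\ u <= x /\ x < v) /\ b1 <= u /\ LL (Ex (k + 1) (msub J (num n))) F u v).
  set (Rel := fun (n : nat) (t t' : M * M * M) => let '(F, u, v) := t in let '(F', u', v') := t' in
     stepR k a (c' n) F u v F' u' v').
  assert (HJs : forall n, msub J (num n) = msub J (num (S n)) + 1).
  { intro n. simpl. pose proof (HJ (S n)) as L. simpl in L. destruct (msub_spec J (num n)) as [_ E1].
    destruct (msub_spec J (num n + 1)) as [_ E2]. specialize (E1 ltac:(ml)). specialize (E2 ltac:(ml)). ml. }
  assert (Hstep : forall n t, Inv n t -> exists t', Inv (S n) t' /\ Rel n t t').
  { intros n [[F u] v] (I1 & I2 & I3). rewrite HJs in I3.
    assert (HSF : sparse F). { eapply sparse_sub; [|exact HS0]. intros x Hx. apply I1, Hx. }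
    destruct (cut_refine k a (msub J (num (S n))) F u v (c' n)) as (F' & u' & v' & K1 & K2); auto; [unfold b1 in I2; ml|unfold b1 in I2; ml|].
    exists (F', u', v'). pose proof K2 as (K3 & K4 & (e & K5 & K6 & K7) & _). split; [|exact K2]. split; [|split; [ml|exact K1]].
    intros x Hx. apply K3 in Hx as (X1 & X2 & X3). split; auto. apply I1, X1. }
  set (st := fix st n := match n with O => (F0, b1, V0) | S n => epsilon (inhabits (F0, b1, V0)) (fun t => Inv (S n) t /\ Rel n (st n) t) end).
  assert (HI : forall n, Inv n (st n)).
  { induction n as [|n IH].
    - change ((forall x, mem x F0 -> mem x F0 /\ b1 <= x /\ x < V0) /\ b1 <= b1 /\ LL (Ex (k + 1) (msub J 0)) F0 b1 V0).
      split; [intros x Hx; split; [auto|apply HF0; auto]|]. split; [ml|].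
      assert (E0 : msub J 0 = J) by (destruct (msub_spec J 0) as [_ E]; specialize (E ltac:(ml)); ml).
      rewrite E0. exact Hw2.
    - simpl. exact (proj1 (epsilon_spec (inhabits (F0, b1, V0)) (fun t => Inv (S n) t /\ Rel n (st n) t) (Hstep n _ IH))). }
  assert (HR : forall n, Rel n (st n) (st (S n))).
  { intro n. simpl. exact (proj2 (epsilon_spec (inhabits (F0, b1, V0)) (fun t => Inv (S n) t /\ Rel n (st n) t) (Hstep n _ (HI n)))). }
  set (Fn := fun n => Datatypes.fst (Datatypes.fst (st n))). set (un := fun n => Datatypes.snd (Datatypes.fst (st n))).
  set (vn := fun n => Datatypes.snd (st n)).
  assert (HI' : forall n, (forall x, mem x (Fn n) -> mem x F0 /\ un n <= x /\ x < vn n) /\ b1 <= un n).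
  { intro n. pose proof (HI n) as H. unfold Fn, un, vn. destruct (st n) as [[F u] v]. simpl. destruct H as (A & B & _). auto. }
  assert (HR' : forall n, stepR k a (c' n) (Fn n) (un n) (vn n) (Fn (S n)) (un (S n)) (vn (S n))).
  { intro n. pose proof (HR n) as H. unfold Fn, un, vn. unfold Rel in H. destruct (st n) as [[F u] v].
    destruct (st (S n)) as [[F' u'] v']. exact H. }
  clearbody Fn un vn. clear st HI HR Hstep Inv Rel.
  assert (Hel : forall n, exists e, mem e (Fn n) /\ un n <= e /\ e < un (S n)) by (intro n; apply (HR' n)).
  assert (Hun : forall n, un n < un (S n)) by (intro n; destruct (Hel n) as (e & _ & A & B); ml).
  assert (Hunm : forall n m, (n <= m)%nat -> un n <= un m).
  { induction 1 as [|m _ IH]; [ml|]. pose proof (Hun m). ml. }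
  assert (HFm : forall n m, (n <= m)%nat -> forall x, mem x (Fn m) -> mem x (Fn n)).
  { induction 1 as [|m _ IH]; auto. intros x Hx. apply IH. apply (HR' m), Hx. }
  assert (Huv : forall n m, un n < vn m).
  { intros n m. destruct (Hel (n + m)%nat) as (e & A & B & _). pose proof (Hunm n (n + m)%nat ltac:(lia)).
    apply (HFm m) in A; [|lia]. apply HI' in A as (_ & _ & A). ml. }
  set (I := fun x => exists n, x < un n).
  assert (HIu : forall n, I (un n)) by (intro n; exists (S n); auto).
  assert (HIv : forall x n, I x -> x < vn n) by (intros x n [m Hm]; pose proof (Huv m n); ml).
  (* Two elements of [F0] above [x] and inside the cut: the larger bounds what [gr] and [g] do to
     the smaller, hence to [x]. *)
  assert (Hgrow : forall x, I x -> exists e e', x <= e /\ mem e F0 /\ mem e' F0 /\ e < e' /\ I e').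
  { intros x [n Hn]. destruct (Hel n) as (e & A & B & C). destruct (Hel (S n)) as (e' & A' & B' & C').
    exists e, e'. split; [ml|]. split; [apply (HI' n), A|]. split; [apply (HI' (S n)), A'|]. split; [ml|]. exists (S (S n)). exact C'. }
  assert (Hdown : forall x y, x <= y -> I y -> I x) by (intros x y Hxy [n Hn]; exists n; ml).
  exists I. split; [exists O; pose proof (proj2 (HI' O)); unfold b1 in *; ml|].
  split; [exists O; pose proof (proj2 (HI' O)); unfold b1 in *; ml|]. split; auto.
  split; [|split; [|split; [|split; [|split]]]].
  - intros x Hx. destruct (Hgrow x Hx) as (e & e' & E1 & E2 & E3 & E4 & E5). apply (Hdown _ e'); auto.
    assert (L : gr (x + 1) <= gr (e + 1)).
    { unfold gr. apply pow2_mono, pow2_mono. ml. }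
    pose proof (sparse_gr F0 e e' HS0 E2 E3 E4). ml.
  - intros x Hx. destruct (Hgrow x Hx) as (e & e' & E1 & E2 & E3 & E4 & E5). apply (Hdown _ e'); auto.
    apply (fset_sparse b1 e e'); auto; apply HF0; auto.
  - exists (vn O). intro H. apply (HIv _ O) in H. exact (lt_irrefl _ H).
  - intros c u [m Hm]. destruct (en_surj c) as [i Ei]. set (n := to_nat (i, m)).
    assert (En : c' n = c) by (unfold c', n; rewrite cancel_of_to; exact Ei).
    assert (Hnm : (m <= n)%nat) by (pose proof (to_nat_non_decreasing i m); unfold n; lia).
    destruct (HR' n) as (_ & _ & _ & Hgap & _). rewrite En in Hgap.
    exists (un (S n)). split; auto. intros x Hx HIx. pose proof (Hunm m n Hnm).
    destruct (Hgap x) as [L|L]; auto; [ml|]. exfalso. apply (HIv _ (S n)) in HIx. ml.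
  - intros c. destruct (en_surj c) as [i Ei]. set (n := to_nat (i, O)).
    assert (En : c' n = c) by (unfold c', n; rewrite cancel_of_to; exact Ei).
    destruct (HR' n) as (_ & _ & _ & _ & Hh & _). rewrite En in Hh.
    exists (Fn (S n)). split.
    + intros x [m Hm]. destruct (Hel (m + S n)%nat) as (e & A & B & C).
      exists e. split; [eexists; exact C|]. pose proof (Hunm m (m + S n)%nat ltac:(lia)). split; [ml|].
      apply (HFm (S n)) in A; auto. lia.
    + destruct Hh as [Hh|Hh]; [left|right]; intros x y _ _ Hx Hy Hxy.
      * exact (proj1 (homg_iff _ _) Hh x y Hx Hy Hxy).
      * exact (proj1 (homg_iff _ _) Hh x y Hx Hy Hxy).
  - intros c Hca. destruct (en_surj c) as [i Ei]. set (n := to_nat (i, O)).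
    assert (En : c' n = c) by (unfold c', n; rewrite cancel_of_to; exact Ei).
    destruct (HR' n) as (_ & _ & _ & _ & _ & Hk). rewrite En in Hk.
    destruct (Hk Hca) as (x & Hx & Hd). exists x. split; [apply (Hdown _ (un (S n))); auto; ml|].
    destruct Hd as [Hd|Hd]; [left|right; auto]. intro HIx. apply (HIv _ (S n)) in HIx. ml.
Qed.
End Cut.

(** * The structure carried by the cut *)

(** Absoluteness of bounded formulas: every element below an image is itself an image, so bounded
    quantifiers have the same range on both sides. *)
Lemma bd_abs (A B : struct) (q : dom A -> dom B) :
  q (s_zero A) = s_zero B -> q (s_one A) = s_one B ->
  (forall x y, q (s_add A x y) = s_add B (q x) (q y)) -> (forall x y, q (s_mul A x y) = s_mul B (q x) (q y)) ->
  (forall x y, s_lt A x y <-> s_lt B (q x) (q y)) -> (forall x y, q x = q y -> x = y) ->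
  (forall y x, s_lt B y (q x) -> exists z, q z = y) ->
  forall p, Bounded p -> forall e s s', (forall X x, s_mem A x (s X) <-> s_mem B (q x) (s' X)) ->
  (sat A p e s <-> sat B p (fun n => q (e n)) s').
Proof.
  intros H0 H1 Ha Hm Hl Hi Hd.
  assert (HT : forall t e, q (teval A t e) = teval B t (fun n => q (e n))).
  { induction t; intro e; simpl; auto; [rewrite Ha|rewrite Hm]; now rewrite IHt1, IHt2. }
  assert (HE : forall x e, (fun n => q ((x .: e) n)) = (q x .: fun n => q (e n))).
  { intros. apply functional_extensionality; intros [|n]; reflexivity. }
  assert (HL : forall t x e, teval B (tlift t) (q x .: fun n => q (e n)) = q (teval A t e)).
  { intros. unfold tlift. rewrite teval_subst. simpl. now rewrite HT. }
  assert (HLA : forall t x e, teval A (tlift t) (x .: e) = teval A t e).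
  { intros. unfold tlift. now rewrite teval_subst. }
  assert (HLB : forall t x e, teval B (tlift t) (x .: e) = teval B t e).
  { intros. unfold tlift. now rewrite teval_subst. }
  induction 1 as [a b|a b|a X| |p r Bp IHp Br IHr|p r Bp IHp Br IHr|p r Bp IHp Br IHr|t p Bp IHp|t p Bp IHp];
    intros e s s' HS; cbn [sat].
  - rewrite <- !HT. split; [congruence|apply Hi].
  - rewrite <- !HT. apply Hl.
  - rewrite <- HT. apply HS.
  - tauto.
  - rewrite (IHp e s s'), (IHr e s s') by auto. tauto.
  - rewrite (IHp e s s'), (IHr e s s') by auto. tauto.
  - rewrite (IHp e s s'), (IHr e s s') by auto. tauto.
  - unfold fball. cbn [sat]. simpl teval. setoid_rewrite HLA. setoid_rewrite HLB. rewrite <- HT. split.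
    + intros H y Hy. simpl in Hy. destruct (Hd _ _ Hy) as [z <-]. rewrite <- HE. apply (IHp (z .: e) s s' HS).
      apply H. simpl. apply Hl, Hy.
    + intros H x Hx. simpl in Hx. apply (IHp (x .: e) s s' HS). rewrite HE. apply H. simpl. apply Hl, Hx.
  - unfold fbex. cbn [sat]. simpl teval. setoid_rewrite HLA. setoid_rewrite HLB. rewrite <- HT. split.
    + intros (x & Hx & H). exists (q x). simpl in *. split; [apply Hl, Hx|]. rewrite <- HE. apply (IHp (x .: e) s s' HS), H.
    + intros (y & Hy & H). simpl in Hy. destruct (Hd _ _ Hy) as [z <-]. exists z. simpl. split; [apply Hl, Hy|].
      apply (IHp (z .: e) s s' HS). rewrite HE. exact H.
Qed.

Section Model.
Context `{R : RM}.
Add Ring Mring14 : M_srt.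

(** The numbers of the model with an exchangeable sort of sets: codes of finite sets when evaluating
    formulas of the cut, the original sets when returning to the model. *)
Definition mst (S : Type) (mm : M -> S -> Prop) : struct :=
  Struct M S 0 1 (s_add rA) (s_mul rA) (s_lt rA) mm.
Lemma sat_mst p : forall e s, sat (mst (sset rA) (s_mem rA)) p e s <-> sat rA p e s.
Proof.
  assert (HT : forall t e, teval (mst (sset rA) (s_mem rA)) t e = teval rA t e).
  { induction t; intro e; simpl; congruence. }
  induction p; intros e s; simpl; rewrite ?HT; try tauto; try (rewrite IHp1, IHp2; tauto).
  all: split; first [intros H x; specialize (H x)|intros [x H]; exists x]; apply IHp, H.
Qed.

Lemma Dl_sat S (mm : M -> S -> Prop) : (forall X, Dl (fun x => mm x X)) ->
  forall p, Bounded p -> forall (E : nat -> M -> M), (forall n, Rc (E n)) -> forall s,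
  Dl (fun z => sat (mst S mm) p (fun n => E n z) s).
Proof.
  intro HM.
  assert (HLT : forall t x e, teval (mst S mm) (tlift t) (x .: e) = teval (mst S mm) t e).
  { intros. unfold tlift. now rewrite teval_subst. }
  assert (HT : forall t E, (forall n, Rc (E n)) -> Rc (fun z => teval (mst S mm) t (fun n => E n z))).
  { induction t; intros E HE; simpl.
    - apply HE.
    - apply Rc_const.
    - apply Rc_const.
    - apply Rc_add; auto.
    - apply Rc_mul; auto. }
  assert (HQ : forall p E s, (forall E, (forall n, Rc (E n)) -> forall s, Dl (fun z => sat (mst S mm) p (fun n => E n z) s)) ->
    (forall n, Rc (E n)) -> Dl (fun w => sat (mst S mm) p (snd w .: fun n => E n (fst w)) s)).
  { intros p E s IH HE.
    eapply Dl_ext; [|apply (IH (fun n w => match n with O => snd w | S n => E n (fst w) end)) with (s := s)].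
    - intro w. cbv beta. replace (fun n => match n with O => snd w | Datatypes.S n0 => E n0 (fst w) end)
        with (snd w .: fun n => E n (fst w)); [tauto|]. apply functional_extensionality; intros [|n]; reflexivity.
    - intros [|n]; [apply Rc_snd|]. apply Rc_comp; auto using Rc_fst. }
  induction 1 as [a b|a b|a X| |p r Bp IHp Br IHr|p r Bp IHp Br IHr|p r Bp IHp Br IHr|t p Bp IHp|t p Bp IHp];
    intros E HE s; cbn [sat].
  - apply Dl_eq; auto.
  - apply (Dl_lt (fun z => teval (mst S mm) a (fun n => E n z)) (fun z => teval (mst S mm) b (fun n => E n z))); auto.
  - apply (Dl_comp (fun x => mm x (s X))); auto.
  - apply Dl_const.
  - apply Dl_imp; auto.
  - apply Dl_and; auto.
  - apply Dl_or; auto.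
  - eapply Dl_ext; [|apply (Dl_ball (fun z => teval (mst S mm) t (fun n => E n z))
      (fun z i => sat (mst S mm) p (i .: fun n => E n z) s)); auto].
    intro z. cbn [sat]. split; intros H i Hi; apply H; revert Hi; simpl; rewrite HLT; auto.
  - eapply Dl_ext; [|apply (Dl_bex (fun z => teval (mst S mm) t (fun n => E n z))
      (fun z i => sat (mst S mm) p (i .: fun n => E n z) s)); auto].
    intro z. cbn [sat]. split; intros (i & Hi & H); exists i; split; auto; revert Hi; simpl; rewrite HLT; auto.
Qed.

(* A binary string has many codes as a sequence.  A cut closed under [canb] contains a
   canonical one for every string of its lengths, which is what weak Koenig's lemma needs. *)
Definition can (s k : M) : M :=
  let t := tab k (fun i => ifm (mem i s) 1 0) in pr k (pr (fst t) (snd t)).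
Definition canb (k : M) : M := msum (pow2 k) (fun s => can s k).
Lemma Rc_can f h : Rc f -> Rc h -> Rc (fun z => can (f z) (h z)).
Proof. intros. unfold can. cbv zeta. rc. Qed.
Lemma Rc_canb : Rc canb.
Proof.
  unfold canb. assert (H : Rc (fun w => can (fst w) (snd w))) by (apply Rc_can; rc). rc.
Qed.
Lemma can_le s k : s < pow2 k -> can s k <= canb k.
Proof. intro H. apply (msum_ge (pow2 k) (fun s => can s k)); auto. apply Rc_can; rc. Qed.
Lemma can_spec s k : sq (can s k) /\ len (can s k) = k /\ forall i, i < k -> ent (can s k) i = ifm (mem i s) 1 0.
Proof.
  unfold can. split; [apply sq_pr|]. split; [unfold len; apply fst_pr|]. intros i Hi. unfold ent. rewrite snd_pr.
  assert (E : forall c, ap (pr (fst c) (snd c)) i = ap c i) by (intro c; unfold ap; now rewrite fst_pr, snd_pr).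
  rewrite E. apply (tab_spec k (fun i => ifm (mem i s) 1 0)); auto. rc.
Qed.

Variable I : M -> Prop.
Hypothesis I_down : forall x y, x <= y -> I y -> I x.
Hypothesis I_gr : forall x, I x -> I (gr (x + 1)).
Hypothesis I_canb : forall x, I x -> I (canb x).
Variable a : M.
Hypothesis I_a : I a.
Variable B : M.
Hypothesis I_B : ~ I B.
Hypothesis I_gap : forall c u, I u -> exists w, I w /\ forall x, x < u -> I (ap c x) -> ap c x <= w.
Hypothesis I_RT : forall c, exists H, (forall n, I n -> exists m, I m /\ n < m /\ mem m H) /\
     ((forall i j, I i -> I j -> mem i H -> mem j H -> i < j -> mem (pr i j) c) \/
      (forall i j, I i -> I j -> mem i H -> mem j H -> i < j -> ~ mem (pr i j) c)).
Hypothesis I_kill : forall c, ap c 0 = a ->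
  exists x, I x /\ (~ I (ap c x) \/ ~ (ord (ap c (x + 1)) /\ olt (ap c (x + 1)) (ap c x))).

Lemma I_lt_B x : I x -> x < B.
Proof. intro Hx. apply NNPP. intro Hn. apply I_B, (I_down _ x); auto. ml. Qed.
Lemma I_0 : I 0.
Proof. apply (I_down _ a); auto. ml. Qed.
Lemma I_add_mul x y : I x -> I y -> I (x + y) /\ I (x * y).
Proof.
  intros Hx Hy. assert (HZ : exists z, I z /\ x <= z /\ y <= z).
  { destruct (lt_total x y) as [L|[L|L]]; [exists y|exists y|exists x]; repeat split; auto; ml. }
  destruct HZ as (z & Hz & L1 & L2). apply I_gr in Hz. pose proof (gr_sq (z + 1)) as L.
  replace ((z + 1) * (z + 1)) with (z * z + z + z + 1) in L by ring.
  pose proof (mul_le2 _ _ _ _ L1 L2). split; apply (I_down _ (gr (z + 1))); auto; ml.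
Qed.
Lemma I_1 : I 1.
Proof. apply (I_down _ (gr (0 + 1))); [|apply I_gr, I_0]. pose proof (gr_gt (0 + 1)). ml. Qed.

Definition dI : Type := {x : M | I x}.
Definition pj (x : dI) : M := proj1_sig x.
(** Every code of the model, also one outside the cut, serves as a set; it denotes the trace on the
    cut of the finite set that it codes. *)
Definition Ist : struct := Struct dI M
  (exist _ 0 I_0) (exist _ 1 I_1)
  (fun x y => exist _ (pj x + pj y) (proj1 (I_add_mul _ _ (proj2_sig x) (proj2_sig y))))
  (fun x y => exist _ (pj x * pj y) (proj2 (I_add_mul _ _ (proj2_sig x) (proj2_sig y))))
  (fun x y => pj x < pj y) (fun x c => mem (pj x) c).
Lemma pj_inj (x y : dI) : pj x = pj y -> x = y.
Proof. destruct x, y. simpl. intro. subst. f_equal. apply proof_irrelevance. Qed.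
Lemma pj_in (x : dI) : I (pj x).
Proof. exact (proj2_sig x). Qed.
Lemma pj_ex x : I x -> exists z : dI, pj z = x.
Proof. intro H. exists (exist _ x H). reflexivity. Qed.
Lemma pj_init x (y : dI) : x <= pj y -> exists z : dI, pj z = x.
Proof. intro H. apply pj_ex. apply (I_down _ (pj y)); auto. apply pj_in. Qed.

Lemma I_abs S (mm : M -> S -> Prop) p e s s' : Bounded p ->
  (forall X x, mem (pj x) (s X) <-> mm (pj x) (s' X)) ->
  (sat Ist p e s <-> sat (mst S mm) p (fun n => pj (e n)) s').
Proof.
  intros HB HS. apply (bd_abs Ist (mst S mm) pj); auto; try reflexivity.
  - apply pj_inj.
  - intros y x H. apply (pj_init y x). simpl in H. ml.
Qed.

(** Tabulate the least witness below [B] for each argument up to [b]. By the gap property the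
    witnesses that lie in the cut have a bound [w] in the cut; up to [b] the induction predicate is
    thus equivalent to one with the quantifier bounded by [w], for which the induction of the model
    applies. *)
Lemma I_ind (th : M -> M -> Prop) : Dl (fun w => th (fst w) (snd w)) ->
  (exists y, I y /\ th 0 y) ->
  (forall x, I x -> (exists y, I y /\ th x y) -> exists y, I y /\ th (x + 1) y) ->
  forall x, I x -> exists y, I y /\ th x y.
Proof.
  intros HD H0 HS b Hb.
  set (f := fun x => mub B (fun y => th x y)).
  assert (Hf : Rc f) by (unfold f; rc).
  destruct (I_gap (tab (b + 1) f) (b + 1)) as (w & Hw & Hgap).
  { apply I_add_mul; auto using I_1. }
  assert (K : forall x, x <= b -> ((exists y, I y /\ th x y) <-> exists y, y <= w /\ th x y)).
  { intros x Hx. split.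
    - intros (y & Hy & Ht). exists (f x).
      destruct (mub_ex B (fun y => th x y) y) as [A1 A2]; [rc|auto|pose proof (I_lt_B y Hy); ml|]. fold (f x) in A1, A2.
      split; auto. pose proof (Hgap x ltac:(ml)) as G. rewrite (tab_spec (b + 1) f Hf x ltac:(ml)) in G. apply G.
      apply (I_down _ y); auto.
    - intros (y & Hy & Ht). exists y. split; auto. apply (I_down _ w); auto. }
  apply K; [ml|].
  assert (KK : forall x, x <= b -> exists y, y <= w /\ th x y); [|apply KK; ml].
  ind_dl; [rc| |].
  - intros _. apply K; auto. ml.
  - intros x IH Hx. apply K; auto. apply HS; [apply (I_down _ b); auto; ml|]. apply K; [ml|]. apply IH. ml.
Qed.

(** For [x] in the cut, either a witness of [th] or a counterexample to [et] exists in the cut. The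
    least such number found below [B] then also lies in the cut and decides the membership of [x]
    recursively. *)
Lemma I_comp (th et : M -> M -> Prop) : Dl (fun w => th (fst w) (snd w)) -> Dl (fun w => et (fst w) (snd w)) ->
  (forall x, I x -> ((exists y, I y /\ th x y) <-> (forall y, I y -> et x y))) ->
  exists c, forall x, I x -> (mem x c <-> exists y, I y /\ th x y).
Proof.
  intros Ht He HE. set (m := fun x => mub B (fun t => th x t \/ ~ et x t)).
  assert (Hm : Rc m) by (unfold m; rc).
  exists (setc B (fun x => th x (m x))). intros x Hx. rewrite mem_setc by rc.
  assert (Hmx : I (m x) /\ (th x (m x) \/ ~ et x (m x))).
  { assert (HT : exists t, I t /\ (th x t \/ ~ et x t)).
    { destruct (classic (exists y, I y /\ th x y)) as [(y & Hy & Hth)|Hn]; [exists y; auto|].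
      rewrite HE in Hn by auto. apply not_all_ex_not in Hn as [y Hy]. exists y. apply imply_to_and in Hy. tauto. }
    destruct HT as (t & Hti & HT). destruct (mub_ex B (fun t => th x t \/ ~ et x t) t) as [A1 A2]; [rc|auto|pose proof (I_lt_B t Hti); ml|].
    fold (m x) in *. split; auto. apply (I_down _ t); auto. }
  destruct Hmx as [M1 M2]. split.
  - intros [_ H]. exists (m x). auto.
  - intro H. split; [apply I_lt_B; auto|]. destruct M2 as [M2|M2]; auto. exfalso. apply M2. apply (proj1 (HE x Hx) H); auto.
Qed.

Lemma Sigma1_inv p : Sigma 1 p -> Bounded p \/ exists q, p = fex q /\ Bounded q.
Proof. intro H. inversion H as [|n q Hq]; subst; auto. right. exists q. split; auto. inversion Hq; auto. Qed.
Lemma Pi1_inv p : Pi 1 p -> Bounded p \/ exists q, p = fall q /\ Bounded q.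
Proof. intro H. inversion H as [|n q Hq]; subst; auto. right. exists q. split; auto. inversion Hq; auto. Qed.

Definition thf (q : form) (e : nat -> dI) (s : nat -> M) (x y : M) : Prop :=
  sat (mst M mem) q (y .: x .: fun n => pj (e n)) s.
Definition thb (q : form) (e : nat -> dI) (s : nat -> M) (x y : M) : Prop :=
  sat (mst M mem) q (x .: fun n => pj (e n)) s.
Lemma Dl_thf q e s : Bounded q -> Dl (fun w => thf q e s (fst w) (snd w)).
Proof.
  intro HB. unfold thf.
  eapply Dl_ext; [|apply (Dl_sat M mem) with (E := fun n w => match n with O => snd w | S O => fst w | S (S n) => pj (e n) end) (s := s)];
    [|intro X; rc|exact HB|intros [|[|n]]; [apply Rc_snd|apply Rc_fst|apply Rc_const]].
  intro w. cbv beta. match goal with |- sat _ _ ?u _ <-> sat _ _ ?v _ => replace u with v; [tauto|] end.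
  apply functional_extensionality; intros [|[|n]]; reflexivity.
Qed.
Lemma Dl_thb q e s : Bounded q -> Dl (fun w => thb q e s (fst w) (snd w)).
Proof.
  intro HB. unfold thb.
  eapply Dl_ext; [|apply (Dl_sat M mem) with (E := fun n w => match n with O => fst w | S n => pj (e n) end) (s := s)];
    [|intro X; rc|exact HB|intros [|n]; [apply Rc_fst|apply Rc_const]].
  intro w. cbv beta. match goal with |- sat _ _ ?u _ <-> sat _ _ ?v _ => replace u with v; [tauto|] end.
  apply functional_extensionality; intros [|n]; reflexivity.
Qed.
Lemma thf_iff q e s (x y : dI) : Bounded q -> (sat Ist q (y .: x .: e) s <-> thf q e s (pj x) (pj y)).
Proof.
  intro HB. rewrite (I_abs M mem q _ s s HB) by tauto. unfold thf.
  match goal with |- sat _ _ ?u _ <-> sat _ _ ?v _ => replace u with v; [tauto|] end.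
  apply functional_extensionality; intros [|[|n]]; reflexivity.
Qed.
Lemma thb_iff q e s (x : dI) y : Bounded q -> (sat Ist q (x .: e) s <-> thb q e s (pj x) y).
Proof.
  intro HB. rewrite (I_abs M mem q _ s s HB) by tauto. unfold thb.
  match goal with |- sat _ _ ?u _ <-> sat _ _ ?v _ => replace u with v; [tauto|] end.
  apply functional_extensionality; intros [|n]; reflexivity.
Qed.

Lemma Sigma1_sem p e s : Sigma 1 p -> exists th, Dl (fun w => th (fst w) (snd w)) /\
  forall x : dI, sat Ist p (x .: e) s <-> exists y, I y /\ th (pj x) y.
Proof.
  intro HS. apply Sigma1_inv in HS as [HB|(q & -> & HB)].
  - exists (thb p e s). split; [apply Dl_thb; auto|]. intro x. rewrite (thb_iff p e s x 0 HB). split.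
    + intro H. exists 0. split; [apply I_0|exact H].
    + intros (y & _ & H). exact H.
  - exists (thf q e s). split; [apply Dl_thf; auto|]. intro x. cbn [sat]. split.
    + intros [y Hy]. exists (pj y). split; [apply pj_in|]. apply thf_iff; auto.
    + intros (y & Hy & H). destruct (pj_ex y Hy) as [z <-]. exists z. apply thf_iff; auto.
Qed.
Lemma Pi1_sem p e s : Pi 1 p -> exists th, Dl (fun w => th (fst w) (snd w)) /\
  forall x : dI, sat Ist p (x .: e) s <-> forall y, I y -> th (pj x) y.
Proof.
  intro HS. apply Pi1_inv in HS as [HB|(q & -> & HB)].
  - exists (thb p e s). split; [apply Dl_thb; auto|]. intro x. rewrite (thb_iff p e s x 0 HB). split.
    + intros H y _. exact H.
    + intro H. exact (H 0 I_0).
  - exists (thf q e s). split; [apply Dl_thf; auto|]. intro x. cbn [sat]. split.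
    + intros H y Hy. destruct (pj_ex y Hy) as [z <-]. apply thf_iff; auto.
    + intros H y. apply thf_iff; auto. apply H, pj_in.
Qed.

Lemma sat_closure_intro A p : (forall e s, sat A p e s) -> forall e s, sat A (closure p) e s.
Proof.
  intro H. unfold closure. generalize (ffvN p) (ffvS p). intros n m.
  induction m as [|m IH]; simpl; auto. induction n as [|n IH]; simpl; auto.
Qed.

Lemma Ist_RCA0 p : RCA0 p -> forall e s, sat Ist p e s.
Proof.
  intros [q Hq|q Hq|q r Hq Hr].
  - intros e s. destruct Hq; cbn [sat fnot fiff teval Defs.succ v0 v1]; unfold v0, v1, Defs.succ; simpl; intros;
      try apply pj_inj; simpl.
    + apply (f_equal pj) in H. exact (S_neq0 _ H).
    + apply (f_equal pj) in H. exact (S_inj _ _ H).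
    + exact (nlt0 _ H).
    + rewrite lt_S. split; (intros [L|L]; [left; exact L|right]); [apply pj_inj, L|apply (f_equal pj), L].
    + apply add_0_r.
    + apply add_S_r.
    + apply mul_0_r.
    + apply mul_S_r.
  - apply sat_closure_intro. intros e s. cbn [sat]. intros [H0 HS].
    destruct (Sigma1_sem q e s Hq) as (th & HD & HT).
    intro x. apply HT. apply (I_ind th HD); [| |apply pj_in].
    + apply sat_instN in H0. apply HT in H0. exact H0.
    + intros y Hy Hex. destruct (pj_ex y Hy) as [z <-]. apply HT in Hex. apply HS in Hex.
      unfold nextN in Hex. apply sat_subst in Hex.
      match type of Hex with sat _ _ ?u _ => replace u with (s_add Ist z (s_one Ist) .: e) in Hex end;
        [|apply functional_extensionality; intros [|n]; reflexivity].
      apply HT in Hex. exact Hex.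
  - apply sat_closure_intro. intros e s. cbn [sat]. intros HE.
    destruct (Sigma1_sem q e s Hq) as (th & HD & HT). destruct (Pi1_sem r e s Hr) as (et & HD' & HT').
    destruct (I_comp th et HD HD') as [c Hc].
    + intros x Hx. destruct (pj_ex x Hx) as [z <-]. rewrite <- HT, <- HT'. specialize (HE z). cbn [sat fiff] in HE. tauto.
    + exists c. intro x. unfold fiff. cbn [sat]. rewrite sat_liftS. simpl. rewrite HT. rewrite Hc by apply pj_in. tauto.
Qed.

Ltac emb := first [reflexivity | apply pj_inj | apply pj_init | (intros; reflexivity) | (intros; tauto)].

Lemma Ist_Len c k : sLen Ist c k <-> sq (pj c) /\ pj k = len (pj c).
Proof. apply (sLen_iff Ist pj); emb. Qed.
Lemma Ist_Entry c i e : sEntry Ist c i e <-> sq (pj c) /\ pj e = ent (pj c) (pj i).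
Proof. apply (sEntry_iff Ist pj); emb. Qed.
Lemma Ist_Seq c : sSeq Ist c <-> sq (pj c).
Proof. apply (sSeq_iff Ist pj); emb. Qed.
Lemma Ist_Ord c : sOrd Ist c <-> ord (pj c).
Proof. apply (sOrd_iff Ist pj); emb. Qed.
Lemma Ist_Olt c d : sOlt Ist c d <-> olt (pj c) (pj d).
Proof. apply (sOlt_iff Ist pj); emb. Qed.
Lemma Ist_Same c c' i : sq (pj c) -> sq (pj c') -> (sSame Ist c c' i <-> ent (pj c) (pj i) = ent (pj c') (pj i)).
Proof. apply (sSame_iff Ist pj); emb. Qed.

Lemma Ist_RT : sRT Ist.
Proof.
  intro c. destruct (I_RT c) as (H & H1 & H2). exists H. split.
  - intro n. destruct (H1 (pj n) (pj_in n)) as (m & Hm & L & HmH). destruct (pj_ex m Hm) as [z <-]. exists z. split; auto.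
  - destruct H2 as [H2|H2]; [left|right]; intros i j Hi Hj Hij; apply (H2 (pj i) (pj j)); auto using pj_in.
Qed.

(** A descending sequence in the cut is the trace of a coded set. Least values below [B] extend it
    to a recursive function of the model, whose table is a code to which [I_kill] applies. At
    arguments in the cut the least value is the true one: it is in the cut, and values there are
    unique. *)
Lemma Ist_WO (x : dI) : pj x = a -> sWO Ist x.
Proof.
  intros Ex (Fs & H1 & H2 & H3 & H4).
  set (f := fun n => mub B (fun m => mem (pr n m) Fs)).
  assert (Hf : Rc f) by (unfold f; rc).
  assert (Ef : forall n m : dI, mem (pr (pj n) (pj m)) Fs -> f (pj n) = pj m).
  { intros n m Hm. destruct (mub_ex B (fun m => mem (pr (pj n) m) Fs) (pj m)) as [A1 A2]; [rc|auto|pose proof (I_lt_B _ (pj_in m)); ml|].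
    fold (f (pj n)) in *. destruct (pj_init _ m A2) as [z Ez]. rewrite <- Ez in *.
    f_equal. apply (H2 n z m); auto. }
  set (c := tab B f).
  assert (Ec : forall n, I n -> ap c n = f n) by (intros n Hn; apply (tab_spec B f Hf), I_lt_B, Hn).
  destruct (I_kill c) as (y & Hy & HK).
  { rewrite Ec by apply I_0. rewrite <- Ex. apply (Ef (exist _ 0 I_0) x). exact H3. }
  destruct (pj_ex y Hy) as [n <-]. set (n1 := s_add Ist n (s_one Ist)).
  destruct (H1 n) as [m Hm]. destruct (H1 n1) as [m1 Hm1].
  assert (E0 : ap c (pj n) = pj m) by (rewrite Ec by apply pj_in; apply Ef, Hm).
  assert (E1 : ap c (pj n + 1) = pj m1) by (rewrite (Ec (pj n + 1)) by apply (pj_in n1); apply (Ef n1 m1), Hm1).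
  rewrite E0, E1 in HK. destruct HK as [HK|HK]; [apply HK, pj_in|].
  apply HK. destruct (H4 n m m1 Hm Hm1) as [O1 O2]. apply Ist_Ord in O1. apply Ist_Olt in O2. auto.
Qed.

(** The least failure of [Q] is a successor, and its predecessor is outside the cut because the cut
    is closed under successor. *)
Lemma I_overspill (Q : M -> Prop) : Dl Q -> (forall k, I k -> Q k) -> exists k, ~ I k /\ Q k.
Proof.
  intros HQ HI. destruct (classic (exists k, ~ Q k)) as [HE|HN].
  - apply least in HE as (k & Hk & Hm); [|rc]. destruct (zero_or_S k) as [->|[k' ->]].
    + exfalso. apply Hk, HI, I_0.
    + exists k'. split; [|apply NNPP, Hm; ml]. intro Hk'. apply Hk, HI. apply I_add_mul; auto using I_1.
  - exists B. split; auto. apply NNPP. intro. apply HN; eauto.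
Qed.

(** For each length in the cut there is a string all of whose initial parts have their canonical
    code in the tree. By overspill this holds for a length outside the cut, and the trace of that
    string is the path. *)
Lemma Ist_WKL : sWKL Ist.
Proof.
  intros t (T1 & T2 & T3).
  set (res := fun s k => setc k (fun i => mem i s)).
  assert (Hres : forall s k i, mem i (res s k) <-> i < k /\ mem i s) by (intros; unfold res; rewrite mem_setc; [tauto|rc]).
  assert (HresR : Rc (fun w => res (fst w) (snd w))) by (unfold res; rc).
  assert (HcanR : Rc (fun w => can (fst w) (snd w))) by (apply Rc_can; rc).
  assert (HcI : forall s k, I k -> I (can (res s k) k)).
  { intros s k Hk. apply (I_down _ (canb k)); auto. apply can_le. unfold res. apply setc_lt. rc. }
  destruct (I_overspill (fun k => exists s, s < pow2 k /\ forall k', k' <= k -> mem (can (res s k') k') t)) as (K & HK & s & Hs & HT).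
  - rc.
  - intros k Hk. destruct (pj_ex k Hk) as [kk <-]. destruct (T3 kk) as (c & Hc & HL). apply Ist_Len in HL as [Hsq HL].
    pose proof (T1 c Hc) as [_ Hbin].
    assert (Hb : forall i : dI, pj i < pj kk -> ent (pj c) (pj i) < 1 + 1).
    { intros i Hi. destruct (pj_init _ c (ent_le (pj c) (pj i) Hsq)) as [e Ee]. rewrite <- Ee.
      apply (Hbin kk i e); auto; [apply Ist_Len; auto|apply Ist_Entry; auto]. }
    set (s := setc (pj kk) (fun i => ent (pj c) i = 1)).
    assert (Hs : forall i, mem i s <-> i < pj kk /\ ent (pj c) i = 1) by (intro; unfold s, ent; rewrite mem_setc; [tauto|rc]).
    exists s. split; [apply setc_lt; unfold ent; rc|]. intros k' Hk'.
    destruct (pj_init k' kk Hk') as [kk' <-]. destruct (pj_ex _ (HcI s (pj kk') (pj_in kk'))) as [c' Ec'].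
    destruct (can_spec (res s (pj kk')) (pj kk')) as (C1 & C2 & C3). rewrite <- Ec' in *.
    apply (T2 c c'); auto.
    + split; [apply Ist_Seq; auto|]. intros k0 i e Hk0 Hi He. apply Ist_Len in Hk0 as [_ Hk0]. apply Ist_Entry in He as [_ He].
      change (pj e < 1 + 1). change (pj i < pj k0) in Hi. rewrite He, C3 by congruence. unfold ifm. destruct (excluded_middle_informative _); ml.
    + exists kk', kk. rewrite !Ist_Len. split; [auto|]. split; [auto|]. split.
      * apply lt_S in Hk' as [L|L]; [left; exact L|right; apply pj_inj, L].
      * intros i Hi. change (pj i < pj kk') in Hi. apply Ist_Same; auto. rewrite C3 by auto.
        pose proof (Hb i ltac:(ml)) as L. destruct (classic (ent (pj c) (pj i) = 1)) as [E|E].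
        -- rewrite ifm_t; auto. apply Hres. split; auto. apply Hs. split; auto. ml.
        -- rewrite ifm_f; [|intro H; apply Hres in H as [_ H]; apply Hs in H; tauto].
           destruct (lt_total (ent (pj c) (pj i)) 1) as [X|[X|X]]; [ml|contradiction|ml].
  - exists s. intro k. assert (HkK : pj k <= K).
    { apply NNPP. intro Hn. apply HK, (I_down _ (pj k)); [ml|apply pj_in]. }
    destruct (pj_ex _ (HcI s (pj k) (pj_in k))) as [c Ec].
    destruct (can_spec (res s (pj k)) (pj k)) as (C1 & C2 & C3). rewrite <- Ec in C1, C2, C3.
    exists c. split; [|split].
    + change (mem (pj c) t). rewrite Ec. apply HT, HkK.
    + apply Ist_Len. auto.
    + intros i e Hi He. apply Ist_Entry in He as [_ He]. change (pj i < pj k) in Hi. rewrite C3 in He by auto.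
      change ((e = s_one Ist -> mem (pj i) s) /\ (mem (pj i) s -> e = s_one Ist)).
      assert (E01 : s_one rA <> 0). { intro E0. apply (S_neq0 0). rewrite add_0_l. exact E0. }
      split.
      * intro E. rewrite E in He. apply NNPP. intro Hn. rewrite ifm_f in He; [exact (E01 He)|].
        intro H. apply Hn. apply Hres in H. tauto.
      * intro H. apply pj_inj. rewrite He. apply ifm_t. apply Hres. auto.
Qed.
End Model.

(** * Conservation *)

Section Transfer.
Context `{R : RM}.
Add Ring Mring15 : M_srt.

(** Each universal quantifier is replaced by a counterexample. The number parameters remain below
    [b'], so that a cut above [b'] contains them; the last clause says that truth of [phi] in such a
    cut entails truth of the matrix at the same parameters, sets being sent to their traces by
    [tr]. *)
Lemma neg_unfold phi : AllSigma2 phi -> forall (e : nat -> M) s b, (forall n, e n <= b) -> ~ sat rA phi e s ->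
  exists p e' s' b', Sigma 2 p /\ b <= b' /\ (forall n, e' n <= b') /\ ~ sat rA p e' s' /\
  forall (N : struct) (tr : sset rA -> sset N) (q : dom N -> M), (forall y, y <= b' -> exists x, q x = y) ->
  forall eN, (forall n, q (eN n) = e n) -> sat N phi eN (fun X => tr (s X)) ->
  exists eN', (forall n, q (eN' n) = e' n) /\ sat N p eN' (fun X => tr (s' X)).
Proof.
  induction 1 as [p Hp|p Hp IH|p Hp IH]; intros e s b Hb Hn.
  - exists p, e, s, b. repeat split; auto; [ml|]. intros N tr q _ eN HE HS. exists eN. auto.
  - cbn [sat] in Hn. apply not_all_ex_not in Hn as [x Hx].
    destruct (IH (x .: e) s (b + x)) as (p' & e' & s' & b' & H1 & H2 & H3 & H4 & H5); auto.
    { intros [|n]; simpl; [ml|]. specialize (Hb n). ml. }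
    exists p', e', s', b'. split; [auto|]. split; [ml|]. do 2 (split; [auto|]).
    intros N tr q Hq eN HE HS. destruct (Hq x ltac:(ml)) as [z Hz]. apply (H5 N tr q Hq (z .: eN)); [|apply HS].
    intros [|n]; simpl; auto.
  - cbn [sat] in Hn. apply not_all_ex_not in Hn as [X HX].
    destruct (IH e (X .: s) b Hb HX) as (p' & e' & s' & b' & H1 & H2 & H3 & H4 & H5).
    exists p', e', s', b'. do 4 (split; [auto|]).
    intros N tr q Hq eN HE HS. apply (H5 N tr q Hq eN HE).
    replace (fun Y => tr ((X .: s) Y)) with (tr X .: fun Y => tr (s Y)); [apply HS|].
    apply functional_extensionality; intros [|n]; reflexivity.
Qed.

Lemma Sigma2_inv p : Sigma 2 p ->
  Bounded p \/ (exists q, p = fex q /\ Bounded q) \/ exists r, p = fex (fall r) /\ Bounded r.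
Proof.
  intro H. inversion H as [|n q Hq]; subst; auto. right.
  inversion Hq as [|n r Hr]; subst; [left; eauto|]. right. exists r. split; auto. inversion Hr; auto.
Qed.

(** Bounded and purely existential matrices pass upward from the cut by absoluteness. For an
    existential quantifier followed by a universal one, [g] finds for each [u] the least
    counterexample, and closure under [g] keeps it in the cut. *)
Lemma Sigma2_skolem p e s : Sigma 2 p -> ~ sat rA p e s -> exists g, Rc g /\
  forall I I_down I_gr a I_a, (forall x, I x -> I (g x)) ->
  forall s', (forall X x, mem (pj I x) (s' X) <-> s_mem rA (pj I x) (s X)) ->
  forall eN, (forall n, pj I (eN n) = e n) -> ~ sat (Ist I I_down I_gr a I_a) p eN s'.
Proof.
  intros Hp Hn.
  assert (HA : forall q e', Bounded q -> forall I I_down I_gr a I_a s',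
    (forall X x, mem (pj I x) (s' X) <-> s_mem rA (pj I x) (s X)) ->
    forall eN, (forall n, pj I (eN n) = e' n) -> sat (Ist I I_down I_gr a I_a) q eN s' -> sat rA q e' s).
  { intros q e' HB I I_down I_gr a I_a s' Hs eN HE HS. apply sat_mst.
    apply (I_abs I I_down I_gr a I_a _ (s_mem rA) q eN s' s HB Hs) in HS.
    replace e' with (fun n => pj I (eN n)); auto. apply functional_extensionality; auto. }
  apply Sigma2_inv in Hp as [HB|[(q & -> & HB)|(r & -> & HB)]].
  - exists (fun _ => 0). split; [apply Rc_const|]. intros I I_down I_gr a I_a _ s' Hs eN HE HS.
    apply Hn, (HA p e HB I I_down I_gr a I_a s' Hs eN HE HS).
  - exists (fun _ => 0). split; [apply Rc_const|]. intros I I_down I_gr a I_a _ s' Hs eN HE [x HS].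
    apply Hn. exists (pj I x). apply (HA q _ HB I I_down I_gr a I_a s' Hs (x .: eN)); auto.
    intros [|n]; simpl; auto.
  - set (Q := fun u v => ~ sat rA r (v .: u .: e) s).
    assert (HQ : Dl (fun w => Q (fst w) (snd w))).
    { unfold Q. apply Dl_not.
      eapply Dl_ext; [|apply (Dl_sat _ (s_mem rA)) with (p := r) (s := s)
        (E := fun n w => match n with O => snd w | S O => fst w | S (S n) => e n end)];
        [|intro X; exists X; tauto|exact HB|intros [|[|n]]; [apply Rc_snd|apply Rc_fst|apply Rc_const]].
      intro w. cbv beta. rewrite sat_mst. match goal with |- sat _ _ ?u _ <-> sat _ _ ?v _ => replace u with v; [tauto|] end.
      apply functional_extensionality; intros [|[|n]]; reflexivity. }
    assert (HT : forall u, exists v, Q u v).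
    { intro u. apply NNPP. intro H. apply Hn. exists u. intro v. apply NNPP. intro H'. apply H. exists v. exact H'. }
    exists (fun u => mu (Q u)). split; [apply Rc_mu; auto|].
    intros I I_down I_gr a I_a Hg s' Hs eN HE [x HS].
    destruct (pj_ex I _ (Hg _ (pj_in I x))) as [v Hv].
    destruct (mu_spec (Q (pj I x))) as [K _]; auto; [rc|]. apply K. rewrite <- Hv.
    apply (HA r _ HB I I_down I_gr a I_a s' Hs (v .: x .: eN)); auto.
    intros [|[|n]]; simpl; auto.
Qed.

Lemma bounded_env (e : nat -> M) N : exists b, forall n, (n < N)%nat -> e n <= b.
Proof.
  induction N as [|N [b IH]]; [exists 0; lia|]. exists (b + e N). intros n Hn.
  destruct (Nat.eq_dec n N) as [->|]; [ml|]. specialize (IH n ltac:(lia)). ml.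
Qed.

Lemma nonstandard_transfer phi (en : nat -> M) J0 : AllSigma2 phi ->
  (forall x, exists n, en n = x) -> (forall n, num n < J0) ->
  (forall A : struct, (forall q, WKL0_RT22 q -> forall e s, sat A q e s) -> forall e s, sat A (WO_statement phi) e s) ->
  forall e s, sat rA (WO_statement phi) e s.
Proof.
  intros HA en_surj J0_ns Hprov e s.
  (* An environment may be unbounded in the model. Setting it to 0 outside the finitely many free
     variables makes it bounded, so that it fits into the cut. *)
  set (N := ffvN (WO_statement phi)). set (e0 := fun n => if lt_dec n N then e n else 0).
  apply (sat_agree rA (WO_statement phi) e e0 s s); auto.
  { intros n Hn. unfold e0, N. destruct (lt_dec _ _); [reflexivity|contradiction]. }
  destruct (bounded_env e N) as [b Hb].
  assert (Hb0 : forall n, e0 n <= b). { intro n. unfold e0. destruct (lt_dec n N); auto. ml. }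
  intros a Ho Hw. apply sat_Ord in Ho. apply sat_WO in Hw. simpl in Ho, Hw.
  apply (sOrd_iff rA (fun x => x)) in Ho; auto; try tauto; [|intros x y _; exists x; reflexivity].
  apply NNPP. intro Hn.
  destruct (neg_unfold phi HA (a .: e0) s (a + b)) as (p & e' & s' & b' & P1 & P2 & P3 & P4 & P5); auto.
  { intros [|n]; simpl; [ml|]. specialize (Hb0 n). ml. }
  destruct (Sigma2_skolem p e' s' P1 P4) as (g & Hg & Hsk).
  (* One cut serves two ends: closure under [g] preserves the refutation of the matrix, and closure
     under [canb] gives weak Koenig's lemma. *)
  destruct (good_cut (fun x => g x + canb x) ltac:(apply Rc_add; auto using Rc_canb) en en_surj J0 J0_ns a b' Ho Hw)
    as (I & I_b & I_a & I_down & I_gr & I_g & (B & I_B) & I_gap & I_RT & I_kill).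
  set (N1 := Ist I I_down I_gr a I_a).
  assert (HN : forall e s, sat N1 (WO_statement phi) e s).
  { apply Hprov. intros q [Hq|[->| ->]] e1 s1.
    - apply (Ist_RCA0 I I_down I_gr a I_a B I_B I_gap); auto.
    - apply sat_WKL. apply (Ist_WKL I I_down I_gr) with (B := B); auto.
      intros x Hx. apply (I_down _ (g x + canb x)); auto. ml.
    - apply sat_RT. apply Ist_RT; auto. }
  set (tr := fun X : sset rA => setc B (fun x => s_mem rA x X) : sset N1).
  set (a' := exist I a I_a : dom N1).
  assert (HI : forall n, I (e0 n)) by (intro n; apply (I_down _ b'); auto; specialize (Hb0 n); ml).
  set (eN := fun n => exist I (e0 n) (HI n) : dom N1).
  destruct (P5 N1 tr (pj I)) with (eN := a' .: eN) as (eN' & E' & S').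
  - intros y Hy. apply pj_ex. apply (I_down _ b'); auto.
  - intros [|n]; reflexivity.
  - apply HN.
    + apply sat_Ord, Ist_Ord. exact Ho.
    + apply sat_WO. apply (Ist_WO I I_down I_gr a I_a B I_B I_kill). reflexivity.
  - apply (Hsk I I_down I_gr a I_a) in S'; auto.
    + intros x Hx. apply (I_down _ (g x + canb x)); auto. ml.
    + intros X x. unfold tr. rewrite mem_setc by (exists (s' X); tauto).
      pose proof (I_lt_B I I_down B I_B _ (pj_in I x)). tauto.
Qed.
End Transfer.

(** Left transparent, since [rA] of the result has to reduce to [A]. *)
Definition RM_of (A : struct) (X0 : sset A) (HA : forall p, RCA0 p -> forall e s, sat A p e s) : RM.
Proof.
  refine {| rA := A; rS0 := X0 |}.
  - intros p Hp. apply HA. now constructor.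
  - intros p Hp e s H0 HS. pose proof (HA _ (rca_ind p Hp)) as H.
    pose proof (fun e0 s0 => sat_closure _ _ e0 s0 (H e0 s0) e s) as K. specialize (K e s). cbn [sat] in K. apply K. split.
    + apply sat_instN. exact H0.
    + intros x Hx. apply HS in Hx. unfold nextN. apply sat_subst.
      match goal with |- sat _ _ ?u _ => replace u with (s_add A x (s_one A) .: e); [exact Hx|] end.
      apply functional_extensionality; intros [|n]; reflexivity.
  - intros p q Hp Hq e s HE. pose proof (HA _ (rca_comp p q Hp Hq)) as H.
    pose proof (sat_closure _ _ e s (H e s) e s) as K. cbn [sat] in K. destruct K as [X HX].
    + intro x. specialize (HE x). unfold fiff. cbn [sat]. tauto.
    + exists X. intro x. specialize (HX x). unfold fiff in HX. cbn [sat] in HX. rewrite sat_liftS in HX. exact HX.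
Defined.

Lemma RCA0_closed p : RCA0 p -> ffvN p = O /\ ffvS p = O.
Proof. intros [q Hq|q Hq|q r Hq Hr]; try apply closure_closed. destruct Hq; split; reflexivity. Qed.

Fixpoint tnum (n : nat) : term := match n with O => tzero | S n => tplus (tnum n) tone end.

Lemma teval_tnum `{R : RM} n e : teval rA (tnum n) e = num n.
Proof. induction n; simpl; congruence. Qed.

Lemma num_lt `{R : RM} m n : (m < n)%nat -> num m < num n.
Proof.
  induction 1 as [|n _ IH]; simpl; ml.
Qed.

Lemma finite_subtheory (T : theory) (F : nat -> form) L :
  (forall q, In q L -> T q \/ exists n, q = F n) ->
  exists k, forall q, In q L -> T q \/ exists n, (n < k)%nat /\ q = F n.
Proof.
  induction L as [|p L IH]; intro H; [exists O; intros q []|].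
  destruct IH as [k Hk]; [intros q Hq; apply H; now right|].
  destruct (H p (or_introl eq_refl)) as [Hp|[n ->]].
  - exists k. intros q [<-|Hq]; auto.
  - exists (Nat.max k (S n)). intros q [<-|Hq]; [right; exists n; split; auto; lia|].
    destruct (Hk q Hq) as [|(m & Hm & ->)]; auto. right. exists m. split; auto. lia.
Qed.

(* Compactness supplies a model in which the fresh variable [n0] names a nonstandard element. *)
Lemma nonstandard_countermodel psi : ~ Provable RCA0 psi ->
  exists R : RM, (exists en : nat -> M, forall x, exists n, en n = x) /\
    (exists J0, forall n, num n < J0) /\ exists e s, ~ sat rA psi e s.
Proof.
  intro Hn. set (T1 := fun p => RCA0 p \/ p = fnot psi). set (n0 := ffvN psi).
  assert (C1 : forall L, (forall q, In q L -> T1 q) -> ~ nd L fbot).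
  { intros L HL HD. apply Hn.
    exists (filter (fun q => if excluded_middle_informative (RCA0 q) then true else false) L). split.
    - intros q Hq. apply filter_In in Hq as [_ Hq]. destruct (excluded_middle_informative _); [auto|discriminate].
    - apply nd_raa. apply (nd_weak L); auto. intros q Hq. destruct (HL q Hq) as [Hr| ->]; [right|now left].
      apply filter_In. split; auto. destruct (excluded_middle_informative _); [auto|contradiction]. }
  assert (FV : forall p, T1 p -> (ffvN p <= n0)%nat /\ (ffvS p <= ffvS psi)%nat).
  { intros p [Hp| ->]; [apply RCA0_closed in Hp as [-> ->]; lia|]. simpl. unfold n0. lia. }
  assert (RC : forall A e s, (forall p, T1 p -> sat A p e s) -> forall p, RCA0 p -> forall e s, sat A p e s).
  { intros A e s HT p Hp e1 s1. destruct (RCA0_closed p Hp). apply (sat_closed A p) with (e := e) (s := s); auto.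
    apply HT. now left. }
  (* This first model, possibly standard, shows that the extended theory is consistent: finitely
     many of the new axioms hold in it once the fresh variable is given a large standard value. *)
  destruct (model_existence T1 n0 (ffvS psi) FV C1) as (A1 & e1 & s1 & HA1 & _).
  set (F := fun n => flt (tnum n) (tvar n0)). set (T := fun p => T1 p \/ exists n, p = F n).
  destruct (model_existence T (S n0) (ffvS psi)) as (A & e & s & HA & Hen).
  - intros p [Hp|[n ->]]; [apply FV in Hp; lia|]. unfold F. simpl.
    assert (tfv (tnum n) = O) as -> by (induction n; simpl; lia). lia.
  - intros L HL HD. apply finite_subtheory in HL as [k Hk].
    pose (R1 := RM_of A1 (s1 O) (RC A1 e1 s1 HA1)).
    apply (soundness A1 L fbot HD (fun n => if Nat.eq_dec n n0 then @num R1 k else e1 n) s1).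
    intros q Hq. destruct (Hk q Hq) as [HT|(n & Hnk & ->)].
    + apply (sat_agree A1 q _ e1 s1 s1); auto. intros n Hlt. apply FV in HT.
      destruct (Nat.eq_dec n n0); [lia|reflexivity].
    + unfold F. cbn [sat]. simpl teval at 2. destruct (Nat.eq_dec n0 n0) as [_|]; [|contradiction].
      change A1 with (@rA R1). rewrite teval_tnum. apply num_lt, Hnk.
  - assert (HT1 : forall p, T1 p -> sat A p e s) by (intros p Hp; apply HA; now left).
    pose (R := RM_of A (s O) (RC A e s HT1)).
    exists R. split; [exact Hen|]. split.
    + exists (e n0). intro n. rewrite <- (@teval_tnum R n e). apply (HA (F n)). right. now exists n.
    + exists e, s. apply (HT1 (fnot psi)). now right.
Qed.

Theorem theorem3p3 (phi : form) :
  AllSigma2 phi ->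
  Provable WKL0_RT22 (WO_statement phi) ->
  Provable RCA0 (WO_statement phi).
Proof.
  intros HA (G & HG & HD). apply NNPP. intro Hn.
  destruct (nonstandard_countermodel _ Hn) as (R & (en & Hen) & (J0 & HJ) & e & s & Hs).
  apply Hs. apply (nonstandard_transfer phi en J0 HA Hen HJ).
  intros A HT e1 s1. apply (soundness A G _ HD). intros q Hq. apply HT, HG, Hq.
Qed.
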